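(* Let $d,\ell,k$ be positive integers with $k\le \ell$, and let $\Omega\colon S^{d-1}\to G(\ell,k)$ be Hölder continuous and canceling in the sense that $$\bigcap_{\zeta\in S^{d-1}}\Omega(\zeta)=\{0\}.$$ Then the Riesz potential $\mathrm{I}_{d/2}$ maps $W_1^{\Omega}$ to $L_2$ continuously; that is, there is a constant $C$ such that for every $g\in W_1^\Omega$ one has $\mathrm{I}_{d/2}[g]\in L_2(\mathbb{R}^d,\mathbb{C}^\ell)$ and $\|\mathrm{I}_{d/2}[g]\|_{L_2(\mathbb{R}^d,\mathbb{C}^\ell)}\le C\|g\|_{L_1(\mathbb{R}^d,\mathbb{C}^\ell)}$.
   Context: $S^{d-1}$ is the unit sphere in $\mathbb{R}^d$. $G(\ell,k)$ is the complex Grassmannian of all $k$-dimensional linear subspaces of $\mathbb{C}^\ell$, with the metric $\mathrm{dist}(L_1,L_2)=\|\pi_{L_1}-\pi_{L_2}\|_{\mathrm{HS}}$, where $\pi_L$ is the orthogonal projection of $\mathbb{C}^\ell$ onto $L$ and $\|\cdot\|_{\mathrm{HS}}$ is the Hilbert--Schmidt norm on $\ell\times\ell$ complex matrices. A map $F\colon M\to N$ between metric spaces is called Hölder continuous if there are $\alpha>0$ and $C$ such that $\mathrm{dist}_N(F(x),F(y))\le C\,\mathrm{dist}_M(x,y)^\alpha$ for all $x,y\in M$ with $\mathrm{dist}_M(x,y)\le 1$. The space $W_1^\Omega$ is $$W_1^\Omega=\Big\{g\in L_1(\mathbb{R}^d,\mathbb{C}^\ell)\ \Big|\ \hat g(\xi)\in\Omega\big(\xi/|\xi|\big)\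 \text{ for all }\xi\in\mathbb{R}^d\setminus\{0\}\Big\},$$ with the norm inherited from $L_1(\mathbb{R}^d,\mathbb{C}^\ell)$. Here $\hat g$ is the Fourier transform (with any fixed normalization), taken coordinatewise. For $\alpha\in(0,d)$, the Riesz potential $\mathrm{I}_\alpha$ is the Fourier multiplier with symbol $|\xi|^{-\alpha}$, i.e. $\mathrm{I}_\alpha[g]=\mathcal{F}^{-1}\big[|\xi|^{-\alpha}\hat g(\xi)\big]$, understood as a tempered distribution (applied coordinatewise). *)

(* Defs.v *)
From HB Require Import structures.
From mathcomp Require Import all_boot all_order all_algebra.
From mathcomp Require Import all_classical all_reals all_analysis.
From mathcomp Require Import complex.

Set Implicit Arguments.
Unset Strict Implicit.
Unset Printing Implicit Defensive.

Import Order.TTheory GRing.Theory Num.Theory.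
Import numFieldNormedType.Exports.

Local Open Scope classical_set_scope.
Local Open Scope ring_scope.
Local Open Scope complex_scope.

(* R^d is 'rV[R]_d and C^l is 'rV[R[i]]_l. The sigma-algebra on 'rV[R]_n is the
   one generated by the coordinates, i.e. the Borel sigma-algebra. *)
Section RowVectorMeasurable.
Variables (R : realType) (n : nat).

Let coords : 'I_n -> 'rV[R]_n -> R := fun i x => x ord0 i.

Let rV_set0 : g_sigma_preimage coords set0.
Proof. exact: sigma_algebra0. Qed.

Let rV_setC A : g_sigma_preimage coords A -> g_sigma_preimage coords (~` A).
Proof. exact: sigma_algebraC. Qed.

Let rV_bigcup (F : (set 'rV[R]_n)^nat) :
  (forall i, g_sigma_preimage coords (F i)) ->
  g_sigma_preimage coords (\bigcup_i (F i)).
Proof. exact: sigma_algebra_bigcup. Qed.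

HB.instance Definition _ := @isMeasurable.Build default_measure_display
  'rV[R]_n (g_sigma_preimage coords) rV_set0 rV_setC rV_bigcup.

End RowVectorMeasurable.

Section LebesgueMeasure.
Variable R : realType.

Lemma measurable_coord n (i : 'I_n) :
  measurable_fun [set: 'rV[R]_n] (fun x : 'rV[R]_n => x ord0 i).
Proof.
move=> _ Y mY; rewrite setTI; apply: sub_sigma_algebra => /=.
rewrite -bigcup_seq/=; exists i => /=; first by rewrite mem_index_enum.
by exists Y => //; rewrite setTI.
Qed.

Lemma measurable_fun_coordP d (T : measurableType d) n (f : T -> 'rV[R]_n) :
  (forall i, measurable_fun [set: T] (fun x => f x ord0 i)) ->
  measurable_fun [set: T] f.
Proof.
move=> mf.
have sub : \big[setU/set0]_(i < n)
    preimage_set_system setT (fun x : 'rV[R]_n => x ord0 i) measurable `<=`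
    [set B | measurable (f @^-1` B)].
  rewrite -bigcup_seq; apply: bigcup_sub => i _ _ [B mB <-] /=.
  by rewrite setTI; have := mf i measurableT B mB; rewrite setTI.
move=> _ A mA; rewrite setTI; apply: (mA [set B | measurable (f @^-1` B)]).
split=> //; split=> /=.
- by rewrite preimage_set0.
- by move=> B mB; rewrite setTD preimage_setC; exact: measurableC.
- by move=> F mF; rewrite preimage_bigcup; exact: bigcup_measurable.
Qed.

Definition rV_cons n (p : (measurableTypeR R * 'rV[R]_n)%type) : 'rV[R]_n.+1 :=
  \row_i (if unlift ord0 i is Some j then p.2 ord0 j else p.1).

Definition rV_uncons n (x : 'rV[R]_n.+1) :
    (measurableTypeR R * 'rV[R]_n)%type :=
  (x ord0 ord0, \row_j x ord0 (lift ord0 j)).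

Lemma rV_consK n : cancel (@rV_cons n) (@rV_uncons n).
Proof.
move=> [a x]; congr pair; rewrite ?mxE ?unlift_none//=.
by apply/rowP => j; rewrite !mxE liftK.
Qed.

Lemma measurable_rV_cons n :
  measurable_fun [set: (measurableTypeR R * 'rV[R]_n)%type] (@rV_cons n).
Proof.
apply: measurable_fun_coordP => i.
case: (unliftP ord0 i) => [j|] ->.
- rewrite (_ : (fun x => _) = (fun y : 'rV[R]_n => y ord0 j) \o snd); last first.
    by apply/funext => x; rewrite mxE liftK.
  by apply: measurableT_comp; [exact: measurable_coord|exact: measurable_snd].
- rewrite (_ : (fun x => _) = fst); first exact: measurable_fst.
  by apply/funext => x; rewrite mxE unlift_none.
Qed.

Lemma measurable_rV_uncons n : measurable_fun [set: 'rV[R]_n.+1] (@rV_uncons n).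
Proof.
apply/measurable_fun_pair; first exact: measurable_coord.
apply: measurable_fun_coordP => i.
under eq_fun do rewrite mxE.
exact: measurable_coord.
Qed.


(* The Lebesgue measure on R^n is the n-fold product of the one on R, carried to
   row vectors; [lebesgue_rV_box] below gives its value on boxes. Only the case
   of probability measures of the sigma-finite structure of [\x] can be
   inferred, hence the explicit proof of sigma-finiteness. *)
Definition lebesgue_cons n (mu : {sigma_finite_measure set 'rV[R]_n -> \bar R}) :
    set 'rV[R]_n.+1 -> \bar R :=
  pushforward (lebesgue_measure \x mu)%E (@rV_cons n).

Section LebesgueCons.
Variables (n : nat) (mu : {sigma_finite_measure set 'rV[R]_n -> \bar R}).

Let lebesgue_cons0 : lebesgue_cons mu set0 = 0%E.
Proof. by rewrite /lebesgue_cons /pushforward preimage_set0 measure0. Qed.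

Let lebesgue_cons_ge0 A : (0 <= lebesgue_cons mu A)%E.
Proof. by rewrite /lebesgue_cons /pushforward measure_ge0. Qed.

Let lebesgue_cons_sigma_additive : semi_sigma_additive (lebesgue_cons mu).
Proof.
apply: measure_semi_sigma_additive; exact: measurable_rV_cons.
Qed.

HB.instance Definition _ := isMeasure.Build _ _ _ (lebesgue_cons mu)
  lebesgue_cons0 lebesgue_cons_ge0 lebesgue_cons_sigma_additive.

Let lebesgue_cons_sigma_finite : sigma_finite setT (lebesgue_cons mu).
Proof.
have /sigma_finiteP[F [TF ndF Foo]] := sigma_finiteT (@lebesgue_measure R).
have /sigma_finiteP[G [TG ndG Goo]] := sigma_finiteT mu.
exists (fun k => @rV_uncons n @^-1` (F k `*` G k)).
  apply/esym/seteqP; split => // x _.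
  have [k _ Fk] : (\bigcup_k F k) (rV_uncons x).1 by rewrite -TF.
  have [m _ Gm] : (\bigcup_k G k) (rV_uncons x).2 by rewrite -TG.
  exists (maxn k m) => //; split => /=.
  - by move: Fk; exact/subsetPset/ndF/leq_maxl.
  - by move: Gm; exact/subsetPset/ndG/leq_maxr.
move=> k; have [mF Foo'] := Foo k; have [mG Goo'] := Goo k; split.
  rewrite -[X in measurable X]setTI; apply: measurable_rV_uncons => //.
  exact: measurableX.
rewrite /lebesgue_cons /pushforward -comp_preimage.
rewrite (_ : @rV_uncons n \o @rV_cons n = id); last exact/funext/rV_consK.
by rewrite preimage_id product_measure1E// lte_mul_pinfty// ge0_fin_numE.
Qed.

HB.instance Definition _ := Measure_isSigmaFinite.Build _ _ _ (lebesgue_cons mu)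
  lebesgue_cons_sigma_finite.

End LebesgueCons.

Fixpoint lebesgue_rV n : {sigma_finite_measure set 'rV[R]_n -> \bar R} :=
  match n with
  | 0 => \d_(0 : 'rV[R]_0)
  | m.+1 => lebesgue_cons (lebesgue_rV m)
  end.

Lemma measurable_box n (a b : 'I_n -> R) :
  measurable [set x : 'rV[R]_n | forall i, x ord0 i \in `[a i, b i]].
Proof.
rewrite (_ : [set _ | _] = \big[setI/setT]_(i < n)
    ((fun x : 'rV[R]_n => x ord0 i) @^-1` [set` `[a i, b i]])).
  apply: bigsetI_measurable => i _; rewrite -[X in measurable X]setTI.
  exact: measurable_coord.
by rewrite -bigcap_seq; apply/seteqP; split => [x /= xab i _|x /= xab i];
  [exact: xab|apply: xab; rewrite /= mem_index_enum].
Qed.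

Lemma lebesgue_rV_box n (a b : 'I_n -> R) : (forall i, a i <= b i) ->
  lebesgue_rV n [set x | forall i, x ord0 i \in `[a i, b i]] =
  (\prod_(i < n) (b i - a i))%:E.
Proof.
elim: n a b => [|n IH] a b ab /=.
  by rewrite big_ord0 diracE mem_set//=; case.
rewrite /lebesgue_cons /pushforward big_ord_recl EFinM -IH; last by move=> i.
rewrite (_ : _ @^-1` _ = [set` `[a ord0, b ord0]] `*`
    [set x : 'rV[R]_n | forall i,
       x ord0 i \in `[a (lift ord0 i), b (lift ord0 i)]]).
  rewrite product_measure1E//=; last exact: measurable_box.
  rewrite lebesgue_measure_itv/= lte_fin.
  case: ltP => // ba; rewrite (_ : b ord0 = a ord0) ?subrr//.
  by apply/le_anti; rewrite ba ab.
apply/seteqP; split => [[t x] /= xab|[t x] [/= tab xab] i].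
  split=> [|i]; first by have := xab ord0; rewrite mxE unlift_none.
  by have := xab (lift ord0 i); rewrite mxE liftK.
by case: (unliftP ord0 i) => [j|] ->; rewrite mxE ?liftK ?unlift_none.
Qed.

End LebesgueMeasure.

Section EuclideanSpace.
Variables (R : realType) (d : nat).
Implicit Types x y : 'rV[R]_d.

Definition dotr x y : R := \sum_(i < d) x ord0 i * y ord0 i.

Definition enorm x : R := Num.sqrt (dotr x x).

Definition sphere := {x : 'rV[R]_d | enorm x == 1}.

Definition sphere_dist (u v : sphere) : R := enorm (val u - val v).

Lemma enorm_direction x : x != 0 -> enorm ((enorm x)^-1 *: x) == 1.
Proof.
move=> x0; have x_gt0 : 0 < dotr x x.
  have x_ge0 i : 0 <= x ord0 i * x ord0 i by rewrite -expr2 sqr_ge0.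
  rewrite lt_neqAle sumr_ge0 ?andbT// eq_sym psumr_eq0//.
  apply: contra x0 => /allP x0; apply/eqP/rowP => i; rewrite mxE.
  have := x0 i (mem_index_enum i).
  by rewrite mulf_eq0 orbb => /eqP.
rewrite /enorm; set r := Num.sqrt (dotr x x).
have r_gt0 : 0 < r by rewrite sqrtr_gt0.
rewrite (_ : dotr _ _ = 1) ?sqrtr1//.
rewrite /dotr; under eq_bigr do rewrite !mxE mulrACA.
rewrite -mulr_sumr -/(dotr x x) -invfM -expr2 sqr_sqrtr ?ltW//.
by rewrite mulVf// gt_eqF.
Qed.

Definition direction x (x0 : x != 0) : sphere :=
  exist _ ((enorm x)^-1 *: x) (enorm_direction x0).

End EuclideanSpace.

Section Grassmannian.
Variables (R : realType) (l k : nat).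

Definition grassmannian := {L : {vspace 'rV[R[i]]_l} | \dim L == k}.

Definition hs_norm m n (A : 'M[R[i]]_(m, n)) : R :=
  Num.sqrt (\sum_i \sum_j (complex.Re (A i j) ^+ 2 + complex.Im (A i j) ^+ 2)).

(* [proj_ortho A] is the orthogonal projection onto the row space of A, acting
   on row vectors by right multiplication. *)
Definition orthoproj (L : {vspace 'rV[R[i]]_l}) : 'M[R[i]]_l :=
  proj_ortho (\matrix_(i < \dim L) (vbasis L)`_i).

Definition grass_dist (L1 L2 : grassmannian) : R :=
  hs_norm (orthoproj (val L1) - orthoproj (val L2)).

End Grassmannian.

Definition holder_continuous (R : realType) (M N : Type)
    (distM : M -> M -> R) (distN : N -> N -> R) (F : M -> N) : Prop :=
  exists alpha C : R, 0 < alpha /\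
    forall x y, distM x y <= 1 -> distN (F x) (F y) <= C * distM x y `^ alpha.

Section Fourier.
Variables (R : realType) (d : nat).
Implicit Types (f : 'rV[R]_d -> R[i]) (T : ('rV[R]_d -> R[i]) -> R[i]).

Definition cintegral f : R[i] :=
  (\int[lebesgue_rV R d]_x complex.Re (f x)) +i*
  (\int[lebesgue_rV R d]_x complex.Im (f x)).

Definition expi (t : R) : R[i] := cos t +i* sin t.

(* Normalization: the kernel of the Fourier transform is
   e^{-2 pi i <x, xi>}, so that [inv_fourier] has no extra constant. *)
Definition fourier f : 'rV[R]_d -> R[i] :=
  fun xi => cintegral (fun x => expi (- (2 * pi * dotr x xi)) * f x).

Definition inv_fourier f : 'rV[R]_d -> R[i] :=
  fun x => cintegral (fun xi => expi (2 * pi * dotr x xi) * f xi).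

Definition iter_partial (s : seq 'I_d) (f : 'rV[R]_d -> R) : 'rV[R]_d -> R :=
  foldr (fun i h x => 'D_(delta_mx ord0 i) h x) f s.

Definition real_schwartz (f : 'rV[R]_d -> R) : Prop :=
  forall s : seq 'I_d,
    (forall x, differentiable (iter_partial s f) x) /\
    forall N : nat, exists C : R,
      forall x, enorm x ^+ N * `|iter_partial s f x| <= C.

(* R[i] carries no normed module structure over R, so smoothness and decay are
   imposed on the real and imaginary parts. *)
Definition schwartz f : Prop :=
  real_schwartz (fun x => complex.Re (f x)) /\
  real_schwartz (fun x => complex.Im (f x)).

(* A tempered distribution is given by its values on Schwartz functions: a
   functional on all functions 'rV[R]_d -> R[i] is used only through its
   restriction to Schwartz functions, see [distr_eq]. *)
Definition distr_of f : ('rV[R]_d -> R[i]) -> R[i] :=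
  fun phi => cintegral (fun x => f x * phi x).

Definition distr_inv_fourier T : ('rV[R]_d -> R[i]) -> R[i] :=
  fun phi => T (inv_fourier phi).

Definition distr_eq T1 T2 : Prop := forall phi, schwartz phi -> T1 phi = T2 phi.

(* [powR] sends 0 to 0 for a nonzero exponent, so the symbol takes the value 0
   at xi = 0, a null set. *)
Definition riesz_potential (alpha : R) f : ('rV[R]_d -> R[i]) -> R[i] :=
  distr_inv_fourier
    (distr_of (fun xi => (enorm xi `^ (- alpha))%:C * fourier f xi)).

End Fourier.

Section VectorValued.
Variables (R : realType) (d l : nat).
Implicit Types f g : 'rV[R]_d -> 'rV[R[i]]_l.

Definition Lp_norm (p : \bar R) f : \bar R :=
  Lnorm (lebesgue_rV R d) p (fun x => (hs_norm (f x))%:E).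

Definition in_Lp (p : \bar R) f : Prop :=
  (forall j, measurable_fun setT (fun x => complex.Re (f x ord0 j)) /\
             measurable_fun setT (fun x => complex.Im (f x ord0 j))) /\
  (Lp_norm p f < +oo)%E.

Definition vfourier f : 'rV[R]_d -> 'rV[R[i]]_l :=
  fun xi => \row_j fourier (fun x => f x ord0 j) xi.

Definition W1 k (Omega : sphere R d -> grassmannian R l k) g : Prop :=
  in_Lp 1%:E g /\
  forall (xi : 'rV[R]_d) (xi0 : xi != 0),
    vfourier g xi \in val (Omega (direction xi0)).

(* The distribution I_alpha[g] is (coordinatewise) the function f. *)
Definition riesz_potential_is (alpha : R) g f : Prop :=
  forall j : 'I_l, distr_eq (distr_of (fun x => f x ord0 j))
                            (riesz_potential alpha (fun x => g x ord0 j)).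

Definition canceling k (Omega : sphere R d -> grassmannian R l k) : Prop :=
  \bigcap_(z in [set: sphere R d]) [set v | v \in val (Omega z)] = [set 0].

End VectorValued.

(* Main.v *)
Require Import Defs.
From mathcomp Require Import all_boot all_order all_algebra spectral.
From mathcomp Require Import all_classical all_reals all_analysis.
From mathcomp Require Import measurable_realfun complex.
From mathcomp Require Import ring lra.

Set Implicit Arguments.
Unset Strict Implicit.
Unset Printing Implicit Defensive.

Import Order.TTheory GRing.Theory Num.Theory.
Import numFieldNormedType.Exports.

Local Open Scope classical_set_scope.
Local Open Scope ring_scope.
Local Open Scope complex_scope.

(* By Plancherel the claim is the estimate int |x|^-d |g^(x)|^2 dx <= C |g|_1^2.
   Write P(x) for the orthogonal projection onto Omega(x/|x|) and w for a radial
   bump supported in 1/2 <= |x| <= 4. The canceling condition makes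
   A = int w (1 - P) invertible, so with B = (int w) A^-1 the Hoelder continuous
   symbol F = w (1 - (1 - P) B) has integral zero, while v F v* = w |v|^2 for
   every v in the fibre. Hence sum_i (2^i)^d F(2^i x), paired with g^ and its
   conjugate, dominates |x|^-d |g^|^2. In physical space this pairing is a
   bilinear form in g with kernel sum_i F^(2^-i (x - y)), which is bounded: the
   mean zero property gives |F^(z)| <= C |z| and Hoelder continuity gives
   |F^(z)| <= C |z|^-alpha, so both ends of the sum are geometric.

   The function f itself is obtained from h = |x|^(-d/2) g^ in L^2: by a Bessel
   inequality the Fourier transforms of truncations of h form a Cauchy sequence
   in L^2, and a fast subsequence converges almost everywhere. *)

(** * Lebesgue measure on row vectors *)

(** The obstacle is logarithmic: for a bump f with nonzero integral, every term f^(2^-i z) with |z|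
    small against 2^i is close to that integral, so summing over scales diverges. The mean must
    therefore vanish exactly, while the symbol must keep its values on the fibres. Both are possible
    because v (1 - P) = 0 for v in the fibre: multiplying w (1 - P) on the right by any constant
    matrix is invisible to v F v*, and the integral of F is (int w) 1 - A B, which a suitable B
    kills as soon as A is invertible. Only finitely many scales are summed at a time, with a bound
    uniform in their number and in the overall dilation; exhausting the space by annuli 2^-J <= |x|
    <= 2^J then recovers the full weight |x|^-d by monotone convergence. The L^2 bound for the
    Fourier transform comes from inserting a wide tent function: its transform is explicit and is
    dominated by a dilated product of Cauchy profiles, whose integral does not depend on the width.
    The same bilinear identity [fourier_bilinear] serves there, with an integrable kernel, and in
    the energy estimate, with a bounded one. *)

Section AffineChange.
Variable R : realType.
Local Notation leb := (@lebesgue_measure R).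

Lemma measurable_affine (a b : R) :
  measurable_fun [set: R] (fun x => a * x + b).
Proof. by apply: measurable_funD => //; exact: mulrl_measurable. Qed.

(** The rescaled pushforward is a measure giving every interval ]x, y] its length, so uniqueness of
    Lebesgue measure identifies it. *)
Lemma lebesgue_measure_affine (a b : R) (A : set R) : 0 < a -> measurable A ->
  (a%:E * pushforward leb ((fun x => a * x + b)%R : _ -> measurableTypeR R) A = leb A)%E.
Proof.
move=> a0 mA.
pose f : measurableTypeR R -> measurableTypeR R := fun x => a * x + b.
have mf : measurable_fun setT f by exact: measurable_affine.
rewrite -[LHS]/(mscale (NngNum (ltW a0))
  (measure_function_pushforward__canonical__measure_function_Measure leb mf) A).
apply/esym/lebesgue_measure_unique => // _ [[x y]] _ <- /=.
rewrite /mscale /= /pushforward.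
have -> : f @^-1` [set` `]x, y]] = [set` `](x - b) / a, (y - b) / a]].
  apply/seteqP; split => t /=; rewrite !in_itv/= /f ltr_pdivrMr// ler_pdivlMr//;
  by rewrite ltrBlDr lerBrDr mulrC.
rewrite !lebesgue_measure_itv/= !lte_fin ltr_pM2r ?invr_gt0// ltrD2r.
case: ifP => _; last by rewrite mule0.
by rewrite -!EFinD -!EFinM; congr EFin; field; exact: lt0r_neq0.
Qed.

Lemma ge0_integral_affine1 (a b : R) (f : R -> \bar R) : 0 < a ->
  measurable_fun setT f -> (forall x, 0 <= f x)%E ->
  (a%:E * \int[leb]_x f (a * x + b)%R = \int[leb]_x f x)%E.
Proof.
move=> a0 mf f0.
pose h : measurableTypeR R -> measurableTypeR R := fun x => a * x + b.
have mh : measurable_fun setT h by exact: measurable_affine.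
have := @ge0_integral_pushforward _ _ _ _ R h mh leb setT f measurableT mf
  (fun x _ => f0 x).
rewrite preimage_setT /= => <-.
rewrite -(ge0_integral_mscale _ measurableT (NngNum (ltW a0)))//.
by apply: eq_measure_integral => A mA _ /=; rewrite /mscale/= lebesgue_measure_affine.
Qed.

End AffineChange.

(** * Changes of variables, Tonelli and measurability in dimension n *)

Section RowVectors.
Variable R : realType.
Local Notation leb := (@lebesgue_measure R).
Local Notation mu := (lebesgue_rV R).

Lemma ge0_integral_rV_cons n (f : 'rV[R]_n.+1 -> \bar R) :
  measurable_fun setT f -> (forall x, 0 <= f x)%E ->
  (\int[mu n.+1]_x f x = \int[leb]_t \int[mu n]_x f (rV_cons (t, x)))%E.
Proof.
move=> mf f0.
have := @ge0_integral_pushforward _ _ _ _ R _ (@measurable_rV_cons R n)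
  (leb \x mu n)%E setT f measurableT mf (fun x _ => f0 x).
rewrite preimage_setT => H.
transitivity (\int[(leb \x mu n)%E]_x (f \o (@rV_cons R n)) x)%E; first exact: H.
rewrite fubini_tonelli1//; last by move=> x; exact: f0.
by apply: measurableT_comp => //; exact: measurable_rV_cons.
Qed.

Lemma measurable_row_affine n (a : R) (b : 'rV[R]_n) :
  measurable_fun [set: 'rV[R]_n] (fun x : 'rV[R]_n => a *: x + b).
Proof.
apply: measurable_fun_coordP => i; under eq_fun do rewrite !mxE.
apply: measurable_funD => //; apply: measurable_funM => //.
exact: measurable_coord.
Qed.

(** Induction on the dimension: Tonelli splits off the first coordinate, which contributes one
    factor a by the one-dimensional case. In dimension 0 the space is a point and a^0 = 1. *)
Lemma ge0_integral_affine n (a : R) (b : 'rV[R]_n) (f : 'rV[R]_n -> \bar R) :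
  0 < a -> measurable_fun setT f -> (forall x, 0 <= f x)%E ->
  ((a ^+ n)%:E * \int[mu n]_x f (a *: x + b)%R = \int[mu n]_x f x)%E.
Proof.
elim: n b f => [|n IH] b f a0 mf f0.
  rewrite expr0 mul1e; apply: eq_integral => x _.
  by congr f; apply/rowP; case.
pose b' : 'rV[R]_n := \row_j b ord0 (lift ord0 j).
have mfc : measurable_fun [set: measurableTypeR R * 'rV[R]_n]%type
    (fun z => f (rV_cons z)).
  by apply: measurableT_comp => //; exact: measurable_rV_cons.
rewrite !ge0_integral_rV_cons//; last first.
  by apply: measurableT_comp => //; exact: measurable_row_affine.
have E t x : f (a *: rV_cons (t, x) + b) =
    f (rV_cons (a * t + b ord0 ord0, a *: x + b')).
  congr f; apply/rowP => i; rewrite !mxE.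
  by case: (unliftP ord0 i) => [j ->|->]; rewrite /= ?mxE.
under eq_integral do under eq_integral do rewrite E.
pose g t := (\int[mu n]_x f (rV_cons (t, x)))%E.
have mg : measurable_fun setT g.
  exact: (@measurable_fun_fubini_tonelli_F _ _ _ _ _ (mu n) (fun z => f (rV_cons z))).
have g0 t : (0 <= g t)%E by exact: integral_ge0.
rewrite exprS EFinM -muleA.
transitivity (a%:E * \int[leb]_t g (a * t + b ord0 ord0)%R)%E; last first.
  exact: ge0_integral_affine1.
congr (_ * _)%E.
rewrite -ge0_integralZl//; last 3 first.
- apply: (@measurable_fun_fubini_tonelli_F _ _ _ _ _ (mu n)
    (fun z => f (rV_cons (a * z.1 + b ord0 ord0, a *: z.2 + b')))) => //.
  apply: (measurableT_comp mfc); apply/measurable_fun_pair => /=.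
    exact: (measurableT_comp (measurable_affine a _) measurable_fst).
  exact: (measurableT_comp (measurable_row_affine a _) measurable_snd).
- by move=> t _; exact: integral_ge0.
- by rewrite lee_fin exprn_ge0// ltW.
apply: eq_integral => t _.
rewrite (IH b' (fun x => f (rV_cons (a * t + b ord0 ord0, x))))//.
exact: (measurableT_comp mfc (measurable_pair1 _)).
Qed.

Lemma ge0_integral_shift n (b : 'rV[R]_n) (f : 'rV[R]_n -> \bar R) :
  measurable_fun setT f -> (forall x, 0 <= f x)%E ->
  (\int[mu n]_x f (x + b)%R = \int[mu n]_x f x)%E.
Proof.
move=> mf f0; rewrite -(@ge0_integral_affine n 1 b f)//.
by rewrite expr1n mul1e; apply: eq_integral => x _; rewrite scale1r.
Qed.

Lemma ge0_integral_dilate n (a : R) (f : 'rV[R]_n -> \bar R) : 0 < a ->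
  measurable_fun setT f -> (forall x, 0 <= f x)%E ->
  ((a ^+ n)%:E * \int[mu n]_x f (a *: x)%R = \int[mu n]_x f x)%E.
Proof.
move=> a0 mf f0; rewrite -(@ge0_integral_affine n a 0 f)//.
by congr (_ * _)%E; apply: eq_integral => x _; rewrite addr0.
Qed.

Lemma ge0_integral_prod n (h : R -> R) :
  measurable_fun setT h -> (forall x, 0 <= h x) ->
  (\int[mu n]_x (\prod_(i < n) h (x ord0 i))%:E = (\int[leb]_t (h t)%:E) ^+ n)%E.
Proof.
move=> mh h0; elim: n => [|n IH].
  under eq_integral do rewrite big_ord0.
  by rewrite integral_cst//= diracT mule1.
rewrite ge0_integral_rV_cons; last 2 first.
- apply/measurable_EFinP; apply: measurable_prod => i _.
  by apply: measurableT_comp => //; exact: measurable_coord.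
- by move=> x; rewrite lee_fin prodr_ge0.
rewrite expeS -IH -ge0_integralZr//; last 3 first.
- exact/measurable_EFinP.
- by move=> x _; rewrite lee_fin.
- by apply: integral_ge0 => x _; rewrite lee_fin prodr_ge0.
apply: eq_integral => t _.
rewrite -ge0_integralZl//; last 3 first.
- apply/measurable_EFinP; apply: measurable_prod => i _.
  by apply: measurableT_comp => //; exact: measurable_coord.
- by move=> x _; rewrite lee_fin prodr_ge0.
- by rewrite lee_fin.
apply: eq_integral => x _; rewrite -EFinM; congr EFin.
rewrite big_ord_recl mxE unlift_none/=; congr (_ * _).
by apply: eq_bigr => i _; rewrite mxE liftK.
Qed.

Lemma measurable_dotr d (T : measurableType d) n (f g : T -> 'rV[R]_n) :
  measurable_fun setT f -> measurable_fun setT g ->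
  measurable_fun setT (fun x => dotr (f x) (g x)).
Proof.
move=> mf mg; apply: measurable_sum => i.
by apply: measurable_funM; apply: (measurableT_comp (@measurable_coord R n i)).
Qed.

Lemma measurable_enorm n : measurable_fun setT (@enorm R n).
Proof.
rewrite (_ : @enorm R n = Num.sqrt \o (fun x => dotr x x))//.
apply: measurableT_comp.
  by apply: continuous_measurable_fun; exact: sqrt_continuous.
by apply: measurable_dotr; exact: measurable_id.
Qed.

(** The sigma-algebra is generated by the coordinates, so its relation to open sets has to be
    proved. Rounding x down to the grid of mesh 1/(k+1) gives functions with countably many values,
    each taken on a product of intervals; by continuity they converge pointwise to f. *)
Lemma continuous_measurable_rV n (f : 'rV[R]_n -> R) : continuous f ->
  measurable_fun setT f.
Proof.
move=> cf.
pose q (k : nat) (x : 'rV[R]_n) : 'rV[int]_n := \row_i Num.floor (k.+1%:R * x ord0 i).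
pose u (k : nat) (v : 'rV[int]_n) : 'rV[R]_n := \row_i ((v ord0 i)%:~R / k.+1%:R).
apply: (@measurable_fun_cvg _ _ _ setT (fun k x => f (u k (q k x)))) => //.
  move=> k _ Y mY; rewrite setTI.
  rewrite (_ : _ @^-1` Y = \bigcup_v (if f (u k v) \in Y then q k @^-1` [set v] else set0)).
    apply: countable_bigcupT_measurable; first exact: countableP.
    move=> v; case: ifP => // _.
    rewrite (_ : _ @^-1` _ = \big[setI/setT]_(i < n)
      [set x : 'rV[R]_n | k.+1%:R * x ord0 i \in `[(v ord0 i)%:~R, (v ord0 i)%:~R + 1[]).
      apply: bigsetI_measurable => i _.
      have mc : measurable_fun setT (fun x : 'rV[R]_n => k.+1%:R * x ord0 i).
        apply: measurable_funM => //; exact: measurable_coord.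
      have := mc measurableT `[(v ord0 i)%:~R, (v ord0 i)%:~R + 1[%classic.
      by rewrite setTI; apply.
    rewrite -bigcap_seq; apply/seteqP; split => x /=.
      move=> <- i _ /=; rewrite in_itv/= mxE; have := floor_itv (k.+1%:R * x ord0 i); by rewrite intrD; exact.
    move=> H; apply/rowP => i; rewrite mxE; apply: floor_def.
    have := H i; rewrite /= mem_index_enum in_itv/= intrD; apply => //.
  apply/seteqP; split => x /=.
    by move=> fY; exists (q k x) => //; rewrite mem_set.
  by case=> v _; case: ifP => // /set_mem fY /= ->.
move=> x _.
apply: (@cvg_comp _ _ _ (fun k => u k (q k x)) f _ (nbhs x)); last exact: cf.
apply/cvg_ballP => e e0; near=> k.
split=> // i j; rewrite !mxE /ball /= ord1.
have k0 : 0 < k.+1%:R :> R by [].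
rewrite (_ : _ - _ = (k.+1%:R * x ord0 j - (Num.floor (k.+1%:R * x ord0 j))%:~R) / k.+1%:R); last first.
  by field; rewrite addrC natr1 pnatr_eq0.
have /andP[h1 h2] := floor_itv (k.+1%:R * x ord0 j).
rewrite ger0_norm; last by rewrite divr_ge0// subr_ge0.
apply: (@le_lt_trans _ _ (k.+1%:R^-1)).
  rewrite ler_pdivrMr// mulVf// lerBlDl ltW//.
  by move: h2; by rewrite intrD; exact.
near: k; exact: near_infty_natSinv_lt (PosNum e0).
Unshelve. all: by end_near. Qed.

End RowVectors.

(** * Complex-valued functions *)

Section ComplexNorm.
Variable R : realType.
Implicit Types z w : R[i].

(* The l^1 norm on C = R^2: it is submultiplicative and equivalent to the
   modulus, and unlike the modulus it needs no square root. *)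
Definition norm1 z : R := `|complex.Re z| + `|complex.Im z|.

Lemma norm1_ge0 z : 0 <= norm1 z. Proof. exact: addr_ge0. Qed.

Lemma ler_norm1_Re z : `|complex.Re z| <= norm1 z.
Proof. by rewrite /norm1 lerDl. Qed.

Lemma ler_norm1_Im z : `|complex.Im z| <= norm1 z.
Proof. by rewrite /norm1 lerDr. Qed.

Lemma ReD z w : complex.Re (z + w) = complex.Re z + complex.Re w.
Proof. by case: z w => [? ?] []. Qed.

Lemma ImD z w : complex.Im (z + w) = complex.Im z + complex.Im w.
Proof. by case: z w => [? ?] []. Qed.

Lemma ReN z : complex.Re (- z) = - complex.Re z. Proof. by case: z. Qed.

Lemma ImN z : complex.Im (- z) = - complex.Im z. Proof. by case: z. Qed.

Lemma ReM z w : complex.Re (z * w) =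
  complex.Re z * complex.Re w - complex.Im z * complex.Im w.
Proof. by case: z w => [? ?] []. Qed.

Lemma ImM z w : complex.Im (z * w) =
  complex.Re z * complex.Im w + complex.Im z * complex.Re w.
Proof. by case: z w => [? ?] []. Qed.

Lemma Re_conj z : complex.Re (conjc z) = complex.Re z. Proof. by case: z. Qed.

Lemma Im_conj z : complex.Im (conjc z) = - complex.Im z. Proof. by case: z. Qed.

Definition ReImE := (ReD, ImD, ReN, ImN, ReM, ImM, Re_conj, Im_conj).

Lemma complex_ext z w :
  complex.Re z = complex.Re w -> complex.Im z = complex.Im w -> z = w.
Proof. by case: z w => [? ?] [? ?] /= -> ->. Qed.

Lemma norm1_0 : norm1 0 = 0. Proof. by rewrite /norm1 /= normr0 addr0. Qed.

Lemma norm1_real (x : R) : norm1 x%:C = `|x|.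
Proof. by rewrite /norm1 /= normr0 addr0. Qed.

Lemma norm1N z : norm1 (- z) = norm1 z.
Proof. by rewrite /norm1 !ReImE !normrN. Qed.

Lemma norm1_conj z : norm1 (conjc z) = norm1 z.
Proof. by rewrite /norm1 !ReImE normrN. Qed.

Lemma ler_norm1D z w : norm1 (z + w) <= norm1 z + norm1 w.
Proof. by rewrite /norm1 !ReImE addrACA lerD// ler_normD. Qed.

Lemma ler_norm1M z w : norm1 (z * w) <= norm1 z * norm1 w.
Proof.
rewrite /norm1 !ReImE mulrDr !mulrDl -!normrM.
set a := complex.Re z; set b := complex.Im z.
set c := complex.Re w; set e := complex.Im w.
have := ler_normB (a * c) (b * e); have := ler_normD (a * e) (b * c); lra.
Qed.

Lemma norm1_sum (I : Type) (r : seq I) (F : I -> R[i]) :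
  norm1 (\sum_(i <- r) F i) <= \sum_(i <- r) norm1 (F i).
Proof.
elim: r => [|i r IH]; first by rewrite !big_nil norm1_0.
by rewrite !big_cons (le_trans (ler_norm1D _ _))// lerD2l.
Qed.

Lemma ler_norm1_expi (t : R) : norm1 (expi t) <= 2.
Proof. by rewrite /norm1 /= -[2]/(1 + 1) lerD// ler_norml ?cos_geN1 ?cos_le1 ?sin_geN1 ?sin_le1. Qed.

Lemma expiD (s t : R) : expi (s + t) = expi s * expi t.
Proof. by apply: complex_ext; rewrite !ReImE /= ?cosD ?sinD//; ring. Qed.

Lemma conjcM z w : conjc (z * w) = conjc z * conjc w.
Proof. by apply: complex_ext; rewrite !ReImE; ring. Qed.

Lemma conj_expi (t : R) : conjc (expi t) = expi (- t).
Proof. by rewrite /expi /= cosN sinN. Qed.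

Lemma expi0 : expi (0 : R) = 1.
Proof. by rewrite /expi cos0 sin0. Qed.

Definition sqnorm z : R := complex.Re z ^+ 2 + complex.Im z ^+ 2.

Lemma sqnorm_ge0 z : 0 <= sqnorm z. Proof. by rewrite addr_ge0 ?sqr_ge0. Qed.

Lemma mul_conj_sqnorm z : z * conjc z = (sqnorm z)%:C.
Proof. by apply: complex_ext; rewrite !ReImE /= /sqnorm; ring. Qed.

Lemma sqnorm_le z : sqnorm z <= norm1 z ^+ 2.
Proof.
rewrite /norm1 sqrrD !real_normK ?num_real//.
have : 0 <= `|complex.Re z| * `|complex.Im z| by exact: mulr_ge0.
rewrite /sqnorm; lra.
Qed.

Lemma norm1_sqr_le z : norm1 z ^+ 2 <= 2 * sqnorm z.
Proof.
rewrite -subr_ge0.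
have := sqr_ge0 (`|complex.Re z| - `|complex.Im z|).
rewrite /norm1 sqrrB sqrrD !real_normK ?num_real// /sqnorm => h.
apply: le_trans h _; rewrite le_eqVlt; apply/orP; left; apply/eqP; ring.
Qed.

End ComplexNorm.

Section ComplexMeasurable.
Context d (T : measurableType d) (R : realType).
Implicit Types f g : T -> R[i].

Definition cmeasurable f :=
  measurable_fun setT (fun x => complex.Re (f x)) /\
  measurable_fun setT (fun x => complex.Im (f x)).

Lemma cmeasurable_cst (c : R[i]) : cmeasurable (fun=> c).
Proof. by split; exact: measurable_cst. Qed.

Lemma cmeasurable_real (h : T -> R) : measurable_fun setT h ->
  cmeasurable (fun x => (h x)%:C).
Proof. by move=> mh; split => //; exact: measurable_cst. Qed.

Lemma cmeasurableD f g : cmeasurable f -> cmeasurable g ->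
  cmeasurable (fun x => f x + g x).
Proof.
move=> [mf1 mf2] [mg1 mg2]; split.
- by under eq_fun do rewrite ReD; exact: measurable_funD.
- by under eq_fun do rewrite ImD; exact: measurable_funD.
Qed.

Lemma cmeasurableN f : cmeasurable f -> cmeasurable (fun x => - f x).
Proof.
move=> [mf1 mf2]; split.
- by under eq_fun do rewrite ReN; exact: measurableT_comp.
- by under eq_fun do rewrite ImN; exact: measurableT_comp.
Qed.

Lemma cmeasurableB f g : cmeasurable f -> cmeasurable g ->
  cmeasurable (fun x => f x - g x).
Proof. by move=> mf mg; apply: cmeasurableD => //; exact: cmeasurableN. Qed.

Lemma cmeasurableM f g : cmeasurable f -> cmeasurable g ->
  cmeasurable (fun x => f x * g x).
Proof.
move=> [mf1 mf2] [mg1 mg2]; split.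
- by under eq_fun do rewrite ReM; apply: measurable_funB; exact: measurable_funM.
- by under eq_fun do rewrite ImM; apply: measurable_funD; exact: measurable_funM.
Qed.

Lemma cmeasurable_conj f : cmeasurable f -> cmeasurable (fun x => conjc (f x)).
Proof.
move=> [mf1 mf2]; split; first by under eq_fun do rewrite Re_conj.
by under eq_fun do rewrite Im_conj; exact: measurableT_comp.
Qed.

Lemma cmeasurable_expi (h : T -> R) : measurable_fun setT h ->
  cmeasurable (fun x => expi (h x)).
Proof.
move=> mh; split => /=.
- apply: (measurableT_comp (f := @cos R)) => //.
  by apply: continuous_measurable_fun; exact: continuous_cos.
- apply: (measurableT_comp (f := @sin R)) => //.
  by apply: continuous_measurable_fun; exact: continuous_sin.
Qed.

Lemma measurable_norm1 f : cmeasurable f ->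
  measurable_fun setT (fun x => norm1 (f x)).
Proof. by move=> [mf1 mf2]; apply: measurable_funD; exact: measurableT_comp. Qed.

Lemma measurable_sqnorm f : cmeasurable f ->
  measurable_fun setT (fun x => sqnorm (f x)).
Proof. by move=> [mf1 mf2]; apply: measurable_funD; exact: measurable_funX. Qed.

End ComplexMeasurable.

Lemma cmeasurable_comp d1 d2 (T1 : measurableType d1) (T2 : measurableType d2)
    (R : realType) (h : T1 -> T2) (f : T2 -> R[i]) :
  measurable_fun setT h -> cmeasurable f -> cmeasurable (fun x => f (h x)).
Proof.
move=> mh [mf1 mf2]; split.
- exact: (measurableT_comp mf1 mh).
- exact: (measurableT_comp mf2 mh).
Qed.

(** * Calculus of the complex integral *)

Section ComplexIntegral.
Variables (R : realType) (n : nat).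
Local Notation T := 'rV[R]_n.
Local Notation mu := (lebesgue_rV R n).
Implicit Types f g : T -> R[i].

Definition cintegrable f := cmeasurable f /\
  (\int[mu]_x (norm1 (f x))%:E < +oo)%E.

Lemma cintegrable_le f (h : T -> R) : cmeasurable f ->
  measurable_fun setT h -> (forall x, norm1 (f x) <= h x) ->
  (\int[mu]_x (h x)%:E < +oo)%E -> cintegrable f.
Proof.
move=> mf mh fh ih; split => //; apply: le_lt_trans ih.
apply: ge0_le_integral => //.
- by move=> x _; rewrite lee_fin norm1_ge0.
- by apply/measurable_EFinP; exact: measurable_norm1.
- exact/measurable_EFinP.
- by move=> x _; rewrite lee_fin.
Qed.

Lemma cintegrable_Re f : cintegrable f ->
  mu.-integrable setT (EFin \o (fun x => complex.Re (f x))).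
Proof.
move=> [[m1 m2] fi]; apply/integrableP; split; first exact/measurable_EFinP.
apply: le_lt_trans fi; apply: ge0_le_integral => //.
- by do 2 apply: measurableT_comp => //.
- by apply/measurable_EFinP; exact: measurable_norm1.
- by move=> x _; rewrite /= lee_fin ler_norm1_Re.
Qed.

Lemma cintegrable_Im f : cintegrable f ->
  mu.-integrable setT (EFin \o (fun x => complex.Im (f x))).
Proof.
move=> [[m1 m2] fi]; apply/integrableP; split; first exact/measurable_EFinP.
apply: le_lt_trans fi; apply: ge0_le_integral => //.
- by do 2 apply: measurableT_comp => //.
- by apply/measurable_EFinP; exact: measurable_norm1.
- by move=> x _; rewrite /= lee_fin ler_norm1_Im.
Qed.

Lemma cintegrable_norm1 f : cintegrable f ->
  mu.-integrable setT (EFin \o (fun x => norm1 (f x))).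
Proof.
move=> [mf fi]; apply/integrableP; split.
  by apply/measurable_EFinP; exact: measurable_norm1.
by under eq_integral do rewrite /= ger0_norm ?norm1_ge0//.
Qed.

Lemma cintegrable0 : cintegrable (fun=> 0).
Proof.
split; first exact: cmeasurable_cst.
by under eq_integral do rewrite norm1_0; rewrite integral0.
Qed.

Lemma cintegrable_real (h : T -> R) : measurable_fun setT h ->
  (\int[mu]_x `|h x|%:E < +oo)%E -> cintegrable (fun x => (h x)%:C).
Proof.
move=> mh ih; split; first exact: cmeasurable_real.
by under eq_integral do rewrite norm1_real.
Qed.

Lemma cintegrableD f g : cintegrable f -> cintegrable g ->
  cintegrable (fun x => f x + g x).
Proof.
move=> [mf fi] [mg gi].
apply: (@cintegrable_le _ (fun x => norm1 (f x) + norm1 (g x))).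
- exact: cmeasurableD.
- by apply: measurable_funD; exact: measurable_norm1.
- by move=> x; exact: ler_norm1D.
- under eq_integral do rewrite EFinD.
  rewrite ge0_integralD//; first exact: lte_add_pinfty.
  + by move=> x _; rewrite lee_fin norm1_ge0.
  + by apply/measurable_EFinP; exact: measurable_norm1.
  + by move=> x _; rewrite lee_fin norm1_ge0.
  + by apply/measurable_EFinP; exact: measurable_norm1.
Qed.

Lemma cintegrable_boundedM f g (C : R) : cmeasurable f ->
  (forall x, norm1 (f x) <= C) -> cintegrable g ->
  cintegrable (fun x => f x * g x).
Proof.
move=> mf fC [mg gi].
apply: (@cintegrable_le _ (fun x => C * norm1 (g x))).
- exact: cmeasurableM.
- by apply: measurable_funM => //; exact: measurable_norm1.
- by move=> x; rewrite (le_trans (ler_norm1M _ _))// ler_wpM2r// norm1_ge0.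
- have C0 : 0 <= C by rewrite (le_trans (norm1_ge0 (f 0))).
  under eq_integral do rewrite EFinM.
  rewrite ge0_integralZl//.
  + exact: lte_mul_pinfty.
  + by apply/measurable_EFinP; exact: measurable_norm1.
  + by move=> x _; rewrite lee_fin norm1_ge0.
Qed.

Lemma cintegrableZ (c : R[i]) f : cintegrable f ->
  cintegrable (fun x => c * f x).
Proof.
by apply: (@cintegrable_boundedM _ _ (norm1 c)) => //; exact: cmeasurable_cst.
Qed.

Lemma cintegrableN f : cintegrable f -> cintegrable (fun x => - f x).
Proof.
move=> [mf fi]; split; first exact: cmeasurableN.
by under eq_integral do rewrite norm1N.
Qed.

Lemma cintegrableB f g : cintegrable f -> cintegrable g ->
  cintegrable (fun x => f x - g x).
Proof. by move=> fi gi; apply: cintegrableD => //; exact: cintegrableN. Qed.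

Lemma cintegrable_conj f : cintegrable f -> cintegrable (fun x => conjc (f x)).
Proof.
move=> [mf fi]; split; first exact: cmeasurable_conj.
by under eq_integral do rewrite norm1_conj.
Qed.

Lemma cintegrable_sum (I : Type) (r : seq I) (F : I -> T -> R[i]) :
  (forall i, cintegrable (F i)) -> cintegrable (fun x => \sum_(i <- r) F i x).
Proof.
move=> mF; elim: r => [|i r IH].
  by under eq_fun do rewrite big_nil; exact: cintegrable0.
by under eq_fun do rewrite big_cons; exact: cintegrableD.
Qed.

Lemma cintegralD f g : cintegrable f -> cintegrable g ->
  cintegral (fun x => f x + g x) = cintegral f + cintegral g.
Proof.
move=> fi gi; apply: complex_ext; rewrite !ReImE /cintegral /=.
- under eq_Rintegral do rewrite ReD.
  by rewrite RintegralD//; exact: cintegrable_Re.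
- under eq_Rintegral do rewrite ImD.
  by rewrite RintegralD//; exact: cintegrable_Im.
Qed.

Lemma cintegralZ (c : R[i]) f : cintegrable f ->
  cintegral (fun x => c * f x) = c * cintegral f.
Proof.
move=> fi; have fr := cintegrable_Re fi; have fm := cintegrable_Im fi.
have Z (a : R) (h : T -> R) : mu.-integrable setT (EFin \o h) ->
    mu.-integrable setT (EFin \o (fun x => a * h x)).
  move=> ih; rewrite (_ : _ \o _ = (fun x => a%:E * (EFin \o h) x)%E).
    exact: integrableZl.
  by apply/funext => x; rewrite /= EFinM.
apply: complex_ext; rewrite !ReImE /cintegral /=.
- under eq_Rintegral do rewrite ReM.
  by rewrite RintegralB ?RintegralZl//; exact: Z.
- under eq_Rintegral do rewrite ImM.
  by rewrite RintegralD ?RintegralZl//; exact: Z.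
Qed.

Lemma cintegralN f : cintegrable f -> cintegral (fun x => - f x) = - cintegral f.
Proof.
move=> fi; rewrite -mulN1r -cintegralZ//; congr cintegral.
by apply/funext => x; rewrite mulN1r.
Qed.

Lemma cintegralB f g : cintegrable f -> cintegrable g ->
  cintegral (fun x => f x - g x) = cintegral f - cintegral g.
Proof. by move=> fi gi; rewrite cintegralD ?cintegralN//; exact: cintegrableN. Qed.

Lemma cintegral0 : cintegral (fun _ : T => 0 : R[i]) = 0.
Proof. by rewrite /cintegral /= /Rintegral integral0. Qed.

Lemma cintegral_sum (I : Type) (r : seq I) (F : I -> T -> R[i]) :
  (forall i, cintegrable (F i)) ->
  cintegral (fun x => \sum_(i <- r) F i x) = \sum_(i <- r) cintegral (F i).
Proof.
move=> iF; elim: r => [|i r IH].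
  by under eq_fun do rewrite big_nil; rewrite big_nil cintegral0.
rewrite big_cons -IH -cintegralD//; last exact: cintegrable_sum.
by congr cintegral; apply/funext => x; rewrite big_cons.
Qed.

Lemma cintegral_conj f : cintegrable f -> cintegral (fun x => conjc (f x)) = conjc (cintegral f).
Proof.
move=> fi; rewrite /cintegral /=; congr (_ +i* _).
  by apply: eq_Rintegral => x _; rewrite Re_conj.
under eq_Rintegral do rewrite Im_conj -mulN1r.
by rewrite RintegralZl ?mulN1r//; exact: cintegrable_Im.
Qed.

Lemma cintegral_real (h : T -> R) :
  cintegral (fun x => (h x)%:C) = (\int[mu]_x h x)%:C.
Proof. by rewrite /cintegral /= /Rintegral integral0. Qed.

Lemma norm1_cintegral f : cintegrable f ->
  ((norm1 (cintegral f))%:E <= \int[mu]_x (norm1 (f x))%:E)%E.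
Proof.
move=> fi; have [[m1 m2] _] := fi.
rewrite /norm1 /cintegral /= EFinD.
under eq_integral do rewrite EFinD.
rewrite ge0_integralD//; last 2 first.
- by apply/measurable_EFinP; exact: measurableT_comp.
- by apply/measurable_EFinP; exact: measurableT_comp.
apply: leeD.
- rewrite EFin_normr_Rintegral//; last exact: cintegrable_Re.
  by apply: le_abse_integral => //; exact/measurable_EFinP.
- rewrite EFin_normr_Rintegral//; last exact: cintegrable_Im.
  by apply: le_abse_integral => //; exact/measurable_EFinP.
Qed.

Lemma norm1_cintegral_le f : cintegrable f ->
  norm1 (cintegral f) <= \int[mu]_x norm1 (f x).
Proof.
move=> fi; rewrite -lee_fin /Rintegral fineK; first exact: norm1_cintegral.
by rewrite ge0_fin_numE ?fi.2// integral_ge0// => x _; rewrite lee_fin norm1_ge0.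
Qed.

Lemma Rintegral_affine (a : R) (b : T) (h : T -> R) : 0 < a ->
  mu.-integrable setT (EFin \o h) ->
  a ^+ n * \int[mu]_x h (a *: x + b) = \int[mu]_x h x.
Proof.
move=> a0 ih.
have mh : measurable_fun setT (EFin \o h) by exact: measurable_int ih.
have mf : measurable_fun setT (EFin \o h)^\+%E by exact: measurable_funepos.
have mg : measurable_fun setT (EFin \o h)^\-%E by exact: measurable_funeneg.
have F1 := integrable_pos_fin_num measurableT ih.
have F2 := integrable_neg_fin_num measurableT ih.
have an0 : a ^+ n != 0 by rewrite expf_neq0// gt_eqF.
rewrite -(ge0_integral_affine b a0 mf) in F1; last by [].
rewrite -(ge0_integral_affine b a0 mg) in F2; last by [].
(* Positivity of a^n carries finiteness from the integrals of the positive and negative parts to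
   those of their dilates, so that [fine] distributes over the product and the difference. *)
have fin (y : \bar R) : ((a ^+ n)%:E * y)%E \is a fin_num -> y \is a fin_num.
  have an : 0 < a ^+ n by rewrite exprn_gt0.
  by case: y => //=; rewrite ?gt0_muley ?gt0_muleNy ?lte_fin.
rewrite /Rintegral [in RHS]integralE [in LHS]integralE.
rewrite -[X in _ = fine (X - _)%E](ge0_integral_affine b a0 mf)//.
rewrite -[X in _ = fine (_ - X)%E](ge0_integral_affine b a0 mg)//.
have G1 := fin _ F1; have G2 := fin _ F2.
rewrite [in RHS]fineB// !fineM// -mulrBr -fineB//.
by congr (_ * fine (_ - _)%E); apply: eq_integral => x _; rewrite ?funeposE ?funenegE.
Qed.

Lemma cintegrable_affine (a : R) (b : T) f : 0 < a -> cintegrable f ->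
  cintegrable (fun x => f (a *: x + b)).
Proof.
move=> a0 [mf fi]; split.
  by apply: cmeasurable_comp mf; exact: measurable_row_affine.
have an : 0 < a ^+ n by rewrite exprn_gt0.
have := ge0_integral_affine b a0 (f := fun x => (norm1 (f x))%:E).
move=> H; move: fi; rewrite -H; last 2 first.
- by apply/measurable_EFinP; exact: measurable_norm1.
- by move=> x; rewrite lee_fin norm1_ge0.
set I := (\int[mu]_x (norm1 (f (a *: x + b)))%:E)%E.
by case: I => [r||]//=; rewrite ?ltry// gt0_muley ?lte_fin.
Qed.

Lemma cintegral_affine (a : R) (b : T) f : 0 < a -> cintegrable f ->
  (a ^+ n)%:C * cintegral (fun x => f (a *: x + b)) = cintegral f.
Proof.
move=> a0 fi; apply: complex_ext; rewrite !ReImE /= mul0r ?subr0 ?addr0.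
- exact: (Rintegral_affine b a0 (cintegrable_Re fi)).
- exact: (Rintegral_affine b a0 (cintegrable_Im fi)).
Qed.

Lemma cintegral_shift (b : T) f : cintegrable f ->
  cintegral (fun x => f (x + b)) = cintegral f.
Proof.
move=> fi; rewrite -(cintegral_affine b ltr01 fi) expr1n mul1r.
by congr cintegral; apply/funext => x; rewrite scale1r.
Qed.

Lemma cintegrable_shift (b : T) f : cintegrable f ->
  cintegrable (fun x => f (x + b)).
Proof.
move=> /(cintegrable_affine b ltr01).
by under eq_fun do rewrite scale1r.
Qed.

End ComplexIntegral.

(** * Fourier transform of integrable functions *)

Section FourierKernel.
Variables (R : realType) (n : nat).
Local Notation T := 'rV[R]_n.
Local Notation mu := (lebesgue_rV R n).
Implicit Types f g u v p m : T -> R[i].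

(** The product majorant makes every slice integrable, not merely almost every one. The inner
    real-valued integrals then agree with the extended ones at each point, and Fubini applies to
    real and imaginary parts. *)
Lemma cintegral_Fubini (G : T * T -> R[i]) (a b : T -> R) :
  cmeasurable G -> measurable_fun setT a -> measurable_fun setT b ->
  (forall x, 0 <= a x) -> (forall x, 0 <= b x) ->
  (\int[mu]_x (a x)%:E < +oo)%E -> (\int[mu]_x (b x)%:E < +oo)%E ->
  (forall x y, norm1 (G (x, y)) <= a x * b y) ->
  cintegral (fun x => cintegral (fun y => G (x, y))) =
  cintegral (fun y => cintegral (fun x => G (x, y))).
Proof.
move=> [mG1 mG2] ma mb a0 b0 ai bi Gab.
have key (h : T * T -> R) : measurable_fun setT h ->
    (forall x y, `|h (x, y)| <= a x * b y) ->
    \int[mu]_x (\int[mu]_y h (x, y)) = \int[mu]_y (\int[mu]_x h (x, y)).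
  move=> mh hab.
  have mhE : measurable_fun setT (EFin \o h) by exact/measurable_EFinP.
  have mh1 x : measurable_fun setT (fun y => h (x, y)).
    exact: (measurableT_comp mh (measurable_pair1 _)).
  have mh2 y : measurable_fun setT (fun x => h (x, y)).
    exact: (measurableT_comp mh (measurable_pair2 _)).
  have bnd1 x : (\int[mu]_y `|h (x, y)|%:E <= (a x)%:E * \int[mu]_y (b y)%:E)%E.
    rewrite -ge0_integralZl//; last 3 first.
      exact/measurable_EFinP.
      by move=> y _; rewrite lee_fin.
      by rewrite lee_fin.
    apply: ge0_le_integral => //.
    + by apply/measurable_EFinP; exact: measurableT_comp.
    + by apply/measurable_EFinP; exact: measurable_funM.
    + by move=> y _; rewrite -EFinM lee_fin.
  have bnd2 y : (\int[mu]_x `|h (x, y)|%:E <= (b y)%:E * \int[mu]_x (a x)%:E)%E.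
    rewrite -ge0_integralZl//; last 3 first.
      exact/measurable_EFinP.
      by move=> x _; rewrite lee_fin.
      by rewrite lee_fin.
    apply: ge0_le_integral => //.
    + by apply/measurable_EFinP; exact: measurableT_comp.
    + by apply/measurable_EFinP; exact: measurable_funM.
    + by move=> x _; rewrite -EFinM lee_fin mulrC.
  have ih : (mu \x mu)%E.-integrable setT (EFin \o h).
    apply/integrable12ltyP => //.
    apply: (@le_lt_trans _ _ (\int[mu]_x ((a x)%:E * \int[mu]_y (b y)%:E))%E).
      apply: ge0_le_integral => //.
      - by move=> x _; exact: integral_ge0.
      - apply: (@measurable_fun_fubini_tonelli_F _ _ _ _ _ mu
          (fun z => `|(EFin \o h) z|)%E) => //.
        exact: measurableT_comp.
      - by apply: emeasurable_funM => //; exact/measurable_EFinP.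
      - by move=> x _; exact: bnd1.
    rewrite ge0_integralZr//; last 3 first.
      exact/measurable_EFinP.
      by move=> x _; rewrite lee_fin.
      by apply: integral_ge0 => x _; rewrite lee_fin.
    apply: lte_mul_pinfty => //; first by apply: integral_ge0 => x _; rewrite lee_fin.
    by rewrite ge0_fin_numE// integral_ge0// => x _; rewrite lee_fin.
  have fin1 x : (\int[mu]_y (h (x, y))%:E)%E \is a fin_num.
    apply: integrable_fin_num => //; apply/integrableP; split.
      exact/measurable_EFinP.
    apply: le_lt_trans (bnd1 x) _; apply: lte_mul_pinfty => //.
    by rewrite lee_fin.
  have fin2 y : (\int[mu]_x (h (x, y))%:E)%E \is a fin_num.
    apply: integrable_fin_num => //; apply/integrableP; split.
      exact/measurable_EFinP.
    apply: le_lt_trans (bnd2 y) _; apply: lte_mul_pinfty => //.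
    by rewrite lee_fin.
  rewrite /Rintegral; congr fine.
  under eq_integral do rewrite fineK//.
  under [in RHS]eq_integral do rewrite fineK//.
  exact: (Fubini ih).
apply: complex_ext; rewrite /cintegral /=.
- exact: (key _ mG1 (fun x y => le_trans (ler_norm1_Re _) (Gab x y))).
- exact: (key _ mG2 (fun x y => le_trans (ler_norm1_Im _) (Gab x y))).
Qed.

(** The frequency s is a parameter so that one theory covers both transforms: s = - 2 pi is the
    Fourier transform, s = 2 pi the inverse one, and conjugation exchanges s and - s. *)
Definition fourier_kernel (s : R) f : T -> R[i] :=
  fun x => cintegral (fun y => expi (s * dotr x y) * f y).

Lemma dotrC (x y : T) : dotr x y = dotr y x.
Proof. by apply: eq_bigr => i _; rewrite mulrC. Qed.

Lemma dotrDl (x y z : T) : dotr (x + y) z = dotr x z + dotr y z.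
Proof. by rewrite -big_split; apply: eq_bigr => i _; rewrite !mxE mulrDl. Qed.

Lemma dotrZl (a : R) (x y : T) : dotr (a *: x) y = a * dotr x y.
Proof. by rewrite mulr_sumr; apply: eq_bigr => i _; rewrite !mxE mulrA. Qed.

Lemma dotrDr (x y z : T) : dotr x (y + z) = dotr x y + dotr x z.
Proof. by rewrite !(dotrC x) dotrDl. Qed.

Lemma dotrZr (a : R) (x y : T) : dotr x (a *: y) = a * dotr x y.
Proof. by rewrite !(dotrC x) dotrZl. Qed.

Lemma dotrNl (x y : T) : dotr (- x) y = - dotr x y.
Proof. by rewrite -scaleN1r dotrZl mulN1r. Qed.

Lemma cmeasurable_kernel2 (s : R) :
  cmeasurable (fun z : T * T => expi (s * dotr z.1 z.2)).
Proof.
apply: cmeasurable_expi; apply: measurable_funM => //.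
by apply: measurable_dotr; [exact: measurable_fst|exact: measurable_snd].
Qed.

Lemma cmeasurable_kernel (s : R) (x : T) :
  cmeasurable (fun y : T => expi (s * dotr x y)).
Proof.
apply: cmeasurable_expi; apply: measurable_funM => //.
by apply: measurable_dotr.
Qed.

Lemma cintegrable_kernel (s : R) (x : T) f : cintegrable f ->
  cintegrable (fun y => expi (s * dotr x y) * f y).
Proof.
apply: (@cintegrable_boundedM _ _ _ _ 2); first exact: cmeasurable_kernel.
by move=> y; exact: ler_norm1_expi.
Qed.

Lemma cmeasurable_fourier (s : R) f : cintegrable f ->
  cmeasurable (fourier_kernel s f).
Proof.
move=> fi.
have mG : cmeasurable (fun z : T * T => expi (s * dotr z.1 z.2) * f z.2).
  apply: cmeasurableM; first exact: cmeasurable_kernel2.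
  by apply: cmeasurable_comp fi.1; exact: measurable_snd.
(* Tonelli gives measurability of parameter integrals of nonnegative functions, whence the splitting
   into positive and negative parts. *)
have key (h : T * T -> R) : measurable_fun setT h ->
    measurable_fun setT (fun x => \int[mu]_y h (x, y)).
  move=> mh; apply: (@measurableT_comp _ _ _ _ _ _ (@fine R)) => //.
  rewrite (_ : (fun x => _) = (fun x => \int[mu]_y (EFin \o h)^\+ (x, y)
                             - \int[mu]_y (EFin \o h)^\- (x, y))%E).
    apply: emeasurable_funB; apply: measurable_fun_fubini_tonelli_F => //.
    - by apply: measurable_funepos; exact/measurable_EFinP.
    - by apply: measurable_funeneg; exact/measurable_EFinP.
  apply/funext => x; rewrite [LHS]integralE; congr (_ - _)%E;
    by apply: eq_integral => y _; rewrite ?funeposE ?funenegE.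
by split; [exact: key mG.1|exact: key mG.2].
Qed.

Lemma norm1_fourier (s : R) f x : cintegrable f ->
  norm1 (fourier_kernel s f x) <= 2 * \int[mu]_y norm1 (f y).
Proof.
move=> fi; apply: le_trans (norm1_cintegral_le (cintegrable_kernel s x fi)) _.
rewrite -RintegralZl//; last exact: cintegrable_norm1.
have h := cintegrable_norm1 (cintegrable_kernel s x fi).
have h' := integrableZl measurableT 2 (cintegrable_norm1 fi).
apply: le_Rintegral => // y _.
by rewrite (le_trans (ler_norm1M _ _))// ler_wpM2r ?norm1_ge0// ler_norm1_expi.
Qed.

Lemma cintegrable_fourierM (s : R) f p : cintegrable f -> cintegrable p ->
  cintegrable (fun x => fourier_kernel s f x * p x).
Proof.
move=> fi pi'; apply: (cintegrable_boundedM _ (fun x => norm1_fourier s x fi) pi').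
exact: cmeasurable_fourier.
Qed.

(** Fubini for p(x) e^{i s <x, y>} u(y): the exponential is symmetric in x and y, so the transform
    may sit on either factor. *)
Lemma fourier_multiplication (s : R) p u : cintegrable p -> cintegrable u ->
  cintegral (fun x => p x * fourier_kernel s u x) =
  cintegral (fun y => fourier_kernel s p y * u y).
Proof.
move=> pi' ui.
pose G (z : T * T) := p z.1 * (expi (s * dotr z.1 z.2) * u z.2).
transitivity (cintegral (fun x => cintegral (fun y => G (x, y)))).
  congr cintegral; apply/funext => x; rewrite /G /= cintegralZ//.
  exact: cintegrable_kernel.
rewrite (@cintegral_Fubini G (fun x => norm1 (p x)) (fun y => 2 * norm1 (u y))).
- congr cintegral; apply/funext => y; rewrite /G /= mulrC -cintegralZ//.
    congr cintegral; apply/funext => x; rewrite dotrC; ring.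
  exact: cintegrable_kernel.
- apply: cmeasurableM.
    by apply: cmeasurable_comp pi'.1; exact: measurable_fst.
  apply: cmeasurableM; first exact: cmeasurable_kernel2.
  by apply: cmeasurable_comp ui.1; exact: measurable_snd.
- exact: measurable_norm1 pi'.1.
- by apply: measurable_funM => //; exact: measurable_norm1 ui.1.
- by move=> x; exact: norm1_ge0.
- by move=> x; rewrite mulr_ge0// norm1_ge0.
- exact: pi'.2.
- under eq_integral do rewrite EFinM.
  rewrite ge0_integralZl//.
  + by apply: lte_mul_pinfty => //; exact: ui.2.
  + by apply/measurable_EFinP; exact: measurable_norm1 ui.1.
  + by move=> x _; rewrite lee_fin norm1_ge0.
- move=> x y; rewrite /G /=; apply: le_trans (ler_norm1M _ _) _.
  rewrite ler_wpM2l ?norm1_ge0//; apply: le_trans (ler_norm1M _ _) _.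
  by rewrite ler_wpM2r ?norm1_ge0// ler_norm1_expi.
Qed.

Lemma conj_fourier (s : R) f x : cintegrable f ->
  conjc (fourier_kernel s f x) = fourier_kernel (- s) (fun y => conjc (f y)) x.
Proof.
move=> fi; rewrite /fourier_kernel -cintegral_conj; last exact: cintegrable_kernel.
by congr cintegral; apply/funext => y; rewrite conjcM conj_expi mulNr.
Qed.

Lemma fourier_modulate (s : R) m x y :
  fourier_kernel (- s) (fun z => expi (s * dotr x z) * m z) y =
  fourier_kernel s m (x - y).
Proof.
rewrite /fourier_kernel; congr cintegral; apply/funext => z.
by rewrite mulrA -expiD dotrDl dotrNl; congr (expi _ * _); ring.
Qed.

(** Two uses of the multiplication formula turn the pairing of m with u^ conj(v^) into the double
    integral of u(x) m^(x - y) conj(v(y)). A pointwise bound K on m^ thus controls a form in u and v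
    themselves. *)
Lemma fourier_bilinear (s : R) m u v (K : T -> R) :
  cintegrable m -> cintegrable u -> cintegrable v ->
  measurable_fun setT K -> (forall x, norm1 (fourier_kernel s m x) <= K x) ->
  ((norm1 (cintegral
      (fun z => m z * (fourier_kernel s u z * conjc (fourier_kernel s v z)))))%:E
   <= \int[mu]_x \int[mu]_y (norm1 (u x) * norm1 (v y) * K (x - y)%R)%:E)%E.
Proof.
move=> mi ui vi mK mKm.
pose w z := m z * conjc (fourier_kernel s v z).
have vci := cintegrable_conj vi.
have wi : cintegrable w.
  rewrite /w; under eq_fun do rewrite mulrC conj_fourier//.
  exact: cintegrable_fourierM.
have -> : (fun z => m z * (fourier_kernel s u z * conjc (fourier_kernel s v z)))
    = (fun z => w z * fourier_kernel s u z).
  by apply/funext => z; rewrite /w; ring.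
rewrite fourier_multiplication//.
apply: le_trans (norm1_cintegral (cintegrable_fourierM s wi ui)) _.
have mKK : measurable_fun setT (fun z : T * T => K (z.1 - z.2)).
  apply: measurableT_comp => //; apply: measurable_fun_coordP => i.
  under eq_fun do rewrite !mxE.
  apply: measurable_funB.
  - exact: (measurableT_comp (measurable_coord i) measurable_fst).
  - exact: (measurableT_comp (measurable_coord i) measurable_snd).
have mG : measurable_fun setT
    (fun z : T * T => (norm1 (u z.1) * norm1 (v z.2) * K (z.1 - z.2))).
  apply: measurable_funM => //; apply: measurable_funM.
  - by apply: (measurableT_comp (measurable_norm1 ui.1)).
  - by apply: (measurableT_comp (measurable_norm1 vi.1)).
have K0 x : 0 <= K x by exact: le_trans (norm1_ge0 _) (mKm x).
apply: ge0_le_integral => //.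
- by move=> x _; rewrite lee_fin norm1_ge0.
- apply/measurable_EFinP; apply: measurable_norm1; apply: cmeasurableM ui.1.
  exact: cmeasurable_fourier.
- apply: (@measurable_fun_fubini_tonelli_F _ _ _ _ _ mu
    (fun z => (norm1 (u z.1) * norm1 (v z.2) * K (z.1 - z.2))%:E)) => //.
  + exact/measurable_EFinP.
  + by move=> z; rewrite lee_fin !mulr_ge0 ?norm1_ge0.
move=> x _.
have -> : fourier_kernel s w x =
    cintegral (fun y => fourier_kernel s m (x - y) * conjc (v y)).
  (* A translate of m^ is the transform of a modulated m at frequency - s, which is also the
     frequency of conj(v^), so the multiplication formula applies a second time. *)
  rewrite -[in RHS](funext (fun y => congr1 (fun t => t * _) (fourier_modulate s m x y))).
  rewrite -fourier_multiplication//; last exact: cintegrable_kernel.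
  rewrite /fourier_kernel; congr cintegral; apply/funext => z.
  by rewrite /w -/(fourier_kernel _ _ _) conj_fourier// mulrA.
have Hi : cintegrable (fun y => fourier_kernel s m (x - y) * conjc (v y)).
  apply: (cintegrable_boundedM _ (fun y => norm1_fourier s (x - y) mi) vci).
  apply: cmeasurable_comp (cmeasurable_fourier s mi).
  apply: measurable_fun_coordP => i; under eq_fun do rewrite !mxE.
  by apply: measurable_funB => //; exact: measurable_coord.
rewrite mulrC -cintegralZ//.
apply: le_trans (norm1_cintegral (cintegrableZ _ Hi)) _.
apply: ge0_le_integral => //.
- by move=> y _; rewrite lee_fin norm1_ge0.
- by apply/measurable_EFinP; apply: measurable_norm1; exact: (cintegrableZ _ Hi).1.
- apply/measurable_EFinP; exact: (measurableT_comp mG (measurable_pair1 _)).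
- move=> y _; rewrite lee_fin; apply: le_trans (ler_norm1M _ _) _.
  rewrite -mulrA ler_wpM2l ?norm1_ge0//; apply: le_trans (ler_norm1M _ _) _.
  by rewrite mulrC norm1_conj ler_wpM2l ?norm1_ge0.
Qed.

End FourierKernel.

(** * Bessel inequality *)

Section OneDimensionalTent.
Variable R : realType.
Local Notation leb := (@lebesgue_measure R).

Lemma Rintegral_FTC2 (a b : R) (f F : R -> R) : a < b -> continuous f ->
  (forall x : R, is_derive x 1 F (f x)) ->
  \int[leb]_(x in `[a, b]) f x = F b - F a.
Proof.
move=> ab cf dF; rewrite /Rintegral (@continuous_FTC2 _ _ F)//.
- exact: continuous_subspaceT.
- have cF x : {for x, continuous F}.
    by apply: differentiable_continuous; apply/derivable1_diffP; have [] := dF x.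
  split; first by move=> x _; have [] := dF x.
  + exact/cvg_at_right_filter/cF.
  + exact/cvg_at_left_filter/cF.
- by move=> x _; rewrite derive1E; apply: derive_val.
Qed.

Lemma is_derive_sinM (b t : R) : is_derive t 1 (fun t => sin (b * t)) (b * cos (b * t)).
Proof.
have d1 : is_derive t 1 ( *%R b) b.
  have -> : ( *%R b) = (b \*: (@id R)) by apply/funext => x.
  by apply: is_derive_eq; rewrite /GRing.scale /= mulr1.
have := @is_derive1_comp _ (@sin R) ( *%R b) t _ _ (is_derive_sin (b * t)) d1.
by rewrite mulrC.
Qed.

Lemma is_derive_cosM (b t : R) : is_derive t 1 (fun t => cos (b * t)) (- (b * sin (b * t))).
Proof.
have d1 : is_derive t 1 ( *%R b) b.
  have -> : ( *%R b) = (b \*: (@id R)) by apply/funext => x.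
  by apply: is_derive_eq; rewrite /GRing.scale /= mulr1.
have := @is_derive1_comp _ (@cos R) ( *%R b) t _ _ (is_derive_cos (b * t)) d1.
by rewrite mulrC -mulrN.
Qed.

Lemma is_derive_affine (p q t : R) : is_derive t 1 (fun t => p + q * t) q.
Proof.
have -> : (fun t => p + q * t) = (cst p + q \*: (@id R)) by apply/funext => x.
by apply: is_derive_eq; rewrite /GRing.scale /= mulr1 add0r.
Qed.

Lemma is_derive_affine_sin_cos (p q b c e t : R) :
  is_derive t 1 (fun t => (p + q * t) * (c * sin (b * t) + e * cos (b * t)))
    ((p + q * t) * (c * (b * cos (b * t)) - e * (b * sin (b * t))) +
     q * (c * sin (b * t) + e * cos (b * t))).
Proof.
have h1 := is_derive_affine p q t.
have h2 := is_derive_sinM b t; have h3 := is_derive_cosM b t.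
have -> : (fun t => (p + q * t) * (c * sin (b * t) + e * cos (b * t))) =
  ((fun t => p + q * t) * (c \*: (fun t => sin (b * t)) + e \*: (fun t => cos (b * t)))).
  by apply/funext.
apply: is_derive_eq; rewrite /GRing.scale /= /GRing.scale /=.
rewrite (_ : (_ + e \*: _) t = c * sin (b * t) + e * cos (b * t)) //.
ring.
Qed.

(** A compactly supported summation kernel: unlike the indicator of an interval it is continuous,
    and its transform decays quadratically, hence is integrable. *)
Definition tent (t : R) : R := Num.max 0 (1 - `|t|).

Lemma tent_ge0 t : 0 <= tent t. Proof. by rewrite /tent le_max lexx. Qed.

Lemma tent_le1 t : tent t <= 1.
Proof. by rewrite /tent ge_max ler01 gerBl normr_ge0. Qed.

Lemma tent_ge_half t : `|t| <= 1 / 2 -> 1 / 2 <= tent t.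
Proof. by move=> h; rewrite /tent le_max; apply/orP; right; lra. Qed.

Lemma tent_out t : 1 <= `|t| -> tent t = 0.
Proof. by move=> h; apply/max_idPl; lra. Qed.

Lemma continuous_tent : continuous tent.
Proof.
move=> t; apply: (@continuous_max _ _ (cst 0) (fun t => 1 - `|t|)).
  exact: cvg_cst.
by apply: cvgB; [exact: cvg_cst|exact: cvg_norm].
Qed.

Lemma tent_integrable (g : R -> R) : continuous g ->
  leb.-integrable setT (EFin \o (fun t => tent t * g t)).
Proof.
move=> cg.
have c : continuous (fun t => tent t * g t).
  by move=> t; apply: cvgM; [exact: continuous_tent|exact: cg].
have -> : EFin \o (fun t => tent t * g t) = (EFin \o (fun t => tent t * g t)) \_ `[-1, 1].
  apply/funext => t; rewrite patchE; case: ifPn => //= /negP; rewrite inE /= in_itv /=.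
  move=> h; rewrite tent_out ?mul0r// leNgt ltr_norml; apply/negP => /andP[h1 h2].
  by apply: h; rewrite !ltW.
rewrite -integrable_mkcond//.
apply: (@continuous_compact_integrable _ (fun t => tent t * g t)).
  exact: segment_compact.
exact: continuous_subspaceT.
Qed.

Lemma tent_integral (g : R -> R) : continuous g ->
  \int[leb]_t (tent t * g t) =
  \int[leb]_(t in `[-1, 0]) ((1 + t) * g t) + \int[leb]_(t in `[0, 1]) ((1 - t) * g t).
Proof.
move=> cg; have ig := tent_integrable cg.
have c : continuous (fun t => tent t * g t).
  by move=> t; apply: cvgM; [exact: continuous_tent|exact: cg].
transitivity (\int[leb]_(t in `[-1, 0] `|` `]0, 1]) (tent t * g t)).
  rewrite [RHS]Rintegral_mkcond; apply: eq_Rintegral => t _.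
  rewrite patchE; case: ifPn => // /negP; rewrite inE /= !in_itv /= => h.
  rewrite tent_out ?mul0r// leNgt ltr_norml; apply/negP => /andP[h1 h2].
  apply: h; case: (lerP t 0) => t0; [left|right]; first by rewrite ltW.
  by rewrite ltW.
rewrite Rintegral_setU//; last 2 first.
- by apply: (integrableS _ _ _ ig) => //; exact: measurableU.
- apply/disj_setPS => t [] /=; rewrite !in_itv /= => /andP[_ t0] /andP[t1 _].
  by move: (lt_le_trans t1 t0); rewrite ltxx.
congr (_ + _).
  apply: eq_Rintegral => t; rewrite inE /= in_itv /= => /andP[t1 t0].
  by rewrite /tent ler0_norm// opprK max_r//; lra.
rewrite Rintegral_itv_obnd_cbnd; last exact: (integrableS _ _ _ ig).
apply: eq_Rintegral => t; rewrite inE /= in_itv /= => /andP[t0 t1].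
by rewrite /tent ger0_norm// max_r//; lra.
Qed.

Definition tent_hat (b : R) : R := \int[leb]_t (tent t * cos (b * t)).

Lemma continuous_cosM (b : R) : continuous (fun t => cos (b * t)).
Proof.
move=> t; apply: differentiable_continuous; apply/derivable1_diffP.
by have [] := is_derive_cosM b t.
Qed.

Lemma continuous_sinM (b : R) : continuous (fun t => sin (b * t)).
Proof.
move=> t; apply: differentiable_continuous; apply/derivable1_diffP.
by have [] := is_derive_sinM b t.
Qed.

Lemma continuous_affineM (p q : R) (g : R -> R) : continuous g ->
  continuous (fun t => (p + q * t) * g t).
Proof.
move=> cg t; apply: cvgM; last exact: cg.
by apply: cvgD; [exact: cvg_cst|apply: cvgM; [exact: cvg_cst|exact: cvg_id]].
Qed.

(** [G] is the antiderivative that integration by parts produces; it is verified by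
    differentiation. *)
Lemma Rintegral_affine_trig (x y p q A B b : R) : x < y -> b != 0 ->
  let G t := (p + q * t) * ((B / b) * sin (b * t) + (- A / b) * cos (b * t)) +
     q * (A / b ^+ 2 * sin (b * t) + (B / b ^+ 2) * cos (b * t)) in
  \int[leb]_(t in `[x, y]) ((p + q * t) * (A * sin (b * t) + B * cos (b * t))) =
  G y - G x.
Proof.
move=> xy b0 G; apply: Rintegral_FTC2 => //.
  apply: continuous_affineM => t.
  apply: cvgD; apply: cvgM; [exact: cvg_cst|exact: continuous_sinM|
    exact: cvg_cst|exact: continuous_cosM].
(* The second summand of [G] is the same shape with constant affine factor q, so one derivative
   formula serves twice. *)
move=> t; have h1 := is_derive_affine_sin_cos p q b (B / b) (- A / b) t.
have := is_derive_affine_sin_cos q 0 b (A / b ^+ 2) (B / b ^+ 2) t.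
under eq_fun do rewrite mul0r addr0.
by move=> h2; apply: (is_derive_eq (is_deriveD h1 h2)); field.
Qed.

(** The integrand is odd. This makes the transform of the tent real, so that the product formula in
    higher dimension has no imaginary part. *)
Lemma tent_sin_integral (b : R) : \int[leb]_t (tent t * sin (b * t)) = 0.
Proof.
have [->|b0] := eqVneq b 0.
  rewrite (_ : (fun _ => _) = cst 0); first by rewrite Rintegral_cst// mul0r.
  by apply/funext => t; rewrite mul0r sin0 mulr0.
rewrite tent_integral; last exact: continuous_sinM.
have h1 := @Rintegral_affine_trig (-1) 0 1 1 1 0 b ltac:(lra) b0.
have h2 := @Rintegral_affine_trig 0 1 1 (-1) 1 0 b ltac:(lra) b0.
transitivity (\int[leb]_(t in `[-1, 0]) ((1 + 1 * t) * (1 * sin (b * t) + 0 * cos (b * t))) +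
  \int[leb]_(t in `[0, 1]) ((1 + (-1) * t) * (1 * sin (b * t) + 0 * cos (b * t)))).
  by congr (_ + _); apply: eq_Rintegral => t _; ring.
rewrite h1 h2.
by rewrite /= !(mulr0 b) !(mulr1 b) !(mulrN1 b) cosN sinN sin0 cos0; field.
Qed.

Lemma tent_hatE (b : R) : b != 0 -> tent_hat b = 2 * (1 - cos b) / b ^+ 2.
Proof.
move=> b0; rewrite /tent_hat tent_integral; last exact: continuous_cosM.
have h1 := @Rintegral_affine_trig (-1) 0 1 1 0 1 b ltac:(lra) b0.
have h2 := @Rintegral_affine_trig 0 1 1 (-1) 0 1 b ltac:(lra) b0.
transitivity (\int[leb]_(t in `[-1, 0]) ((1 + 1 * t) * (0 * sin (b * t) + 1 * cos (b * t))) +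
  \int[leb]_(t in `[0, 1]) ((1 + (-1) * t) * (0 * sin (b * t) + 1 * cos (b * t)))).
  by congr (_ + _); apply: eq_Rintegral => t _; ring.
rewrite h1 h2.
by rewrite /= !(mulr0 b) !(mulr1 b) !(mulrN1 b) cosN sinN sin0 cos0; field.
Qed.

Lemma tent_hat_le2 (b : R) : `|tent_hat b| <= 2.
Proof.
rewrite /tent_hat.
have h1 := tent_integrable (@continuous_cosM b).
have h2 : leb.-integrable setT (EFin \o \1_(`[-1, 1]%classic)).
  exact: integrable_indic_itv.
apply: le_trans (le_normr_Rintegral _ h1) _ => //.
apply: (@le_trans _ _ (\int[leb]_t (\1_(`[-1, 1]%classic) t))).
  apply: le_Rintegral => //; first exact: integrable_norm.
  move=> t _; rewrite indicE; case: (boolP (t \in _)) => /= ht.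
    rewrite normrM ger0_norm ?tent_ge0// mulr_ile1 ?tent_ge0 ?tent_le1//.
    by rewrite ler_norml cos_geN1 cos_le1.
  rewrite tent_out ?mul0r ?normr0// leNgt ltr_norml; apply/negP => /andP[a b'].
  by move/negP : ht; apply; rewrite inE /= in_itv /= !ltW.
rewrite /Rintegral integral_indic// setIT.
rewrite [X in fine X](_ : _ = leb `[-1, 1]%classic)// lebesgue_measure_itv/=.
by rewrite ifT ?lte_fin//=; lra.
Qed.

(** For b^2 <= 1 the bound 2 suffices, since 2 (1 + b^2) <= 4. For b^2 > 1 the explicit formula
    gives 4 / b^2, and 4 (1 + b^2) <= 8 b^2 is the source of the 8. *)
Lemma tent_hat_le (b : R) : `|tent_hat b| <= 8 * (1 + b ^+ 2)^-1.
Proof.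
have D : 0 < 1 + b ^+ 2 by rewrite ltr_pwDl// sqr_ge0.
rewrite -ler_pdivrMr ?invr_gt0// invrK.
have [b1|b1] := leP (b ^+ 2) 1.
  have := tent_hat_le2 b; nra.
have b0 : b != 0 by apply: contraTneq b1 => ->; rewrite expr0n /= ltr10.
have b20 : 0 < b ^+ 2 by lra.
rewrite tent_hatE// normrM normfV (gtr0_norm b20) mulrAC ler_pdivrMr//.
have : `|2 * (1 - cos b)| <= 4.
  by have := cos_le1 b; have := cos_geN1 b; rewrite ler_norml; lra.
nra.
Qed.

End OneDimensionalTent.

(** * The tent in dimension n and its Fourier transform *)

Section ProductTent.
Variable R : realType.
Local Notation leb := (@lebesgue_measure R).
Local Notation mu := (lebesgue_rV R).

Lemma integrable_rV_cons n (h : R -> R) (k : 'rV[R]_n -> R) :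
  leb.-integrable setT (EFin \o h) -> (mu n).-integrable setT (EFin \o k) ->
  (mu n.+1).-integrable setT (EFin \o
    (fun x : 'rV[R]_n.+1 => h (x ord0 ord0) * k (\row_j x ord0 (lift ord0 j)))).
Proof.
move=> ih ik.
have mh : measurable_fun setT h by apply/measurable_EFinP; exact: measurable_int ih.
have mk : measurable_fun setT k by apply/measurable_EFinP; exact: measurable_int ik.
have mtail : measurable_fun setT (fun x : 'rV[R]_n.+1 => \row_j x ord0 (lift ord0 j)).
  by apply: measurable_fun_coordP => i; under eq_fun do rewrite mxE; exact: measurable_coord.
have mf : measurable_fun setT
    (fun x : 'rV[R]_n.+1 => h (x ord0 ord0) * k (\row_j x ord0 (lift ord0 j))).
  apply: measurable_funM; last exact: measurableT_comp.
  by apply: measurableT_comp => //; exact: measurable_coord.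
apply/integrableP; split; first exact/measurable_EFinP.
rewrite ge0_integral_rV_cons//; last first.
  by apply: measurableT_comp => //; exact/measurable_EFinP.
have -> : (\int[leb]_t \int[mu n]_y `|(EFin \o (fun x : 'rV[R]_n.+1 =>
     (h (x ord0 ord0) * k (\row_j x ord0 (lift ord0 j)))%R)) (rV_cons (t, y))| =
    (\int[leb]_x `|(h x)%:E|) * (\int[mu n]_y `|(k y)%:E|))%E.
  rewrite -ge0_integralZr//; last 2 first.
  - by apply: measurableT_comp => //; exact/measurable_EFinP.
  - exact: integral_ge0.
  apply: eq_integral => t _; rewrite -ge0_integralZl//.
  - apply: eq_integral => y _; rewrite /= normrM mxE unlift_none -EFinM.
    by congr (_ * `|k _|)%:E; apply/rowP => j; rewrite !mxE liftK.
  - by apply: measurableT_comp => //; exact/measurable_EFinP.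
apply: lte_mul_pinfty; [exact: integral_ge0| |by case/integrableP : ik].
by rewrite ge0_fin_numE ?integral_ge0//; case/integrableP : ih.
Qed.

(** Counterpart of [ge0_integral_rV_cons] for products with changing sign, as the cosine and sine
    factors require. *)
Lemma Rintegral_rV_cons n (h : R -> R) (k : 'rV[R]_n -> R) :
  leb.-integrable setT (EFin \o h) -> (mu n).-integrable setT (EFin \o k) ->
  \int[mu n.+1]_x (h (x ord0 ord0) * k (\row_j x ord0 (lift ord0 j))) =
  \int[leb]_t h t * \int[mu n]_y k y.
Proof.
move=> ih ik.
pose f (x : 'rV[R]_n.+1) := h (x ord0 ord0) * k (\row_j x ord0 (lift ord0 j)).
have mh : measurable_fun setT h by apply/measurable_EFinP; exact: measurable_int ih.
have mk : measurable_fun setT k by apply/measurable_EFinP; exact: measurable_int ik.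
have mtail : measurable_fun setT (fun x : 'rV[R]_n.+1 => \row_j x ord0 (lift ord0 j)).
  by apply: measurable_fun_coordP => i; under eq_fun do rewrite mxE; exact: measurable_coord.
have mf : measurable_fun setT (EFin \o f).
  apply/measurable_EFinP; apply: measurable_funM.
    by apply: measurableT_comp => //; exact: measurable_coord.
  exact: measurableT_comp.
have fE : (EFin \o f) \o @rV_cons R n = (fun z => (h z.1 * k z.2)%:E).
  apply/funext => -[t y]; rewrite /f /= mxE unlift_none; congr (h _ * k _)%:E.
  by apply/rowP => j; rewrite !mxE liftK.
have mhk : measurable_fun setT (fun z : measurableTypeR R * 'rV[R]_n => (h z.1 * k z.2)%:E).
  apply/measurable_EFinP; apply: measurable_funM.
  - by apply: measurableT_comp => //; exact: measurable_fst.
  - by apply: measurableT_comp => //; exact: measurable_snd.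
have if' : (leb \x mu n)%E.-integrable setT (fun z => (h z.1 * k z.2)%:E).
  apply/integrable12ltyP => //.
  have -> : (\int[leb]_x \int[mu n]_y `|(h (x, y).1 * k (x, y).2)%:E| =
      (\int[leb]_x `|(h x)%:E|) * (\int[mu n]_y `|(k y)%:E|))%E.
    rewrite -ge0_integralZr//; last 2 first.
    - by apply: measurableT_comp => //; exact/measurable_EFinP.
    - exact: integral_ge0.
    apply: eq_integral => t _; rewrite -ge0_integralZl//.
    - by apply: eq_integral => y _; rewrite /= normrM.
    - by apply: measurableT_comp => //; exact/measurable_EFinP.
  apply: lte_mul_pinfty; [exact: integral_ge0| |by case/integrableP : ik].
  by rewrite ge0_fin_numE ?integral_ge0//; case/integrableP : ih.
have H := @integral_pushforward _ _ _ _ R _ (@measurable_rV_cons R n)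
  (leb \x mu n)%E setT (EFin \o f) mf.
rewrite preimage_setT fE in H.
rewrite [LHS]/Rintegral.
transitivity (fine (\int[(leb \x mu n)%E]_z (h z.1 * k z.2)%:E)).
  by congr fine; exact: (H if' measurableT).
rewrite -(integral12_prod_meas1 if') /Rintegral -fineM; last 2 first.
- exact: integrable_fin_num.
- exact: integrable_fin_num.
congr fine; rewrite /fubini_F /=.
have kfin : (\int[mu n]_y (k y)%:E)%E \is a fin_num by exact: integrable_fin_num.
transitivity (\int[leb]_x ((h x)%:E * (fine (\int[mu n]_y (k y)%:E))%:E))%E.
  apply: eq_integral => t _; rewrite fineK//.
  under eq_integral do rewrite EFinM.
  by rewrite integralZl.
by rewrite integralZr// fineK.
Qed.

Definition tent_rV n (x : 'rV[R]_n) : R := \prod_(i < n) tent (x ord0 i).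

Lemma tent_rV_ge0 n (x : 'rV[R]_n) : 0 <= tent_rV x.
Proof. by apply: prodr_ge0 => i _; exact: tent_ge0. Qed.

Lemma measurable_tent : measurable_fun setT (@tent R).
Proof. by apply: continuous_measurable_fun; exact: continuous_tent. Qed.

Lemma measurable_tent_rV n : measurable_fun setT (@tent_rV n).
Proof.
apply: measurable_prod => i _.
by apply: (measurableT_comp measurable_tent); exact: measurable_coord.
Qed.

Lemma expe_lty (x : \bar R) n : (0 <= x -> x < +oo -> x ^+ n < +oo)%E.
Proof.
move=> x0 xy; elim: n => [|n IH]; first by rewrite ltry.
rewrite expeS lte_mul_pinfty// ge0_fin_numE//.
Qed.

Lemma cintegrable_tent_rV n : cintegrable (fun x : 'rV[R]_n => (tent_rV x)%:C).
Proof.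
apply: cintegrable_real; first exact: measurable_tent_rV.
under eq_integral do rewrite ger0_norm ?tent_rV_ge0//.
rewrite ge0_integral_prod.
- apply: expe_lty; first by apply: integral_ge0 => t _; rewrite lee_fin tent_ge0.
  have c1 : continuous (cst 1 : R -> R) by move=> x; exact: cvg_cst.
  have /integrableP[_] := tent_integrable c1.
  apply: le_lt_trans; apply: ge0_le_integral => //.
  + by move=> t _; rewrite lee_fin tent_ge0.
  + by apply/measurable_EFinP; exact: measurable_tent.
  + apply/measurable_EFinP; apply: measurableT_comp => //.
    by apply: measurable_funM => //; exact: measurable_tent.
  + by move=> t _; rewrite /= mulr1 lee_fin ler_norm.
- exact: measurable_tent.
- by move=> x; exact: tent_ge0.
Qed.

Lemma Rintegral_rV0 (h : 'rV[R]_0 -> R) : \int[mu 0]_x h x = h 0.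
Proof.
have e : mu 0 [set: 'rV[R]_0] = 1%E by exact: diracT.
rewrite (_ : h = cst (h 0)); first by rewrite Rintegral_cst// [X in _ * fine X]e mulr1.
by apply/funext => x; rewrite (thinmx0 x).
Qed.

(** Both the exponential and the tent factor over the coordinates. Peeling off the first one leaves
    ([A1] + i [A2]) times the integrand in the other coordinates; the sine part [A2] integrates to 0
    and the remaining integral is real by induction. *)
Lemma fourier_tent_rV n (s : R) (x : 'rV[R]_n) :
  fourier_kernel s (fun y => (tent_rV y)%:C) x =
  (\prod_(i < n) tent_hat (s * x ord0 i))%:C.
Proof.
elim: n x => [|n IH] x.
  rewrite /fourier_kernel /cintegral !Rintegral_rV0 /tent_rV /dotr !big_ord0.
  by rewrite mulr0 expi0 mul1r.
pose x' : 'rV[R]_n := \row_j x ord0 (lift ord0 j).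
pose B (y : 'rV[R]_n) := expi (s * dotr x' y) * (tent_rV y)%:C.
have iB : cintegrable B by apply: cintegrable_kernel; exact: cintegrable_tent_rV.
pose A1 t := tent t * cos (s * x ord0 ord0 * t).
pose A2 t := tent t * sin (s * x ord0 ord0 * t).
have iA1 : leb.-integrable setT (EFin \o A1).
  by apply: tent_integrable; exact: continuous_cosM.
have iA2 : leb.-integrable setT (EFin \o A2).
  by apply: tent_integrable; exact: continuous_sinM.
have E (z : 'rV[R]_n.+1) : expi (s * dotr x z) * (tent_rV z)%:C =
   (A1 (z ord0 ord0) +i* A2 (z ord0 ord0)) * B (\row_j z ord0 (lift ord0 j)).
  rewrite /dotr /tent_rV /B !big_ord_recl mulrDr expiD mulrA rmorphM /=.
  have -> : (A1 (z ord0 ord0) +i* A2 (z ord0 ord0)) =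
      (tent (z ord0 ord0))%:C * expi (s * x ord0 ord0 * z ord0 ord0).
    by apply: complex_ext; rewrite !ReImE /A1 /A2 /=; ring.
  have -> : dotr x' (\row_j z ord0 (lift ord0 j)) =
      \sum_(i < n) x ord0 (lift ord0 i) * z ord0 (lift ord0 i).
    by apply: eq_bigr => i _; rewrite !mxE.
  have -> : tent_rV (\row_j z ord0 (lift ord0 j)) =
      \prod_(i < n) tent (z ord0 (lift ord0 i)).
    by apply: eq_bigr => i _; rewrite !mxE.
  ring.
have H := @integrable_rV_cons n.
have IHB : cintegral B = (\prod_(i < n) tent_hat (s * x' ord0 i))%:C by exact: IH.
move: B iB E IHB => B iB E IHB.
have sE : \int[leb]_t A2 t = 0 by exact: tent_sin_integral.
rewrite /fourier_kernel; under [X in cintegral X]funext do rewrite E.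
apply: complex_ext; rewrite /cintegral /=.
- under eq_Rintegral do rewrite ReM /=.
  rewrite RintegralB//; last 2 first.
  + by apply: (H A1 (fun y => complex.Re (B y))) => //; exact: cintegrable_Re.
  + by apply: (H A2 (fun y => complex.Im (B y))) => //; exact: cintegrable_Im.
  rewrite (Rintegral_rV_cons iA1 (cintegrable_Re iB)).
  rewrite (Rintegral_rV_cons iA2 (cintegrable_Im iB)) sE mul0r subr0.
  rewrite big_ord_recl; congr (_ * _).
  have := congr1 (@complex.Re R) IHB; rewrite /= => ->.
  by apply: eq_bigr => i _; rewrite mxE.
- under eq_Rintegral do rewrite ImM /=.
  rewrite RintegralD//; last 2 first.
  + by apply: (H A1 (fun y => complex.Im (B y))) => //; exact: cintegrable_Im.
  + by apply: (H A2 (fun y => complex.Re (B y))) => //; exact: cintegrable_Re.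
  rewrite (Rintegral_rV_cons iA1 (cintegrable_Im iB)).
  rewrite (Rintegral_rV_cons iA2 (cintegrable_Re iB)) sE mul0r addr0.
  by have := congr1 (@complex.Im R) IHB; rewrite /= => ->; rewrite mulr0.
Qed.

End ProductTent.

(** * The L^2 bound for transforms of integrable functions *)

Section Bessel.
Variables (R : realType) (n : nat).
Local Notation T := 'rV[R]_n.
Local Notation mu := (lebesgue_rV R n).
Local Notation leb := (@lebesgue_measure R).
Implicit Types u : T -> R[i].

(** The Cauchy density up to the factor pi^n. The product form matches the bound on the tent
    transform and is integrable in every dimension; it also serves as majorant for Schwartz
    functions. *)
Definition cauchy_prod (x : T) : R := \prod_(i < n) (1 + x ord0 i ^+ 2)^-1.

Lemma cauchy_prod_gt0 x : 0 < cauchy_prod x.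
Proof. by apply: prodr_gt0 => i _; rewrite invr_gt0 ltr_pwDl// sqr_ge0. Qed.

Lemma measurable_cauchy1 : measurable_fun setT (fun t : R => (1 + t ^+ 2)^-1).
Proof. by apply: continuous_measurable_fun; exact: continuous_oneDsqrV. Qed.

Lemma measurable_cauchy_prod : measurable_fun setT cauchy_prod.
Proof.
apply: measurable_prod => i _; apply: (measurableT_comp measurable_cauchy1).
exact: measurable_coord.
Qed.

(** The half-line integral is known from the arctangent; the negative half is reduced to it by the
    reflection t -> - t. *)
Lemma integral_cauchy1_lty : (\int[leb]_t ((1 + t ^+ 2)^-1)%:E < +oo)%E.
Proof.
have g0 (t : R) : 0 <= (1 + t ^+ 2)^-1 by rewrite invr_ge0 addr_ge0// sqr_ge0.
have mg : measurable_fun setT (fun t : R => ((1 + t ^+ 2)^-1)%:E).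
  by apply/measurable_EFinP; exact: measurable_cauchy1.
have mI : measurable (`[0%R, +oo[%classic : set (measurableTypeR R)) by [].
have dI : [disjoint (`[0%R, +oo[%classic : set R) & ~` `[0%R, +oo[%classic].
  by apply/disj_setPCl.
rewrite -(setUv `[0%R, +oo[%classic).
rewrite (ge0_integral_setU leb mI (measurableC mI) (measurable_funTS mg) (fun x _ => g0 x) dI).
have I0 := integral0y_oneDsqr R.
have h1 : (\int[leb]_(t in `[0%R, +oo[) ((1 + t ^+ 2)^-1)%:E < +oo)%E.
  by rewrite [X in (X < _)%E]I0 ltry.
rewrite lte_add_pinfty//.
apply: le_lt_trans h1.
rewrite [leRHS](@ge0_integration_by_substitution0 _ (fun t : R => ((1 + t ^+ 2)^-1)%:E))//.
under [leRHS]eq_integral do rewrite sqrrN.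
apply: ge0_subset_integral => //.
- exact: measurableC.
- exact: measurable_funTS.
- by move=> t _; rewrite lee_fin.
- move=> t /=; rewrite !in_itv/= andbT => /negP; rewrite -ltNge => /ltW //.
Qed.

Lemma integral_cauchy_prod_lty : (\int[mu]_x (cauchy_prod x)%:E < +oo)%E.
Proof.
rewrite (ge0_integral_prod n measurable_cauchy1).
  apply: expe_lty; last exact: integral_cauchy1_lty.
  by apply: integral_ge0 => t _; rewrite lee_fin invr_ge0 addr_ge0// sqr_ge0.
by move=> t; rewrite invr_ge0 addr_ge0// sqr_ge0.
Qed.

Definition tent_scale (e : R) (x : T) : R := tent_rV (e *: x).

Lemma measurable_scale (e : R) : measurable_fun setT (fun x : T => e *: x).
Proof.
apply: measurable_fun_coordP => i; under eq_fun do rewrite mxE.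
by apply: measurable_funM => //; exact: measurable_coord.
Qed.

Lemma cintegrable_tent_scale (e : R) : 0 < e ->
  cintegrable (fun x => (tent_scale e x)%:C).
Proof.
move=> e0; have := cintegrable_affine 0 e0 (@cintegrable_tent_rV R n).
by under eq_fun do rewrite addr0.
Qed.

Lemma fourier_scale (s a : R) (m : T -> R[i]) x : 0 < a -> cintegrable m ->
  (a ^+ n)%:C * fourier_kernel s (fun y => m (a *: y)) x =
  fourier_kernel s m (a^-1 *: x).
Proof.
move=> a0 mi; have := cintegral_affine 0 a0 (cintegrable_kernel s (a^-1 *: x) mi).
rewrite /fourier_kernel => <-; congr (_ * cintegral _); apply/funext => y.
rewrite addr0 dotrZl dotrZr; congr (expi (s * _) * _).
by rewrite mulrA mulVf ?mul1r// gt_eqF.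
Qed.

(** The condition on s removes it from the bound: 1 + (s t)^2 >= 1 + t^2 in each coordinate. *)
Lemma norm1_fourier_tent_scale (s e : R) x : 0 < e -> 1 <= s ^+ 2 ->
  norm1 (fourier_kernel s (fun x => (tent_scale e x)%:C) x) <=
  (e ^+ n)^-1 * (8 ^+ n * cauchy_prod (e^-1 *: x)).
Proof.
move=> e0 s1; have en : 0 < e ^+ n by rewrite exprn_gt0.
have := fourier_scale s x e0 (@cintegrable_tent_rV R n).
rewrite fourier_tent_rV => H.
have -> : fourier_kernel s (fun y => (tent_scale e y)%:C) x =
    ((e ^+ n)^-1 * \prod_(i < n) tent_hat (s * (e^-1 *: x) ord0 i))%:C.
  apply: (@mulfI _ (e ^+ n)%:C).
    by rewrite eq_complex /= eqxx andbT gt_eqF.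
  by rewrite H -rmorphM /= mulVKf// gt_eqF.
rewrite norm1_real normrM gtr0_norm ?invr_gt0// ler_wpM2l ?invr_ge0 ?(ltW en)//.
rewrite normr_prod /cauchy_prod -[X in 8 ^+ X](card_ord n) -prodr_const -big_split.
apply: ler_prod => i _; rewrite normr_ge0 /=; apply: le_trans (tent_hat_le _) _.
rewrite ler_wpM2l// lef_pV2 ?posrE ?ltr_pwDl ?sqr_ge0// lerD2l exprMn.
by rewrite ler_peMl// sqr_ge0.
Qed.

(* Schur test: the left-hand side is a quadratic form in [u] whose kernel is the
   Fourier transform of the tent, with integral independent of [e]. *)
Lemma tent_scale_bessel (s e : R) u : 0 < e -> 1 <= s ^+ 2 -> cintegrable u ->
  (\int[mu]_x (tent_scale e x * sqnorm (fourier_kernel s u x))%:E <=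
   (8 ^+ n)%:E * (\int[mu]_x (cauchy_prod x)%:E) * \int[mu]_x (norm1 (u x) ^+ 2)%:E)%E.
Proof.
move=> e0 s1 ui; have en : 0 < e ^+ n by rewrite exprn_gt0.
pose K x := (e ^+ n)^-1 * (8 ^+ n * cauchy_prod (e^-1 *: x)).
have mK : measurable_fun setT K.
  apply: measurable_funM => //; apply: measurable_funM => //.
  by apply: (measurableT_comp measurable_cauchy_prod); exact: measurable_scale.
have K0 x : 0 <= K x.
  by rewrite !mulr_ge0 ?invr_ge0 ?(ltW en)// ltW// cauchy_prod_gt0.
have KN x : K (- x) = K x.
  rewrite /K scalerN; congr (_ * (_ * _)).
  by apply: eq_bigr => i _; rewrite mxE sqrrN.
have intK : (\int[mu]_x (K x)%:E = (8 ^+ n)%:E * (\int[mu]_x (cauchy_prod x)%:E))%E.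
  have e'0 : 0 < e^-1 by rewrite invr_gt0.
  have mE : measurable_fun setT (fun x => (cauchy_prod x)%:E).
    by apply/measurable_EFinP; exact: measurable_cauchy_prod.
  have c0 x : (0 <= (cauchy_prod x)%:E)%E by rewrite lee_fin ltW// cauchy_prod_gt0.
  rewrite -(ge0_integral_dilate e'0 mE c0) -ge0_integralZl//; last 2 first.
  - by apply/measurable_EFinP; apply: (measurableT_comp measurable_cauchy_prod); exact: measurable_scale.
  - by rewrite lee_fin exprn_ge0// ltW.
  rewrite -ge0_integralZl//; last 2 first.
  - apply/measurable_EFinP; apply: measurable_funM => //.
    by apply: (measurableT_comp measurable_cauchy_prod); exact: measurable_scale.
  - by move=> x _; rewrite mule_ge0// lee_fin exprn_ge0// ltW.
  by apply: eq_integral => x _; rewrite /K -!EFinM exprVn mulrCA.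
have mN : measurable_fun setT (fun x => norm1 (u x) ^+ 2).
  by apply: measurable_funX; exact: measurable_norm1 ui.1.
have mdiff : measurable_fun setT (fun z : T * T => K (z.1 - z.2)).
  apply: measurableT_comp => //; apply: measurable_fun_coordP => i.
  under eq_fun do rewrite !mxE.
  apply: measurable_funB.
  - exact: (measurableT_comp (measurable_coord i) measurable_fst).
  - exact: (measurableT_comp (measurable_coord i) measurable_snd).
have mdx (x : T) : measurable_fun setT (fun y : T => K (x - y)).
  exact: (measurableT_comp mdiff (measurable_pair1 x)).
have mdy (y : T) : measurable_fun setT (fun x : T => K (x - y)).
  exact: (measurableT_comp mdiff (measurable_pair2 y)).
have shiftK y : (\int[mu]_x (K (x - y))%:E = \int[mu]_x (K x)%:E)%E.
  apply: (ge0_integral_shift (- y) (f := fun x => (K x)%:E)) => //.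
    exact/measurable_EFinP.
have shiftK' x : (\int[mu]_y (K (x - y))%:E = \int[mu]_x (K x)%:E)%E.
  by rewrite -(shiftK x); apply: eq_integral => y _; rewrite -KN opprB.
have := fourier_bilinear (cintegrable_tent_scale e0) ui ui mK
  (fun x => norm1_fourier_tent_scale x e0 s1).
set J := cintegral _ => HJ.
have mF := cmeasurable_fourier s ui.
have mts : measurable_fun setT (tent_scale e).
  by apply: (measurableT_comp (@measurable_tent_rV R n)); exact: measurable_scale.
have EJ : J = (\int[mu]_x (tent_scale e x * sqnorm (fourier_kernel s u x)))%:C.
  rewrite /J -cintegral_real; congr cintegral; apply/funext => x.
  by rewrite mul_conj_sqnorm rmorphM.
(* [J] is built from [fine], which would turn an infinite integral into 0. Finiteness holds because
   the transform is bounded and the tent integrable. *)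
have Jfin : (\int[mu]_x (tent_scale e x * sqnorm (fourier_kernel s u x))%:E)%E
    \is a fin_num.
  have cm : cmeasurable (fun x => (sqnorm (fourier_kernel s u x))%:C).
    by apply: cmeasurable_real; exact: measurable_sqnorm.
  pose C := 2 * \int[mu]_y norm1 (u y).
  have bd x : norm1 (sqnorm (fourier_kernel s u x))%:C <= C ^+ 2.
    rewrite norm1_real ger0_norm ?sqnorm_ge0// (le_trans (sqnorm_le _))//.
    by rewrite ler_sqr ?nnegrE ?norm1_ge0// ?norm1_fourier// (le_trans (norm1_ge0 _) (norm1_fourier s 0 ui)).
  have := cintegrable_boundedM cm bd (cintegrable_tent_scale e0).
  move=> /cintegrable_Re/integrable_fin_num => /(_ measurableT).
  apply: eq_ind; congr (_ \is a fin_num); apply: eq_integral => x _ /=.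
  by rewrite mulr0 subr0 mulrC.
have -> : (\int[mu]_x (tent_scale e x * sqnorm (fourier_kernel s u x))%:E =
    (norm1 J)%:E)%E.
  rewrite EJ norm1_real ger0_norm; first by rewrite /Rintegral fineK.
  by apply: Rintegral_ge0 => x _; rewrite mulr_ge0 ?tent_rV_ge0 ?sqnorm_ge0.
apply: le_trans HJ _.
(* By the arithmetic-geometric mean inequality |u(x)| |u(y)| <= N(x) + N(y). Each half then
   separates, since K(x - y) has the same integral in x and, K being even, in y. *)
pose N x := 2^-1 * norm1 (u x) ^+ 2.
have N0 x : 0 <= N x by rewrite mulr_ge0// sqr_ge0.
have mN' : measurable_fun setT N by exact: measurable_funM.
have mNx : measurable_fun setT (fun z : T * T => (N z.1 * K (z.1 - z.2))%:E).
  apply/measurable_EFinP; apply: measurable_funM => //.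
  exact: (measurableT_comp mN' measurable_fst).
have mNy : measurable_fun setT (fun z : T * T => (N z.2 * K (z.1 - z.2))%:E).
  apply/measurable_EFinP; apply: measurable_funM => //.
  exact: (measurableT_comp mN' measurable_snd).
have Nx0 z : (0 <= (N z.1 * K (z.1 - z.2))%:E)%E by rewrite lee_fin mulr_ge0.
have Ny0 z : (0 <= (N z.2 * K (z.1 - z.2))%:E)%E by rewrite lee_fin mulr_ge0.
have IK0 : (0 <= \int[mu]_x (K x)%:E)%E by apply: integral_ge0 => x _; rewrite lee_fin.
have EN : (\int[mu]_x ((N x)%:E * \int[mu]_x (K x)%:E) =
    (\int[mu]_x (N x)%:E) * \int[mu]_x (K x)%:E)%E.
  rewrite ge0_integralZr//; first exact/measurable_EFinP.
  by move=> x _; rewrite lee_fin.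
have E1 : (\int[mu]_x \int[mu]_y (N x * K (x - y))%:E =
    (\int[mu]_x (N x)%:E) * \int[mu]_x (K x)%:E)%E.
  rewrite -EN; apply: eq_integral => x _; under eq_integral do rewrite EFinM.
  rewrite ge0_integralZl//; first by rewrite shiftK'.
  - exact/measurable_EFinP.
  - by move=> y _; rewrite lee_fin.
  - by rewrite lee_fin.
have E2 : (\int[mu]_x \int[mu]_y (N y * K (x - y))%:E =
    (\int[mu]_x (N x)%:E) * \int[mu]_x (K x)%:E)%E.
  transitivity (\int[mu]_y \int[mu]_x (N y * K (x - y))%:E)%E.
    exact: (fubini_tonelli (fun z : T * T => (N z.2 * K (z.1 - z.2))%:E) mNy Ny0).
  rewrite -EN; apply: eq_integral => y _; under eq_integral do rewrite EFinM.
  rewrite ge0_integralZl//; first by rewrite shiftK.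
  - exact/measurable_EFinP.
  - by move=> x _; rewrite lee_fin.
  - by rewrite lee_fin.
have mIx : measurable_fun setT (fun x => \int[mu]_y (N x * K (x - y))%:E)%E.
  exact: (measurable_fun_fubini_tonelli_F (fun z : T * T => (N z.1 * K (z.1 - z.2))%:E)).
have mIy : measurable_fun setT (fun x : T => \int[mu]_y (N y * K (x - y))%:E)%E.
  exact: (measurable_fun_fubini_tonelli_F (fun z : T * T => (N z.2 * K (z.1 - z.2))%:E)).
apply: (@le_trans _ _ (\int[mu]_x (\int[mu]_y (N x * K (x - y)%R)%:E +
    \int[mu]_y (N y * K (x - y)%R)%:E))%E).
  have m1 := measurable_norm1 ui.1.
  have mG : measurable_fun setT
      (fun z : T * T => (norm1 (u z.1) * norm1 (u z.2) * K (z.1 - z.2))%:E).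
    apply/measurable_EFinP; apply: measurable_funM => //; apply: measurable_funM.
    - exact: (measurableT_comp m1 measurable_fst).
    - exact: (measurableT_comp m1 measurable_snd).
  have G0 z : (0 <= (norm1 (u z.1) * norm1 (u z.2) * K (z.1 - z.2))%:E)%E.
    by rewrite lee_fin; apply: mulr_ge0 => //; apply: mulr_ge0; exact: norm1_ge0.
  apply: ge0_le_integral => //.
  - by move=> x _; apply: integral_ge0 => y _; exact: (G0 (x, y)).
  - exact: (measurable_fun_fubini_tonelli_F
      (fun z : T * T => (norm1 (u z.1) * norm1 (u z.2) * K (z.1 - z.2))%:E)).
  - exact: emeasurable_funD.
  move=> x _; rewrite -ge0_integralD//; last 4 first.
  - by move=> y _; exact: (Nx0 (x, y)).
  - exact: (measurableT_comp mNx (measurable_pair1 x)).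
  - by move=> y _; exact: (Ny0 (x, y)).
  - exact: (measurableT_comp mNy (measurable_pair1 x)).
  apply: ge0_le_integral => //.
  - by move=> y _; exact: (G0 (x, y)).
  - exact: (measurableT_comp mG (measurable_pair1 x)).
  - apply: emeasurable_funD.
    + exact: (measurableT_comp mNx (measurable_pair1 x)).
    + exact: (measurableT_comp mNy (measurable_pair1 x)).
  - move=> y _; rewrite -EFinD lee_fin -mulrDl ler_wpM2r// /N.
    have := sqr_ge0 (norm1 (u x) - norm1 (u y)); nra.
rewrite ge0_integralD//; last 2 first.
- by move=> x _; apply: integral_ge0 => y _; exact: (Nx0 (x, y)).
- by move=> x _; apply: integral_ge0 => y _; exact: (Ny0 (x, y)).
rewrite E1 E2 -ge0_muleDl; last 2 first.
- by apply: integral_ge0 => x _; rewrite lee_fin.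
- by apply: integral_ge0 => x _; rewrite lee_fin.
rewrite -ge0_integralD//; last 4 first.
- by move=> x _; rewrite lee_fin.
- exact/measurable_EFinP.
- by move=> x _; rewrite lee_fin.
- exact/measurable_EFinP.
rewrite intK muleC; apply: lee_wpmul2l; first by rewrite -intK.
apply: ge0_le_integral => //.
- by move=> x _; rewrite -EFinD lee_fin addr_ge0.
- by apply: emeasurable_funD; exact/measurable_EFinP.
- exact/measurable_EFinP.
- by move=> x _; rewrite -EFinD lee_fin /N; lra.
Qed.

(** The tent bound does not depend on the width, and on a cube a wide enough tent is at least 2^-n;
    monotone convergence over growing cubes concludes. In the constant, 2^n undoes the tent, 2
    compares [norm1] with [sqnorm], and the added 1 ensures positivity. *)
Lemma bessel_inequality (s : R) : 1 <= s ^+ 2 -> exists2 C : R, 0 < C &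
  forall u, cintegrable u ->
    (\int[mu]_x (sqnorm (fourier_kernel s u x))%:E <=
     C%:E * \int[mu]_x (sqnorm (u x))%:E)%E.
Proof.
move=> s1.
have c0 : (0 <= \int[mu]_x (cauchy_prod x)%:E)%E.
  by apply: integral_ge0 => x _; rewrite lee_fin ltW// cauchy_prod_gt0.
pose I := fine (\int[mu]_x (cauchy_prod x)%:E)%E.
have IE : (\int[mu]_x (cauchy_prod x)%:E = I%:E)%E.
  by rewrite /I fineK// ge0_fin_numE// integral_cauchy_prod_lty.
have I0 : 0 <= I by rewrite fine_ge0.
exists (2 ^+ n * (2 * (8 ^+ n * I)) + 1); first by rewrite ltr_wpDl// !mulr_ge0.
move=> u ui.
have mF := cmeasurable_fourier s ui.
have mS := measurable_sqnorm mF.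
pose B (N : nat) := [set x : T | forall i, x ord0 i \in `[- N%:R, N%:R]].
have mB N : measurable (B N) by exact: (measurable_box (fun=> - N%:R) (fun=> N%:R)).
have ndB : nondecreasing_seq B.
  move=> N M NM; apply/subsetPset => x /= h i; have := h i.
  rewrite !in_itv/= => /andP[h1 h2]; have NM' : (N%:R <= M%:R :> R) by rewrite ler_nat.
  by rewrite (le_trans h2 NM') (le_trans _ h1)// lerN2.
have BT : \bigcup_N B N = setT.
  apply/seteqP; split => // x _.
  exists (Num.bound (\sum_i `|x ord0 i|)) => // i; rewrite in_itv/= -ler_norml.
  apply: le_trans (ltW (archi_boundP _)).
    by rewrite (bigD1 i)//= lerDl sumr_ge0.
  exact: sumr_ge0.
have cvg := @ge0_nondecreasing_set_cvg_integral _ T R B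
  (fun x => (sqnorm (fourier_kernel s u x))%:E) mu ndB mB
  (fun N => measurable_funTS (measurableT_comp (@EFin_measurable R setT) mS))
  (fun N x _ => sqnorm_ge0 _).
rewrite BT in cvg.
rewrite -(cvg_lim _ cvg)//; apply: lime_le; first by apply/cvg_ex; eexists; exact: cvg.
apply: nearW => N.
(* With this width the rescaled coordinates of a point of [B N] are at most 1/2 in absolute value,
   where the tent is at least 1/2; the successor covers N = 0. *)
have e0 : 0 < (2 * N.+1%:R)^-1 :> R by rewrite invr_gt0 mulr_gt0.
have tB x : B N x -> (2 ^+ n)^-1 <= tent_scale (2 * N.+1%:R)^-1 x.
  move=> h; rewrite /tent_scale /tent_rV -exprVn -[X in _ ^+ X](card_ord n) -prodr_const.
  apply: ler_prod => i _; rewrite invr_ge0 ler0n /= -[2^-1]mul1r tent_ge_half//.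
  have := h i; rewrite mxE in_itv/= -ler_norml => hi.
  rewrite normrM gtr0_norm// mulrC ler_pdivrMr ?mulr_gt0//.
  have : N%:R <= N.+1%:R :> R by rewrite ler_nat.
  lra.
have mts : measurable_fun setT (tent_scale (2 * N.+1%:R)^-1).
  by apply: (measurableT_comp (@measurable_tent_rV R n)); exact: measurable_scale.
apply: (@le_trans _ _ ((2 ^+ n)%:E * \int[mu]_x (tent_scale (2 * N.+1%:R)^-1 x *
    sqnorm (fourier_kernel s u x))%:E)%E).
  rewrite -ge0_integralZl//; last 2 first.
  - by apply/measurable_EFinP; exact: measurable_funM.
  - by move=> x _; rewrite lee_fin mulr_ge0 ?tent_rV_ge0 ?sqnorm_ge0.
  apply: (@le_trans _ _ (\int[mu]_(x in B N) ((2 ^+ n)%:E *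
      (tent_scale (2 * N.+1%:R)^-1 x * sqnorm (fourier_kernel s u x))%:E))%E).
    apply: ge0_le_integral => //.
    - by move=> x _; rewrite lee_fin sqnorm_ge0.
    - by apply: measurable_funTS; exact/measurable_EFinP.
    - apply: measurable_funTS; apply: emeasurable_funM => //.
      by apply/measurable_EFinP; exact: measurable_funM.
    - move=> x Bx; rewrite -EFinM lee_fin mulrA ler_peMl ?sqnorm_ge0//.
      by rewrite -ler_pdivrMl ?exprn_gt0// mulr1 tB.
  apply: ge0_subset_integral => //.
  - apply: emeasurable_funM => //.
    by apply/measurable_EFinP; exact: measurable_funM.
  - by move=> x _; rewrite -EFinM lee_fin !mulr_ge0 ?exprn_ge0 ?tent_rV_ge0 ?sqnorm_ge0.
have H := tent_scale_bessel e0 s1 ui; rewrite IE in H.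
have n2 : (\int[mu]_x (norm1 (u x) ^+ 2)%:E <= 2%:E * \int[mu]_x (sqnorm (u x))%:E)%E.
  have mu1 := measurable_sqnorm ui.1.
  rewrite -ge0_integralZl//; last 2 first.
  - exact/measurable_EFinP.
  - by move=> x _; rewrite lee_fin sqnorm_ge0.
  apply: ge0_le_integral => //.
  - by move=> x _; rewrite lee_fin sqr_ge0.
  - by apply/measurable_EFinP; apply: measurable_funX; exact: measurable_norm1 ui.1.
  - by apply: emeasurable_funM => //; exact/measurable_EFinP.
  - by move=> x _; rewrite -EFinM lee_fin norm1_sqr_le.
have S0 : (0 <= \int[mu]_x (sqnorm (u x))%:E)%E.
  by apply: integral_ge0 => x _; rewrite lee_fin sqnorm_ge0.
apply: le_trans (lee_wpmul2l _ H) _; first by rewrite lee_fin exprn_ge0.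
apply: le_trans (lee_wpmul2l _ (lee_wpmul2l _ n2)) _.
- by rewrite lee_fin exprn_ge0.
- by rewrite -EFinM lee_fin mulr_ge0// exprn_ge0.
rewrite -EFinM !muleA -!EFinM.
apply: lee_wpmul2r => //; rewrite lee_fin; lra.
Qed.

End Bessel.

(** * Fourier transforms of Hoelder functions *)

Section EuclideanNorm.
Variables (R : realType) (n : nat).
Local Notation T := 'rV[R]_n.
Implicit Types x y : T.

Lemma dotr_ge0 x : 0 <= dotr x x.
Proof. by apply: sumr_ge0 => i _; rewrite -expr2 sqr_ge0. Qed.

Lemma enorm_ge0 x : 0 <= enorm x. Proof. exact: sqrtr_ge0. Qed.

Lemma enorm_sqr x : enorm x ^+ 2 = dotr x x.
Proof. by rewrite sqr_sqrtr// dotr_ge0. Qed.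

Lemma enorm0 : enorm (0 : T) = 0.
Proof. by rewrite /enorm /dotr big1 ?sqrtr0// => i _; rewrite mxE mul0r. Qed.

Lemma enormZ (a : R) x : enorm (a *: x) = `|a| * enorm x.
Proof. by rewrite /enorm dotrZl dotrZr mulrA -expr2 sqrtrM ?sqr_ge0// sqrtr_sqr. Qed.

Lemma enormN x : enorm (- x) = enorm x.
Proof. by rewrite -scaleN1r enormZ normrN1 mul1r. Qed.

Lemma enormBC x y : enorm (x - y) = enorm (y - x).
Proof. by rewrite -enormN opprB. Qed.

Lemma enorm_coord x i : `|x ord0 i| <= enorm x.
Proof.
rewrite -(@ler_pXn2r _ 2)// ?nnegrE ?enorm_ge0// enorm_sqr real_normK ?num_real//.
rewrite /dotr (bigD1 i)//= -expr2 lerDl sumr_ge0// => j _.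
by rewrite -expr2 sqr_ge0.
Qed.

Lemma enorm_gt0 x : x != 0 -> 0 < enorm x.
Proof.
move=> x0; rewrite lt_neqAle enorm_ge0 andbT eq_sym.
apply: contra x0 => /eqP e; apply/eqP/rowP => i; rewrite mxE.
by apply/eqP; rewrite -normr_le0 -e enorm_coord.
Qed.

Lemma dotr_cauchy_schwarz x y : `|dotr x y| <= enorm x * enorm y.
Proof.
rewrite -(@ler_pXn2r _ 2)// ?nnegrE ?mulr_ge0 ?enorm_ge0//.
rewrite real_normK ?num_real// exprMn !enorm_sqr.
have := dotr_ge0 (dotr y y *: x - dotr x y *: y).
rewrite dotrDl !dotrDr -!scaleNr !dotrZl !dotrZr (dotrC y x).
have [y0|y0] := eqVneq y 0.
  move=> _; suff -> : dotr x y = 0 by rewrite expr0n mulr_ge0// dotr_ge0.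
  by rewrite y0 /dotr big1// => i _; rewrite mxE mulr0.
have d0 : 0 < dotr y y by rewrite -enorm_sqr exprn_gt0// enorm_gt0.
move: (dotr x x) (dotr x y) (dotr y y) d0 => a b c c0 h.
have : 0 <= c * (a * c - b ^+ 2) by apply: le_trans h _; rewrite le_eqVlt; apply/orP; left; apply/eqP; ring.
by rewrite pmulr_rge0// subr_ge0.
Qed.

Lemma ler_enormD x y : enorm (x + y) <= enorm x + enorm y.
Proof.
rewrite -(@ler_pXn2r _ 2)// ?nnegrE ?addr_ge0 ?enorm_ge0//.
rewrite sqrrD !enorm_sqr dotrDl !dotrDr (dotrC y x).
have := dotr_cauchy_schwarz x y; have := ler_norm (dotr x y); lra.
Qed.

Lemma ler_enorm_dist x y : `|enorm x - enorm y| <= enorm (x - y).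
Proof.
have h1 := ler_enormD (x - y) y; have h2 := ler_enormD (y - x) x.
rewrite !subrK in h1 h2; rewrite enormBC in h2.
by rewrite ler_norml; lra.
Qed.

Lemma enorm_le_sum x : enorm x <= \sum_i `|x ord0 i|.
Proof.
rewrite -(@ler_pXn2r _ 2)// ?nnegrE ?sumr_ge0 ?enorm_ge0// enorm_sqr expr2 mulr_suml.
apply: ler_sum => i _; rewrite -expr2 -real_normK ?num_real// expr2 ler_wpM2l//.
by rewrite (bigD1 i)//= lerDl sumr_ge0.
Qed.

Lemma near_enorm x (e : R) : 0 < e -> \forall y \near x, enorm (x - y) < e.
Proof.
move=> e0; have d0 : 0 < e / n.+1%:R by rewrite divr_gt0.
near=> y.
have : ball x (e / n.+1%:R) y.
  by near: y; exact: nbhsx_ballx.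
case=> _ h; apply: le_lt_trans (enorm_le_sum _) _.
have : \sum_i `|(x - y) ord0 i| <= \sum_(i < n) e / n.+1%:R.
  apply: ler_sum => i _; rewrite !mxE; apply: ltW; exact: (h ord0 i).
move=> /le_lt_trans; apply.
rewrite sumr_const card_ord -[X in X < _]mulr_natr mulrAC ltr_pdivrMr// ltr_pM2l//.
by rewrite ltr_nat.
Unshelve. all: by end_near. Qed.

Definition cube (r : R) : set T := [set x | forall i, x ord0 i \in `[- r, r]].

Lemma measurable_cube r : measurable (cube r).
Proof. exact: (measurable_box (fun=> - r) (fun=> r)). Qed.

Lemma lebesgue_cube r : 0 <= r -> lebesgue_rV R n (cube r) = ((2 * r) ^+ n)%:E.
Proof.
move=> r0; rewrite (lebesgue_rV_box (a := fun=> - r) (b := fun=> r)).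
  by rewrite prodr_const card_ord opprK -mulr2n mulr_natl.
by move=> _; lra.
Qed.

Lemma cube_enorm r x : enorm x <= r -> cube r x.
Proof. by move=> h i; rewrite in_itv/= -ler_norml (le_trans (enorm_coord _ _)). Qed.

Lemma cintegrable_cube (f : T -> R[i]) (C r : R) : 0 <= r -> cmeasurable f ->
  (forall x, norm1 (f x) <= C) -> (forall x, r < enorm x -> f x = 0) ->
  cintegrable f.
Proof.
move=> r0 mf fC fr.
have C0 : 0 <= C by exact: le_trans (norm1_ge0 _) (fC 0).
apply: (@cintegrable_le _ _ _ (fun x => C * \1_(cube r) x)) => //.
- by apply: measurable_funM => //; apply: measurable_indic; exact: measurable_cube.
- move=> x; rewrite indicE; case: (boolP (x \in cube r)) => /= hx.
    by rewrite mulr1.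
  rewrite mulr0 fr ?norm1_0// ltNge; apply/negP => h.
  by move/negP: hx; apply; rewrite inE; exact: cube_enorm.
- under eq_integral do rewrite EFinM.
  rewrite ge0_integralZl//; last first.
    by apply/measurable_EFinP; apply: measurable_indic; exact: measurable_cube.
  rewrite integral_indic ?setIT//; last exact: measurable_cube.
  by rewrite [X in (_ * X)%E](lebesgue_cube r0) -EFinM ltry.
Qed.

End EuclideanNorm.

(** * Fourier decay of Hoelder bumps and the uniform dyadic kernel bound *)

Section HolderKernel.
Variables (R : realType) (n : nat).
Local Notation T := 'rV[R]_n.
Local Notation mu := (lebesgue_rV R n).
Implicit Types f g : T -> R[i].

(** The class is closed under linear combinations, so a matrix symbol can be treated entry by entry.
    The radius 4 is the outer radius of [cutoff]. *)
Definition holder_bump (alpha : R) f : Prop :=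
  [/\ exists C, forall x y, norm1 (f x - f y) <= C * enorm (x - y) `^ alpha,
      exists C, forall x, norm1 (f x) <= C &
      forall x, 4 < enorm x -> f x = 0].

Lemma holder_bumpD (alpha : R) f g : holder_bump alpha f -> holder_bump alpha g ->
  holder_bump alpha (fun x => f x + g x).
Proof.
move=> [[C1 h1] [B1 b1] s1] [[C2 h2] [B2 b2] s2]; split.
- exists (C1 + C2) => x y.
  rewrite (_ : _ - _ = (f x - f y) + (g x - g y)); last by ring.
  by rewrite (le_trans (ler_norm1D _ _))// mulrDl lerD.
- by exists (B1 + B2) => x; rewrite (le_trans (ler_norm1D _ _))// lerD.
- by move=> x hx; rewrite s1// s2// addr0.
Qed.

Lemma holder_bumpZ (alpha : R) (c : R[i]) f : holder_bump alpha f ->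
  holder_bump alpha (fun x => c * f x).
Proof.
move=> [[C1 h1] [B1 b1] s1]; split.
- exists (norm1 c * C1) => x y.
  by rewrite -mulrBr (le_trans (ler_norm1M _ _))// -mulrA ler_wpM2l// norm1_ge0.
- exists (norm1 c * B1) => x.
  by rewrite (le_trans (ler_norm1M _ _))// ler_wpM2l// norm1_ge0.
- by move=> x hx; rewrite s1// mulr0.
Qed.

Lemma holder_bump_sum (alpha : R) (I : Type) (r : seq I) (F : I -> T -> R[i]) :
  (forall i, holder_bump alpha (F i)) ->
  holder_bump alpha (fun x => \sum_(i <- r) F i x).
Proof.
move=> hF; elim: r => [|i r IH].
  under eq_fun do rewrite big_nil.
  split=> //; last by exists 0 => x; rewrite norm1_0.
  by exists 0 => x y; rewrite subrr norm1_0 mul0r.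
by under eq_fun do rewrite big_cons; exact: holder_bumpD.
Qed.

(** The Hoelder bound yields continuity, with (e / (|C| + 1))^(1/alpha) as modulus; |C| + 1 is used
    because the sign of C is unconstrained. *)
Lemma cmeasurable_holder_bump (alpha : R) f : 0 < alpha -> holder_bump alpha f ->
  cmeasurable f.
Proof.
move=> a0 [[C hC] _ _].
have key (h : T -> R) : (forall x y, `|h x - h y| <= C * enorm (x - y) `^ alpha) ->
    measurable_fun setT h.
  move=> hh; suff ch : continuous h by exact: continuous_measurable_rV.
  move=> x; apply: (iffRL (@cvgrPdist_lt _ _ _ (nbhs (x : T)) _ h (h x))) => e e0.
  have C1 : 0 < `|C| + 1 by rewrite ltr_wpDl.
  have q0 : 0 < e / (`|C| + 1) by rewrite divr_gt0.
  have r0 : 0 < (e / (`|C| + 1)) `^ alpha^-1 by rewrite powR_gt0.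
  near=> y.
  have : enorm (x - y) < (e / (`|C| + 1)) `^ alpha^-1.
    by near: y; exact: near_enorm.
  move=> /(gt0_ltr_powR a0); rewrite !nnegrE enorm_ge0 powR_ge0.
  move=> /(_ isT isT); rewrite -powRrM mulVf ?gt_eqF// powRr1 ?(ltW q0)// => hy.
  apply: le_lt_trans (hh x y) _; apply: (@le_lt_trans _ _ ((`|C| + 1) * enorm (x - y) `^ alpha)).
    by rewrite ler_wpM2r ?powR_ge0// (le_trans (ler_norm C))// lerDl.
  by rewrite mulrC -ltr_pdivlMr.
split; apply: key => x y; apply: le_trans (hC x y).
- by rewrite -ReN -ReD ler_norm1_Re.
- by rewrite -ImN -ImD ler_norm1_Im.
Unshelve. all: by end_near. Qed.

Lemma cintegrable_holder_bump (alpha : R) f : 0 < alpha -> holder_bump alpha f ->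
  cintegrable f.
Proof.
move=> a0 hf; have mf := cmeasurable_holder_bump a0 hf.
have [_ [C hC] sf] := hf.
exact: (@cintegrable_cube _ _ _ C 4).
Qed.

Lemma normr_sin_le (t : R) : `|sin t| <= `|t|.
Proof.
wlog t0 : t / 0 <= t.
  move=> H; have [/H//|t0] := leP 0 t.
  by have := H (- t); rewrite sinN !normrN; apply; lra.
have [|c _] := @MVT_segment R sin cos 0 t t0.
  by apply: continuous_subspaceT; exact: continuous_sin.
by rewrite sin0 !subr0 => ->; rewrite normrM ler_piMl// cos_max.
Qed.

Lemma normr_cosB1_le (t : R) : `|cos t - 1| <= `|t|.
Proof.
wlog t0 : t / 0 <= t.
  move=> H; have [/H//|t0] := leP 0 t.
  by have := H (- t); rewrite cosN !normrN; apply; lra.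
have [|c _] := @MVT_segment R cos (fun x => - sin x) 0 t t0.
  by apply: continuous_subspaceT; exact: continuous_cos.
by rewrite cos0 subr0 => ->; rewrite normrM normrN ler_piMl// sin_max.
Qed.

Lemma norm1_expiB1 (t : R) : norm1 (expi t - 1) <= 2 * `|t|.
Proof.
rewrite /norm1 /= oppr0 addr0.
have := normr_sin_le t; have := normr_cosB1_le t; lra.
Qed.

(** Since f has integral 0, the exponential may be replaced by itself minus 1, which is at most 2
    |s| |z| |x| in [norm1]; on the support |x| <= 4, whence the 8. *)
Lemma fourier_small (alpha : R) f (s : R) : 0 < alpha -> holder_bump alpha f ->
  cintegral f = 0 ->
  exists2 C, 0 <= C & forall z, norm1 (fourier_kernel s f z) <= C * enorm z.
Proof.
move=> a0 hf f0; have fi := cintegrable_holder_bump a0 hf.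
exists (8 * `|s| * \int[mu]_x norm1 (f x)).
  by rewrite !mulr_ge0// Rintegral_ge0// => x _; exact: norm1_ge0.
move=> z; rewrite -[fourier_kernel _ _ _]subr0 -f0 /fourier_kernel -cintegralB//; last first.
  exact: cintegrable_kernel.
apply: le_trans (norm1_cintegral_le (cintegrableB (cintegrable_kernel s z fi) fi)) _.
rewrite mulrAC -RintegralZl//; last exact: cintegrable_norm1.
have h := cintegrable_norm1 (cintegrableB (cintegrable_kernel s z fi) fi).
have h' := integrableZl measurableT (8 * `|s| * enorm z) (cintegrable_norm1 fi).
apply: le_Rintegral => // x _.
rewrite -[X in _ - X]mul1r -mulrBl.
have [hx|hx] := leP (enorm x) 4; last first.
  by have [_ _ sf] := hf; rewrite sf// !mulr0 norm1_0 mulr0.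
rewrite (le_trans (ler_norm1M _ _))// ler_wpM2r ?norm1_ge0//.
apply: le_trans (norm1_expiB1 _) _; rewrite normrM.
have := dotr_cauchy_schwarz z x; have := normr_ge0 s.
have := enorm_ge0 z.
move: (enorm z) (enorm x) `|s| `|dotr z x| hx => a b c e hx a0' c0 h1.
have : e <= a * 4 by rewrite (le_trans h1)// ler_wpM2l.
move=> /(ler_wpM2l c0); lra.
Qed.

(* Translation by [h], half a period of the exponential, changes the sign of the
   transform, so twice the transform of [f] is that of [f x - f (x + h)]. *)
Lemma fourier_decay (alpha : R) f (s : R) : 0 < alpha -> holder_bump alpha f ->
  pi <= `|s| ->
  exists2 C, 0 <= C & forall z, 1 <= enorm z ->
    norm1 (fourier_kernel s f z) <= C * enorm z `^ (- alpha).
Proof.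
move=> a0 hf spi; have fi := cintegrable_holder_bump a0 hf.
have [[C' hC'] _ sf] := hf.
pose C : R := `|C'|.
have C0 : 0 <= C by exact: normr_ge0.
have hC x y : norm1 (f x - f y) <= C * enorm (x - y) `^ alpha.
  by rewrite (le_trans (hC' x y))// ler_wpM2r ?powR_ge0// ler_norm.
have s0 : s != 0.
  by rewrite -normr_gt0 (lt_le_trans _ spi)// pi_gt0.
exists (C * (2 * 5) ^+ n); first by rewrite mulr_ge0// exprn_ge0.
move=> z z1; have z0 : 0 < enorm z by lra.
(* Chosen so that s <z, h> = pi, hence the exponential at h is -1. The hypothesis pi <= |s| makes
   |h| <= 1 / |z|, which turns |h|^alpha into the decay |z|^-alpha. *)
pose h := (pi / (s * enorm z ^+ 2)) *: z.
have sh : s * dotr z h = pi.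
  by rewrite dotrZr -enorm_sqr; field; rewrite s0 gt_eqF.
have hn : enorm h <= (enorm z)^-1.
  rewrite enormZ normrM normfV normrM (gtr0_norm (pi_gt0 R)) normrX (gtr0_norm z0).
  have -> : pi / (`|s| * enorm z ^+ 2) * enorm z = (pi / `|s|) * (enorm z)^-1.
    by field; rewrite normr_eq0 s0 gt_eqF.
  rewrite ler_piMl ?invr_ge0 ?(ltW z0)// ler_pdivrMr ?mul1r//.
  by rewrite normr_gt0.
have h1 : enorm h <= 1 by rewrite (le_trans hn)// invf_le1.
have fhi : cintegrable (fun x => f (x + h)) by exact: cintegrable_shift.
have E : fourier_kernel s f z = - fourier_kernel s (fun x => f (x + h)) z.
  rewrite /fourier_kernel -(cintegral_shift h (cintegrable_kernel s z fi)).
  rewrite -cintegralN; last exact: cintegrable_kernel.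
  congr cintegral; apply/funext => x; rewrite dotrDr mulrDr sh expiD.
  have -> : expi (pi : R) = -1 by rewrite /expi cospi sinpi; apply: complex_ext; rewrite /= ?oppr0.
  by ring.
have E2 : 2 * fourier_kernel s f z =
    cintegral (fun x => expi (s * dotr z x) * (f x - f (x + h))).
  rewrite mulr_natl mulr2n [X in _ + X]E /fourier_kernel -cintegralB; last 2 first.
  - exact: cintegrable_kernel.
  - exact: cintegrable_kernel.
  by congr cintegral; apply/funext => x; rewrite mulrBr.
have Di : cintegrable (fun x => f x - f (x + h)) by exact: cintegrableB.
have n2 : norm1 (2 * fourier_kernel s f z) = 2 * norm1 (fourier_kernel s f z).
  rewrite mulr_natl mulr2n /norm1 !ReImE -!mulr2n !normrMn -mulrnDl mulr_natl.
  by [].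
have := norm1_cintegral (cintegrable_kernel s z Di).
rewrite -E2 n2 => H.
have Q0 : 0 <= 2 * (C * enorm z `^ (- alpha)) by rewrite !mulr_ge0// powR_ge0.
(* As |h| <= 1 and f lives in |x| <= 4, the difference f(x) - f(x + h) vanishes outside the cube of
   half-side 5, of volume (2 * 5)^n. *)
have : ((2 * norm1 (fourier_kernel s f z))%:E <=
    \int[mu]_x (2 * (C * enorm z `^ (- alpha)) * \1_(cube (n := n) 5) x)%:E)%E.
  apply: le_trans H _; apply: ge0_le_integral => //.
  - by move=> x _; rewrite lee_fin norm1_ge0.
  - apply/measurable_EFinP; apply: measurable_norm1.
    by have [] := cintegrable_kernel s z Di.
  - apply/measurable_EFinP; apply: measurable_funM => //.
    by apply: measurable_indic; exact: measurable_cube.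
  move=> x _; rewrite lee_fin indicE; case: (boolP (x \in _)) => /= hx.
    rewrite mulr1 (le_trans (ler_norm1M _ _))// ler_pM ?norm1_ge0 ?ler_norm1_expi//.
    apply: le_trans (hC _ _) _; rewrite ler_wpM2l//.
    have -> : enorm z `^ (- alpha) = (enorm z)^-1 `^ alpha.
      by rewrite -powR_inv1 ?enorm_ge0// -powRrM mulN1r.
    rewrite opprD addNKr enormN; apply: ge0_ler_powR => //; first exact: ltW.
    - by rewrite nnegrE enorm_ge0.
    - by rewrite nnegrE invr_ge0 enorm_ge0.
  have nx : 5 < enorm x.
    by rewrite ltNge; apply/negP => h5; move/negP: hx; apply; rewrite inE; exact: cube_enorm.
  have := ler_enormD (x + h) (- h); rewrite addrK enormN => hh.
  by rewrite !sf ?subrr ?mulr0 ?norm1_0//; lra.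
under eq_integral do rewrite EFinM.
rewrite ge0_integralZl//; last by apply/measurable_EFinP; apply: measurable_indic; exact: measurable_cube.
rewrite integral_indic ?setIT//; last exact: measurable_cube.
have V : mu (cube (n := n) 5) = ((2 * 5) ^+ n)%:E by exact: lebesgue_cube.
rewrite [X in (_ <= _ * X)%E]V -EFinM lee_fin => {}H.
rewrite -(@ler_pM2l _ 2)//; apply: le_trans H _.
by rewrite le_eqVlt; apply/orP; left; apply/eqP; ring.
Qed.

(** Along the scales t = 2^i r the bound a t grows geometrically until t reaches 1, and b t^-alpha
    decays geometrically afterwards. The sum is therefore bounded independently of N and of the
    starting point r. *)
Lemma dyadic_sum_le (alpha a b : R) : 0 < alpha -> 0 <= a -> 0 <= b ->
  exists C, forall (N : nat) (r : R) (c : nat -> R), 0 <= r ->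
    (forall i, c i <= a * (2 ^+ i * r)) ->
    (forall i, 1 <= 2 ^+ i * r -> c i <= b * (2 ^+ i * r) `^ (- alpha)) ->
    \sum_(i < N) c i <= C.
Proof.
move=> al0 a0 b0.
pose q : R := 2 `^ (- alpha).
have q1 : q < 1.
  rewrite /q powRN invf_lt1 ?powR_gt0//.
  have : 1 `^ alpha < 2 `^ alpha :> R.
    by apply: gt0_ltr_powR => //; rewrite ?nnegrE ?ltr1n.
  by rewrite powR1.
have q0 : 0 < q by rewrite powR_gt0.
pose G := (1 - q)^-1.
have G0 : 0 < G by rewrite invr_gt0 subr_gt0.
have GE : 1 + G * q = G by rewrite /G; field; rewrite gt_eqF// subr_gt0.
(* A form suited to induction on N, dropping the first term and doubling r. The bound a (2 - r) is
   reproduced because a r + a (2 - 2 r) = a (2 - r), and b G r^-alpha because 1 + G q = G. If r <= 1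
   < 2 r, the first term is absorbed by a r <= a (2 - r). *)
suff H N (r : R) (c : nat -> R) : 0 < r ->
    (forall i, c i <= a * (2 ^+ i * r)) ->
    (forall i, 1 <= 2 ^+ i * r -> c i <= b * (2 ^+ i * r) `^ (- alpha)) ->
    (r <= 1 -> \sum_(i < N) c i <= a * (2 - r) + b * G) /\
    (1 <= r -> \sum_(i < N) c i <= b * G * r `^ (- alpha)).
  exists (a * 2 + b * G) => N r c; rewrite le_eqVlt => /predU1P[<- h1 _|r0 h1 h2].
    apply: (@le_trans _ _ 0); last by rewrite addr_ge0 ?mulr_ge0// ltW.
    apply: sumr_le0 => i _; have := h1 i; by rewrite !mulr0.
  have [H1 H2] := H N r c r0 h1 h2; have [r1|/ltW r1] := leP r 1.
    by apply: le_trans (H1 r1) _; nra.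
  apply: le_trans (H2 r1) _.
  have : r `^ (- alpha) <= 1.
    by rewrite powRN invf_le1 ?powR_gt0// -[leLHS](powRr0 r) ler_powR// ltW.
  have bG : 0 <= b * G by rewrite mulr_ge0// ltW.
  move=> /(ler_wpM2l bG); nra.
elim: N r c => [|N IH] r c r0 h1 h2.
  rewrite big_ord0; split => hr.
    by rewrite addr_ge0 ?mulr_ge0// ?ltW// ; lra.
  by rewrite !mulr_ge0 ?powR_ge0// ltW.
have [|||I1 I2] := IH (2 * r) (fun i => c i.+1).
- by rewrite mulr_gt0.
- by move=> i; have := h1 i.+1; rewrite exprSr -mulrA.
- by move=> i; have := h2 i.+1; rewrite exprSr -mulrA.
have E : \sum_(i < N.+1) c i = c 0%N + \sum_(i < N) c i.+1 by rewrite big_ord_recl.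
have P2 : (2 * r) `^ (- alpha) = q * r `^ (- alpha) by rewrite powRM// ltW.
have bG : 0 <= b * G by rewrite mulr_ge0// ltW.
have c0a : c 0%N <= a * r by have := h1 0%N; rewrite expr0 mul1r.
rewrite E; split=> hr.
  have [hr2|hr2] := leP (2 * r) 1.
    by have := I1 hr2; lra.
  have := I2 (ltW hr2) => I2'.
  have : (2 * r) `^ (- alpha) <= 1.
    by rewrite powRN invf_le1 ?powR_gt0 ?mulr_gt0// -[leLHS](powRr0 (2 * r)) ler_powR// ltW.
  move=> /(ler_wpM2l bG) => h3; have : a * r <= a * (2 - r) by rewrite ler_wpM2l//; lra.
  lra.
have I2' := I2 (le_trans hr (ler_peMl (ltW r0) (ler1n _ 2))).
have := h2 0%N; rewrite expr0 mul1r => /(_ hr) h20.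
rewrite P2 in I2'.
have -> : b * G * r `^ (- alpha) = b * r `^ (- alpha) + b * G * (q * r `^ (- alpha)).
  by rewrite -{1}GE; ring.
lra.
Qed.

Lemma kernel_bound (alpha : R) f (s : R) : 0 < alpha -> holder_bump alpha f ->
  pi <= `|s| -> cintegral f = 0 ->
  exists C, forall N z, \sum_(i < N) norm1 (fourier_kernel s f (2 ^+ i *: z)) <= C.
Proof.
move=> a0 hf spi f0.
have [a a1 ha] := fourier_small s a0 hf f0.
have [b b1 hb] := fourier_decay a0 hf spi.
have [C HC] := dyadic_sum_le a0 a1 b1.
have en i z : enorm (2 ^+ i *: z : T) = 2 ^+ i * enorm z.
  by rewrite enormZ ger0_norm// exprn_ge0.
exists C => N z; apply: (HC N (enorm z) (fun i => norm1 (fourier_kernel s f (2 ^+ i *: z)))).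
- exact: enorm_ge0.
- by move=> i; rewrite -en; exact: ha.
- by move=> i; rewrite -en; exact: hb.
Qed.

End HolderKernel.

(** * Extension of the Fourier transform to square integrable functions *)

Section FastLimit.
Context d (T : measurableType d) (R : realType) (mu : {measure set T -> \bar R}).

Lemma geometric_half_le (N : nat) : \sum_(0 <= k < N) (2^-1 : R) ^+ k <= 2.
Proof.
suff -> : \sum_(0 <= k < N) (2^-1 : R) ^+ k = 2 - 2 * 2^-1 ^+ N.
  by rewrite gerBl mulr_ge0// exprn_ge0// invr_ge0.
elim: N => [|N IH]; first by rewrite big_nil expr0 mulr1 subrr.
by rewrite big_nat_recr//= IH exprS; field.
Qed.

(** The Riesz-Fischer argument for a fast Cauchy sequence. Besides the limit it returns an
    integrable G with |a_k| <= M + 2 + G for all k, which later allows dominated convergence, and a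
    measurable set of full measure on which everything holds pointwise. *)
Lemma fast_l2_limit (a : nat -> T -> R) (c M : R) : 0 <= c ->
  (forall k, measurable_fun setT (a k)) -> (forall x, `|a 0%N x| <= M) ->
  (forall k, (\int[mu]_x ((a k.+1 x - a k x) ^+ 2)%:E <= (c * 4^-1 ^+ k)%:E)%E) ->
  exists D : set T, exists f G : T -> R,
    [/\ [/\ measurable D, {ae mu, forall x, D x}, measurable_fun setT f,
         measurable_fun setT G & (\int[mu]_x (G x)%:E < +oo)%E],
        forall x, 0 <= G x,
        forall x, D x -> a ^~ x @ \oo --> f x,
        forall x, ~ D x -> f x = 0 &
        forall x k, D x -> `|a k x| <= M + 2 + G x].
Proof.
move=> c0 ma aM ha.
pose u k x := a k.+1 x - a k x.
have mu_ k : measurable_fun setT (u k) by exact: measurable_funB.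
(* The weight 2^k costs half of the decay 4^-k: the integrals still sum to at most 2 c, while the
   weighted series controls the sum of |u_k| and not only of the squares. *)
pose w k x : \bar R := (2 ^+ k * u k x ^+ 2)%:E.
have mw k : measurable_fun setT (w k).
  by apply/measurable_EFinP; apply: measurable_funM => //; exact: measurable_funX.
have w0 k x : (0 <= w k x)%E by rewrite lee_fin; apply: mulr_ge0; [exact: exprn_ge0|exact: sqr_ge0].
pose S x := (\sum_(0 <= k <oo) w k x)%E.
have S0 x : (0 <= S x)%E by apply: nneseries_ge0 => k _ _; exact: w0.
have mS : measurable_fun setT S.
  by apply: ge0_emeasurable_sum => // k x _ _; exact: w0.
have Sint : (\int[mu]_x S x <= (c * 2)%:E)%E.
  rewrite integral_nneseries//.
  apply: lime_le; first by apply: is_cvg_nneseries => k _ _; apply: integral_ge0 => x _; exact: w0.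
  apply: nearW => N.
  apply: (@le_trans _ _ (\sum_(0 <= k < N) (c * 2^-1 ^+ k)%:E)%E).
    apply: lee_sum => k _.
    have -> : (\int[mu]_x w k x = (2 ^+ k)%:E * \int[mu]_x ((u k x) ^+ 2)%:E)%E.
      rewrite -ge0_integralZl//.
      - by apply/measurable_EFinP; exact: measurable_funX.
      - by move=> x _; rewrite lee_fin sqr_ge0.
    apply: le_trans (lee_wpmul2l _ (ha k)) _; first by rewrite lee_fin exprn_ge0.
    rewrite -EFinM lee_fin mulrCA ler_wpM2l// -exprMn.
    by rewrite (_ : 2 * 4^-1 = 2^-1)//; field.
  by rewrite sumEFin lee_fin -mulr_sumr ler_wpM2l// geometric_half_le.
have Sfin : (\int[mu]_x S x < +oo)%E by apply: le_lt_trans Sint _; rewrite ltry.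
pose D := [set x | (S x < +oo)%E].
have mD : measurable D.
  by have := emeasurable_fun_infty_o measurableT mS +oo%E; rewrite setTI.
have aeD : {ae mu, forall x, D x}.
  have iS : mu.-integrable setT S.
    by apply/integrableP; split => //; under eq_integral do rewrite gee0_abs//.
  have := integrable_ae measurableT iS; apply: filterS => x /(_ I).
  by rewrite ge0_fin_numE.
pose G x := fine (S x).
have mG : measurable_fun setT G by exact: (measurableT_comp (fine_measurable measurableT)).
have G0 x : 0 <= G x by exact: fine_ge0.
have bound x N : D x -> \sum_(0 <= k < N) `|u k x| <= 2 + G x.
  move=> Dx.
  have h1 : \sum_(0 <= k < N) (2 ^+ k * u k x ^+ 2) <= G x.
    rewrite -lee_fin /G fineK; last by rewrite ge0_fin_numE.
    rewrite -sumEFin; apply: (nneseries_lim_ge (u_ := fun k => w k x)) => k' _ _; exact: w0.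
  (* AM-GM: [v <= 2^-k + 2^k v^2] *)
  have h2 := geometric_half_le N.
  apply: (@le_trans _ _ (\sum_(0 <= k < N) (2^-1 ^+ k + 2 ^+ k * u k x ^+ 2))); last first.
    by rewrite big_split /= lerD.
  apply: ler_sum => k _.
  have p0 : 0 < (2 : R) ^+ k by rewrite exprn_gt0.
  have -> : 2^-1 ^+ k = (2 ^+ k)^-1 :> R by rewrite exprVn.
  rewrite -[u k x ^+ 2]real_normK ?num_real//.
  move: (2 ^+ k) `|u k x| (normr_ge0 (u k x)) p0 => p v v0 p0.
  have : 0 <= p^-1 * ((p * v - 1) ^+ 2 + p * v).
    by rewrite mulr_ge0 ?invr_ge0 ?(ltW p0)// addr_ge0 ?sqr_ge0 ?mulr_ge0// ltW.
  have -> : p^-1 * ((p * v - 1) ^+ 2 + p * v) = p^-1 + p * v ^+ 2 - v.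
    by field; rewrite gt_eqF.
  by rewrite subr_ge0.
have tel x N : a N x = a 0%N x + \sum_(0 <= k < N) u k x.
  by rewrite telescope_sumr// addrC subrK.
have cv x : D x -> cvgn (a ^~ x).
  move=> Dx.
  have : cvgn (series (fun k => u k x)).
    apply: normed_cvg; apply: nondecreasing_is_cvgn.
      apply/nondecreasing_seqP => N.
      by rewrite -subr_ge0 seriesSB normr_ge0.
    by exists (2 + G x) => _ [N _ <-]; exact: bound.
  move=> cs; have -> : a ^~ x = (fun N => a 0%N x + series (fun k => u k x) N).
    by apply/funext => N; rewrite tel.
  by apply: is_cvgD => //; exact: is_cvg_cst.
(* Setting the sequence to 0 off D makes it converge everywhere, so the limit is measurable. *)
pose b k x := a k x * \1_D x.
pose f x := lim (b ^~ x @ \oo).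
have bE x k : D x -> b k x = a k x by move=> Dx; rewrite /b indicE mem_set// mulr1.
have bE' x k : ~ D x -> b k x = 0 by move=> Dx; rewrite /b indicE memNset// mulr0.
have cb x : cvgn (b ^~ x).
  have [Dx|Dx] := pselect (D x).
    have -> : b ^~ x = a ^~ x by apply/funext => k; rewrite bE.
    exact: cv.
  have -> : b ^~ x = (fun=> 0) by apply/funext => k; rewrite bE'.
  exact: is_cvg_cst.
exists D, f, G; split => //.
- split => //.
  + apply: (@measurable_fun_cvg _ _ _ setT b) => // k.
    by apply: measurable_funM => //; exact: measurable_indic.
  + apply: le_lt_trans Sfin; apply: ge0_le_integral => //.
    * by move=> x _; rewrite lee_fin.
    * exact/measurable_EFinP.
    * move=> x _; rewrite /G; have := S0 x; by case: (S x) => //= *; rewrite ?leey.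
- move=> x Dx; have -> : a ^~ x = b ^~ x by apply/funext => k; rewrite bE.
  exact: cb.
- move=> x Dx; rewrite /f.
  have -> : b ^~ x = (fun=> 0) by apply/funext => k; rewrite bE'.
  by rewrite lim_cst.
- move=> x k Dx; rewrite tel -addrA.
  apply: le_trans (ler_normD _ _) _; apply: lerD; first exact: aM.
  apply: le_trans (ler_norm_sum _ _ _) _; exact: bound.
Qed.

End FastLimit.

(** * The Fourier transform on L^2 as a limit of truncations *)

Section Plancherel.
Variables (R : realType) (n : nat).
Local Notation T := 'rV[R]_n.
Local Notation mu := (lebesgue_rV R n).
Implicit Types f g h u : T -> R[i].

Lemma Rintegral_dominated_cvg (g_ : nat -> T -> R) (g H : T -> R) :
  (forall k, measurable_fun setT (g_ k)) -> measurable_fun setT g ->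
  mu.-integrable setT (EFin \o H) ->
  {ae mu, forall x, g_ ^~ x @ \oo --> g x} ->
  {ae mu, forall x k, `|g_ k x| <= H x} ->
  \int[mu]_x g_ k x @[k --> \oo] --> \int[mu]_x g x.
Proof.
move=> mg_ mg iH cv bd.
have m1 k : measurable_fun setT (EFin \o g_ k) by exact/measurable_EFinP.
have m2 : measurable_fun setT (EFin \o g) by exact/measurable_EFinP.
have H1 : {ae mu, forall x, [set: T] x ->
    (fun k => (EFin \o g_ k) x) @ \oo --> (EFin \o g) x}.
  apply: filterS cv => x gx _; apply: cvg_EFin; last exact: gx.
  exact: nearW.
have H2 : {ae mu, forall x k, [set: T] x -> (`|(EFin \o g_ k) x| <= (EFin \o H) x)%E}.
  by apply: filterS bd => x bx k _ /=; rewrite lee_fin.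
have [ig _ lim] := dominated_convergence measurableT m1 m2 H1 iH H2.
have : (\int[mu]_x (g_ k x)%:E)%E @[k --> \oo] --> (fine (\int[mu]_x (g x)%:E)%E)%:E.
  rewrite fineK; first exact: lim.
  exact: integrable_fin_num.
exact: fine_cvg.
Qed.

Lemma cintegral_dominated_cvg (g_ : nat -> T -> R[i]) g (H : T -> R) (D : set T) :
  (forall k, cmeasurable (g_ k)) -> cmeasurable g ->
  mu.-integrable setT (EFin \o H) -> {ae mu, forall x, D x} ->
  (forall x, D x -> (complex.Re (g_ k x) @[k --> \oo] --> complex.Re (g x)) /\
                    (complex.Im (g_ k x) @[k --> \oo] --> complex.Im (g x))) ->
  (forall x k, D x -> norm1 (g_ k x) <= H x) ->
  (complex.Re (cintegral (g_ k)) @[k --> \oo] --> complex.Re (cintegral g)) /\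
  (complex.Im (cintegral (g_ k)) @[k --> \oo] --> complex.Im (cintegral g)).
Proof.
move=> mg_ mg iH aeD cv bd; split; rewrite /cintegral /=.
- apply: (@Rintegral_dominated_cvg (fun k x => complex.Re (g_ k x)) (fun x => complex.Re (g x)) H) => //.
  + by move=> k; have [] := mg_ k.
  + by have [] := mg.
  + by apply: filterS aeD => x Dx; have [] := cv x Dx.
  + by apply: filterS aeD => x Dx k; apply: le_trans (bd x k Dx); exact: ler_norm1_Re.
- apply: (@Rintegral_dominated_cvg (fun k x => complex.Im (g_ k x)) (fun x => complex.Im (g x)) H) => //.
  + by move=> k; have [] := mg_ k.
  + by have [] := mg.
  + by apply: filterS aeD => x Dx; have [] := cv x Dx.
  + by apply: filterS aeD => x Dx k; apply: le_trans (bd x k Dx); exact: ler_norm1_Im.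
Qed.

Lemma fourierB (s : R) f g x : cintegrable f -> cintegrable g ->
  fourier_kernel s (fun y => f y - g y) x = fourier_kernel s f x - fourier_kernel s g x.
Proof.
move=> fi gi; rewrite /fourier_kernel -cintegralB; try exact: cintegrable_kernel.
by congr cintegral; apply/funext => y; rewrite mulrBr.
Qed.

(** Cutting to a cube of finite volume makes a square integrable function integrable, so that its
    transform is given by an integral. *)
Definition truncate h (N : nat) : T -> R[i] :=
  fun x => (\1_(cube (n := n) N%:R) x)%:C * h x.

Lemma truncate_in h N x : cube N%:R x -> truncate h N x = h x.
Proof. by move=> hx; rewrite /truncate indicE mem_set// mul1r. Qed.

Lemma truncate_out h N x : ~ cube N%:R x -> truncate h N x = 0.
Proof. by move=> hx; rewrite /truncate indicE memNset// mul0r. Qed.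

Lemma cmeasurable_truncate h N : cmeasurable h -> cmeasurable (truncate h N).
Proof.
move=> mh; apply: cmeasurableM => //; apply: cmeasurable_real.
by apply: measurable_indic; exact: measurable_cube.
Qed.

Lemma sqnorm_truncate h N x : sqnorm (truncate h N x) <= sqnorm (h x).
Proof.
have [hx|hx] := pselect (cube (n := n) N%:R x); first by rewrite truncate_in.
by rewrite truncate_out// {1}/sqnorm /= expr0n addr0 sqnorm_ge0.
Qed.

Lemma norm1_truncate h N x : norm1 (truncate h N x) <= norm1 (h x).
Proof.
have [hx|hx] := pselect (cube (n := n) N%:R x); first by rewrite truncate_in.
by rewrite truncate_out// norm1_0 norm1_ge0.
Qed.

Lemma cintegrable_truncate h N : cmeasurable h ->
  (\int[mu]_x (sqnorm (h x))%:E < +oo)%E -> cintegrable (truncate h N).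
Proof.
move=> mh ih.
have mc : measurable_fun setT (\1_(cube (n := n) N%:R) : T -> R).
  by apply: measurable_indic; exact: measurable_cube.
have mq := measurable_sqnorm mh.
apply: (@cintegrable_le _ _ _ (fun x => \1_(cube (n := n) N%:R) x + 2 * sqnorm (h x))).
- exact: cmeasurable_truncate.
- by apply: measurable_funD => //; exact: measurable_funM.
- move=> x; have [hx|hx] := pselect (cube (n := n) N%:R x); last first.
    by rewrite truncate_out// norm1_0 addr_ge0 ?mulr_ge0 ?sqnorm_ge0.
  rewrite truncate_in// indicE mem_set//=.
  have := norm1_sqr_le (h x); have := sqr_ge0 (norm1 (h x) - 1); have := norm1_ge0 (h x).
  rewrite sqrrB; lra.
- under eq_integral do rewrite EFinD.
  rewrite ge0_integralD//; last 3 first.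
  + exact/measurable_EFinP.
  + by move=> x _; rewrite lee_fin mulr_ge0 ?sqnorm_ge0.
  + by apply/measurable_EFinP; exact: measurable_funM.
  apply: lte_add_pinfty.
    rewrite integral_indic ?setIT//; last exact: measurable_cube.
    by rewrite [X in (X < _)%E](lebesgue_cube _ (ler0n R N)) ltry.
  under eq_integral do rewrite EFinM.
  rewrite ge0_integralZl//; first exact: lte_mul_pinfty.
  + exact/measurable_EFinP.
  + by move=> x _; rewrite lee_fin sqnorm_ge0.
Qed.

Lemma near_truncate h x : \forall N \near \oo, truncate h N x = h x.
Proof.
near=> N; apply: truncate_in; apply: cube_enorm.
by near: N; exact: nbhs_infty_ger.
Unshelve. all: by end_near. Qed.

Lemma truncate_tail h : cmeasurable h -> (\int[mu]_x (sqnorm (h x))%:E < +oo)%E ->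
  \int[mu]_x sqnorm (h x - truncate h N x) @[N --> \oo] --> (0 : R).
Proof.
move=> mh ih.
have -> : (0 : R) = \int[mu]_x (cst 0 x) by rewrite /Rintegral integral0.
have mq := measurable_sqnorm mh.
apply: (@Rintegral_dominated_cvg (fun N x => sqnorm (h x - truncate h N x)) (cst 0)
  (fun x => sqnorm (h x))) => //.
- move=> N; apply: measurable_sqnorm; apply: cmeasurableB => //.
  exact: cmeasurable_truncate.
- apply/integrableP; split; first exact/measurable_EFinP.
  by under eq_integral do rewrite /= ger0_norm ?sqnorm_ge0//.
- apply: aeW => x; apply: cvg_near_cst.
  by apply: filterS (near_truncate h x) => N ->; rewrite subrr /sqnorm /= expr0n addr0.
- apply: aeW => x N; rewrite ger0_norm ?sqnorm_ge0//.
  have [hx|hx] := pselect (cube (n := n) N%:R x).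
    by rewrite truncate_in// subrr {1}/sqnorm /= expr0n addr0 sqnorm_ge0.
  by rewrite truncate_out// subr0.
Qed.

Lemma sqnormB_le (z w : R[i]) : sqnorm (z - w) <= 2 * sqnorm z + 2 * sqnorm w.
Proof.
rewrite /sqnorm !ReImE.
have := sqr_ge0 (complex.Re z + complex.Re w); have := sqr_ge0 (complex.Im z + complex.Im w).
rewrite !sqrrD !sqrrN; lra.
Qed.

(** f is the L^2 transform of h, characterised by the multiplication formula against bounded
    integrable functions. This is the form in which tempered distributions see it. *)
Lemma plancherel_extension (s : R) : 1 <= s ^+ 2 -> exists2 C : R, 0 < C &
  forall h, cmeasurable h -> (\int[mu]_x (sqnorm (h x))%:E < +oo)%E ->
  exists f, [/\ cmeasurable f,
    (\int[mu]_x (sqnorm (f x))%:E <= C%:E * \int[mu]_x (sqnorm (h x))%:E)%E &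
    forall (phi : T -> R[i]) (B : R), cintegrable phi ->
      (forall x, norm1 (phi x) <= B) ->
      cintegral (fun x => f x * phi x) =
      cintegral (fun x => h x * fourier_kernel s phi x)].
Proof.
move=> s1; have [C C0 bessel] := @bessel_inequality R n s s1.
exists C => // h mh ih.
have mq := measurable_sqnorm mh.
have itr N := cintegrable_truncate N mh ih.
have tail (N : nat) : mu.-integrable setT (EFin \o (fun x => sqnorm (h x - truncate h N x))).
  have mtr : cmeasurable (fun x => h x - truncate h N x).
    by apply: cmeasurableB => //; exact: cmeasurable_truncate.
  apply/integrableP; split; first by apply/measurable_EFinP; exact: measurable_sqnorm.
  apply: le_lt_trans ih; apply: ge0_le_integral => //.
  - apply: measurableT_comp => //; apply/measurable_EFinP; exact: measurable_sqnorm.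
  - exact/measurable_EFinP.
  - move=> x _; rewrite /= lee_fin ger0_norm ?sqnorm_ge0//.
    have [hx|hx] := pselect (cube (n := n) N%:R x).
      by rewrite truncate_in// subrr {1}/sqnorm /= expr0n addr0 sqnorm_ge0.
    by rewrite truncate_out// subr0.
have tailE N : (\int[mu]_x (sqnorm (h x - truncate h N x))%:E =
    (\int[mu]_x sqnorm (h x - truncate h N x))%:E)%E.
  by rewrite /Rintegral fineK//; exact: integrable_fin_num (tail N).
(* Tails at most 4^-k give the fast Cauchy condition; k <= N k ensures that the chosen truncations
   still exhaust the space. *)
have /choice[N hN] : forall k : nat, exists N : nat, (k <= N)%N /\
    \int[mu]_x sqnorm (h x - truncate h N x) <= 4^-1 ^+ k.
  move=> k; have e0 : 0 < (4^-1 : R) ^+ k by rewrite exprn_gt0.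
  have /cvgrPdist_lt/(_ _ e0) := truncate_tail mh ih.
  move=> [N0 _ hN0]; exists (maxn k N0); split; first exact: leq_maxl.
  have := hN0 (maxn k N0) (leq_maxr _ _); rewrite /= sub0r normrN => /ltW.
  exact: le_trans (ler_norm _).
pose fk k := fourier_kernel s (truncate h (N k)).
have mfk k : cmeasurable (fk k) by exact: cmeasurable_fourier.
(* Bessel applied to the difference of two truncations, whose squared norm is at most twice the sum
   of both tails: 2 (4^-k + 4^-(k+1)) <= 4 * 4^-k. *)
have diff k : (\int[mu]_x (sqnorm (fk k.+1 x - fk k x))%:E <= (4 * C * 4^-1 ^+ k)%:E)%E.
  have -> : (fun x => (sqnorm (fk k.+1 x - fk k x))%:E) = (fun x => (sqnorm
      (fourier_kernel s (fun y => truncate h (N k.+1) y - truncate h (N k) y) x))%:E).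
    by apply/funext => x; rewrite fourierB.
  apply: le_trans (bessel _ (cintegrableB (itr _) (itr _))) _.
  rewrite (mulrC 4) -mulrA EFinM; apply: lee_wpmul2l; first by rewrite lee_fin ltW.
  apply: (@le_trans _ _ (\int[mu]_x (2 * sqnorm (h x - truncate h (N k) x) +
      2 * sqnorm (h x - truncate h (N k.+1) x))%:E)%E).
    apply: ge0_le_integral => //.
    - by move=> x _; rewrite lee_fin sqnorm_ge0.
    - apply/measurable_EFinP; apply: measurable_sqnorm.
      by apply: cmeasurableB; exact: cmeasurable_truncate.
    - apply/measurable_EFinP; apply: measurable_funD; apply: measurable_funM => //;
      apply: measurable_sqnorm; apply: cmeasurableB => //; exact: cmeasurable_truncate.
    - move=> x _; rewrite lee_fin; apply: le_trans (sqnormB_le _ _).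
      rewrite (_ : _ - _ = h x - truncate h (N k) x - (h x - truncate h (N k.+1) x))//.
      by ring.
  under eq_integral do rewrite EFinD !EFinM.
  have mt M : measurable_fun setT (fun x => sqnorm (h x - truncate h M x)).
    by apply: measurable_sqnorm; apply: cmeasurableB => //; exact: cmeasurable_truncate.
  have tg M (x : T) : (0 <= (sqnorm (h x - truncate h M x))%:E)%E.
    by rewrite lee_fin sqnorm_ge0.
  have mtE M : measurable_fun setT (fun x => (sqnorm (h x - truncate h M x))%:E).
    exact/measurable_EFinP.
  rewrite ge0_integralD//; last 4 first.
  - by move=> x _; rewrite mule_ge0.
  - by apply: emeasurable_funM.
  - by move=> x _; rewrite mule_ge0.
  - by apply: emeasurable_funM.
  rewrite !ge0_integralZl// !tailE -!EFinM -EFinD lee_fin.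
  have := (hN k).2; have := (hN k.+1).2; rewrite exprS.
  have : 0 <= (4^-1 : R) ^+ k by rewrite exprn_ge0.
  move: (_ ^+ k) (Rintegral _ _ _) (Rintegral _ _ _) => e a b h1 h2 h3.
  clear -h1 h2 h3; lra.
pose M := 2 * \int[mu]_y norm1 (truncate h (N 0) y).
have f0M x : norm1 (fk 0%N x) <= M by exact: norm1_fourier.
have C40 : 0 <= 4 * C by rewrite mulr_ge0// ltW.
have diffR (P : R[i] -> R) : (forall z, P z ^+ 2 <= sqnorm z) ->
    (forall k, measurable_fun setT (fun x => P (fk k x))) ->
    (forall z w, P (z - w) = P z - P w) ->
    forall k, (\int[mu]_x ((P (fk k.+1 x) - P (fk k x)) ^+ 2)%:E <= (4 * C * 4^-1 ^+ k)%:E)%E.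
  move=> Ps mP PB k; apply: le_trans (diff k); apply: ge0_le_integral => //.
  - by move=> x _; rewrite lee_fin sqr_ge0.
  - by apply/measurable_EFinP; apply: measurable_funX; exact: measurable_funB.
  - by apply/measurable_EFinP; apply: measurable_sqnorm; exact: cmeasurableB.
  - by move=> x _; rewrite lee_fin -PB.
have [D1 [f1 [G1 [[mD1 aeD1 mf1 mG1 iG1] G10 cv1 f10 bd1]]]] :=
  @fast_l2_limit _ T R mu (fun k x => complex.Re (fk k x)) (4 * C) M C40
   (fun k => (mfk k).1) (fun x => le_trans (ler_norm1_Re _) (f0M x))
   (diffR (@complex.Re R) (fun z => ler_wpDr (sqr_ge0 _) (lexx _)) (fun k => (mfk k).1)
     (fun z w => etrans (ReD _ _) (congr1 _ (ReN w)))).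
have [D2 [f2 [G2 [[mD2 aeD2 mf2 mG2 iG2] G20 cv2 f20 bd2]]]] :=
  @fast_l2_limit _ T R mu (fun k x => complex.Im (fk k x)) (4 * C) M C40
   (fun k => (mfk k).2) (fun x => le_trans (ler_norm1_Im _) (f0M x))
   (diffR (@complex.Im R) (fun z => ler_wpDl (sqr_ge0 _) (lexx _)) (fun k => (mfk k).2)
     (fun z w => etrans (ImD _ _) (congr1 _ (ImN w)))).
pose f x := f1 x +i* f2 x.
have mf : cmeasurable f by [].
have aeD : {ae mu, forall x, (D1 `&` D2) x}.
  by apply: filterS2 aeD1 aeD2 => x.
exists f; split => //.
(* Masked with the indicators, the squared moduli converge at every point to that of f, and each is
   bounded by [sqnorm] of [fk k]; Fatou and Bessel give the norm bound. *)
- pose r k x := (complex.Re (fk k x) * \1_D1 x) ^+ 2 + (complex.Im (fk k x) * \1_D2 x) ^+ 2.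
  have mr k : measurable_fun setT (fun x => (r k x)%:E).
    apply/measurable_EFinP; apply: measurable_funD; apply: measurable_funX;
    apply: measurable_funM; [exact: (mfk k).1|exact: measurable_indic|exact: (mfk k).2|exact: measurable_indic].
  have r0 k x : (0 <= (r k x)%:E)%E by rewrite lee_fin addr_ge0 ?sqr_ge0.
  have cvr x : (r k x)%:E @[k --> \oo] --> (sqnorm (f x))%:E.
    apply: cvg_EFin; first exact: nearW.
    apply: cvgD.
    + have : complex.Re (fk k x) * \1_D1 x @[k --> \oo] --> f1 x.
        have [Dx|Dx] := pselect (D1 x).
          by rewrite indicE mem_set//=; under eq_fun do rewrite mulr1; exact: cv1.
        by rewrite indicE memNset//= f10//; under eq_fun do rewrite mulr0; exact: cvg_cst.
      by move=> c; under eq_fun do rewrite expr2; rewrite /f /= expr2; exact: cvgM.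
    + have : complex.Im (fk k x) * \1_D2 x @[k --> \oo] --> f2 x.
        have [Dx|Dx] := pselect (D2 x).
          by rewrite indicE mem_set//=; under eq_fun do rewrite mulr1; exact: cv2.
        by rewrite indicE memNset//= f20//; under eq_fun do rewrite mulr0; exact: cvg_cst.
      by move=> c; under eq_fun do rewrite expr2; rewrite /f /= expr2; exact: cvgM.
  have -> : (\int[mu]_x (sqnorm (f x))%:E = \int[mu]_x limn_einf (fun k => (r k x)%:E))%E.
    by apply: eq_integral => x _; rewrite (cvg_limn_einf_sup (cvr x)).1.
  apply: le_trans (fatou mu measurableT mr (fun k x _ => r0 k x)) _.
  rewrite limn_einf_lim; apply: lime_le; first exact: is_cvg_einfs.
  apply: nearW => k; apply: ereal_inf_le; exists (\int[mu]_x (r k x)%:E)%E.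
    by exists k => //=.
  apply: (@le_trans _ _ (\int[mu]_x (sqnorm (fk k x))%:E)%E).
    apply: ge0_le_integral => //.
    + by apply/measurable_EFinP; exact: measurable_sqnorm.
    + move=> x _; rewrite lee_fin /r /sqnorm lerD// exprMn ler_piMr ?sqr_ge0//;
      by rewrite indicE; case: (_ \in _); rewrite /= ?expr1n ?expr0n.
  apply: le_trans (bessel _ (itr _)) _; apply: lee_wpmul2l; first by rewrite lee_fin ltW.
  apply: ge0_le_integral => //.
  + by move=> x _; rewrite lee_fin sqnorm_ge0.
  + by apply/measurable_EFinP; apply: measurable_sqnorm; exact: cmeasurable_truncate.
  + exact/measurable_EFinP.
  + by move=> x _; rewrite lee_fin sqnorm_truncate.
- move=> phi B iphi phiB.
  have B0 : 0 <= B by exact: le_trans (norm1_ge0 _) (phiB 0).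
  have M0 : 0 <= M by exact: le_trans (norm1_ge0 _) (f0M 0).
  have EQ k : cintegral (fun x => fk k x * phi x) =
      cintegral (fun x => truncate h (N k) x * fourier_kernel s phi x).
    by rewrite fourier_multiplication.
  have mFphi := cmeasurable_fourier s iphi.
  (* The majorant of [fk k] times phi: the constant part of the bound is paired with the
     integrability of phi, the integrable part [G1] + [G2] with its boundedness. *)
  have iG : mu.-integrable setT (EFin \o (fun x =>
      (2 * M + 4) * norm1 (phi x) + B * (G1 x + G2 x))).
    have iGG (G : T -> R) : measurable_fun setT G -> (forall x, 0 <= G x) ->
        (\int[mu]_x (G x)%:E < +oo)%E -> mu.-integrable setT (EFin \o G).
      move=> mG G0 iG; apply/integrableP; split; first exact/measurable_EFinP.
      by under eq_integral do rewrite /= ger0_norm//.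
    have i1 := iGG _ mG1 G10 iG1; have i2 := iGG _ mG2 G20 iG2.
    have := integrableD measurableT
      (integrableZl measurableT (2 * M + 4) (cintegrable_norm1 iphi))
      (integrableZl measurableT B (integrableD measurableT i1 i2)).
    by apply: eq_integrable => //.
  have [l1 l2] := @cintegral_dominated_cvg (fun k x => fk k x * phi x)
    (fun x => f x * phi x) _ (D1 `&` D2) (fun k => cmeasurableM (mfk k) iphi.1)
    (cmeasurableM mf iphi.1) iG aeD
    ltac:(move=> x [Dx1 Dx2]; rewrite !ReImE /f /=; split;
      [under eq_fun do rewrite ReM; apply: cvgB; (apply: cvgM; last exact: cvg_cst); [exact: cv1|exact: cv2]
      |under eq_fun do rewrite ImM; apply: cvgD; (apply: cvgM; last exact: cvg_cst); [exact: cv1|exact: cv2]])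
    ltac:(move=> x k [Dx1 Dx2]; apply: le_trans (ler_norm1M _ _) _;
      have b1 := bd1 x k Dx1; have b2 := bd2 x k Dx2; have p0 := norm1_ge0 (phi x);
      have pB := phiB x; have g1 := G10 x; have g2 := G20 x; rewrite {1}/norm1;
      apply: (@le_trans _ _ ((2 * M + 4 + (G1 x + G2 x)) * norm1 (phi x)));
      [by rewrite ler_wpM2r//; lra
      |rewrite mulrDl lerD2l mulrC ler_wpM2r// addr_ge0//]).
  (* A bounded integrable function is square integrable, so Bessel makes its transform square
     integrable too; |h|^2 + |phi^|^2 then dominates the right-hand integrands. *)
  have iphi2 : (\int[mu]_x (sqnorm (phi x))%:E < +oo)%E.
    apply: (@le_lt_trans _ _ (\int[mu]_x (B * norm1 (phi x))%:E)%E).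
      have mn := measurable_norm1 iphi.1.
      apply: ge0_le_integral => //.
      + by move=> x _; rewrite lee_fin sqnorm_ge0.
      + by apply/measurable_EFinP; apply: measurable_sqnorm iphi.1.
      + by apply/measurable_EFinP; exact: measurable_funM.
      + move=> x _; rewrite lee_fin; apply: le_trans (sqnorm_le _) _; rewrite expr2; apply: ler_wpM2r => //; exact: norm1_ge0.
    under eq_integral do rewrite EFinM.
    rewrite ge0_integralZl//.
    + by apply: lte_mul_pinfty => //; exact: iphi.2.
    + by apply/measurable_EFinP; exact: measurable_norm1 iphi.1.
    + by move=> x _; rewrite lee_fin norm1_ge0.
  have iF2 : (\int[mu]_x (sqnorm (fourier_kernel s phi x))%:E < +oo)%E.
    apply: le_lt_trans (bessel _ iphi) _; apply: lte_mul_pinfty => //.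
    by rewrite lee_fin ltW.
  have iH : mu.-integrable setT (EFin \o (fun x => sqnorm (h x) + sqnorm (fourier_kernel s phi x))).
    have iS (g : T -> R[i]) : cmeasurable g -> (\int[mu]_x (sqnorm (g x))%:E < +oo)%E ->
        mu.-integrable setT (EFin \o (fun x => sqnorm (g x))).
      move=> mg ig; apply/integrableP; split.
        by apply/measurable_EFinP; exact: measurable_sqnorm.
      by under eq_integral do rewrite /= ger0_norm ?sqnorm_ge0//.
    have := integrableD measurableT (iS _ mh ih) (iS _ mFphi iF2).
    by apply: eq_integrable.
  have trunc_cvg x : \forall k \near \oo, truncate h (N k) x = h x.
    have [K _ hK] := near_truncate h x; exists K => // k /= Kk.
    by apply: hK => /=; exact: leq_trans (hN k).1.
  have aeT : {ae mu, forall x, [set: T] x} by exact: aeW.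
  have [r1 r2] := @cintegral_dominated_cvg
    (fun k x => truncate h (N k) x * fourier_kernel s phi x)
    (fun x => h x * fourier_kernel s phi x) _ setT
    (fun k => cmeasurableM (cmeasurable_truncate (N k) mh) mFphi)
    (cmeasurableM mh mFphi) iH aeT
    ltac:(move=> x _; split; apply: cvg_near_cst; apply: filterS (trunc_cvg x) => k -> //)
    ltac:(move=> x k _; apply: le_trans (ler_norm1M _ _) _;
      have t1 := norm1_truncate h (N k) x; have t2 := norm1_sqr_le (h x);
      have t3 := norm1_sqr_le (fourier_kernel s phi x);
      have t4 := sqr_ge0 (norm1 (h x) - norm1 (fourier_kernel s phi x));
      have t5 := norm1_ge0 (fourier_kernel s phi x);
      have t6 := ler_wpM2r t5 t1; rewrite sqrrB in t4; lra).
  apply: complex_ext.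
  + rewrite -(cvg_lim _ l1)// -(cvg_lim _ r1)//; congr (lim (_ @ \oo)).
    by apply/funext => k; rewrite EQ.
  + rewrite -(cvg_lim _ l2)// -(cvg_lim _ r2)//; congr (lim (_ @ \oo)).
    by apply/funext => k; rewrite EQ.
Qed.

End Plancherel.

(** * The compensated symbol *)

Section OrthogonalProjection.
Variables (R : realType) (l : nat).
Implicit Types (P : 'M[R[i]]_l) (L : {vspace 'rV[R[i]]_l}).

Definition hermitian_idempotent P :=
  P *m P = P /\ forall a b, P a b = conjc (P b a).

Lemma mem_orthoproj L v : v \in L <-> v *m orthoproj L = v.
Proof.
set A := \matrix_(i < \dim L) (vbasis L)`_i.
have AL i : row i A \in L.
  by rewrite rowK vbasis_mem// mem_nth// size_tuple.
split=> [vL|<-].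
- apply: proj_ortho_id; apply/submxP.
  exists (\row_i coord (vbasis L) i v).
  rewrite {1}(coord_vbasis vL) mulmx_sum_row; apply: eq_bigr => i _.
  by rewrite mxE rowK.
- have /submxP[w ->] : (v *m orthoproj L <= A)%MS by exact: proj_ortho_sub.
  by rewrite mulmx_sum_row rpred_sum// => i _; rewrite rpredZ.
Qed.

(** The rows of P are orthogonal to those of 1 - P, that is P (1 - P)* = 0. Hence P = P P*, which is
    visibly Hermitian. *)
Lemma orthoproj_hermitian L : hermitian_idempotent (orthoproj L).
Proof.
split; first exact: proj_ortho_proj.
set P := orthoproj L.
have PP : P = P *m map_mx Num.conj P^T.
  have := proj_ortho_compl_sub (\matrix_(i < \dim L) (vbasis L)`_i) 1%:M.
  rewrite mul1mx -/(orthoproj L) -/P.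
  rewrite orthomx_sym => sub.
  have : (P <= orthomx Num.Def.conjC (mx_of_hermitian (hermitian1mx l)) (1%:M - P))%MS.
    by apply: submx_trans sub; rewrite -[P]mul1mx proj_ortho_sub.
  move=> /orthomx1P; rewrite linearB /= map_mxB trmx1 map_mx1 mulmxBr mulmx1 => /eqP.
  by rewrite subr_eq0 => /eqP.
move=> a b; rewrite PP !mxE rmorph_sum; apply: eq_bigr => j _.
rewrite !mxE rmorphM /= mulrC; congr (_ * _).
by rewrite -[LHS]conjcK.
Qed.

Lemma hermitian_idempotent0 : hermitian_idempotent 0.
Proof. by split=> [|a b]; rewrite ?mulmx0// !mxE conjc0. Qed.

Lemma sum_real (I : Type) (r : seq I) (F : I -> R) :
  \sum_(i <- r) (F i)%:C = (\sum_(i <- r) F i)%:C.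
Proof. by rewrite rmorph_sum. Qed.

(** From P = P P* the diagonal entry P_aa equals the sum S of the |P_ac|^2. Then S^2 <= S forces S
    <= 1, so every entry has modulus at most 1. *)
Lemma hermitian_idempotent_bound P a b : hermitian_idempotent P -> norm1 (P a b) <= 2.
Proof.
move=> [PP hP].
have e : P a a = (\sum_c sqnorm (P a c))%:C.
  rewrite -{1}PP mxE -sum_real; apply: eq_bigr => c _.
  by rewrite -mul_conj_sqnorm [P c a]hP.
have ge c : sqnorm (P a c) <= \sum_c sqnorm (P a c).
  by rewrite (bigD1 c)//= lerDl sumr_ge0// => j _; exact: sqnorm_ge0.
have := ge a; rewrite {1}e {1}/sqnorm /= expr0n addr0.
set S := \sum_c _ => SS.
have S1 : S <= 1.
  have S0 : 0 <= S by apply: sumr_ge0 => j _; exact: sqnorm_ge0.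
  move: SS; rewrite leNgt => /negP SS; rewrite leNgt; apply/negP => S1.
  by apply: SS; rewrite expr2 ltr_pMl// (lt_trans _ S1).
rewrite -(@ler_pXn2r _ 2)// ?nnegrE ?norm1_ge0//.
have := norm1_sqr_le (P a b); have := ge b; rewrite -/S; lra.
Qed.

Lemma hermitian_idempotent_quad P (u : 'rV[R[i]]_l) : hermitian_idempotent P ->
  \sum_a \sum_b u ord0 a * (1%:M - P) a b * conjc (u ord0 b) =
  (\sum_b sqnorm ((u *m (1%:M - P)) ord0 b))%:C.
Proof.
move=> [PP hP]; set Q := 1%:M - P.
have QQ : Q *m Q = Q.
  by rewrite /Q mulmxBr mulmx1 mulmxBl mul1mx PP subrr subr0.
have hQ a b : Q a b = conjc (Q b a).
  by rewrite !mxE rmorphB /= -hP conjc_nat eq_sym.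
rewrite -sum_real; under [RHS]eq_bigr do rewrite -mul_conj_sqnorm.
transitivity (\sum_b (u *m Q) ord0 b * conjc (u ord0 b)).
  rewrite exchange_big; apply: eq_bigr => b _.
  by rewrite mxE mulr_suml.
rewrite -[in LHS]QQ mulmxA; set v := u *m Q.
transitivity (\sum_c v ord0 c * \sum_b Q c b * conjc (u ord0 b)).
  under [RHS]eq_bigr do rewrite mulr_sumr.
  rewrite exchange_big; apply: eq_bigr => b _.
  by rewrite mxE mulr_suml; apply: eq_bigr => c _; rewrite mulrA.
apply: eq_bigr => c _; congr (_ * _).
rewrite /v mxE rmorph_sum; apply: eq_bigr => b _.
by rewrite rmorphM /= mulrC [Q c b]hQ.
Qed.

Lemma norm1_hs_norm m n (A : 'M[R[i]]_(m, n)) a b : norm1 (A a b) <= 2 * hs_norm A.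
Proof.
have h0 : 0 <= hs_norm A by exact: sqrtr_ge0.
rewrite -(@ler_pXn2r _ 2)// ?nnegrE ?norm1_ge0 ?mulr_ge0// exprMn.
rewrite /hs_norm sqr_sqrtr; last first.
  by apply: sumr_ge0 => i _; apply: sumr_ge0 => j _; exact: sqnorm_ge0.
apply: le_trans (norm1_sqr_le _) _.
have le1 : sqnorm (A a b) <= \sum_i \sum_j sqnorm (A i j).
  rewrite (bigD1 a)//= (bigD1 b)//= -addrA lerDl addr_ge0//.
    by apply: sumr_ge0 => j _; exact: sqnorm_ge0.
  by apply: sumr_ge0 => i _; apply: sumr_ge0 => j _; exact: sqnorm_ge0.
have := le_trans (sqnorm_ge0 (A a b)) le1.
rewrite -/(sqnorm _); move: le1; rewrite /sqnorm; lra.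
Qed.

End OrthogonalProjection.

(** * The radial bump *)

Section Cutoff.
Variables (R : realType) (n : nat).
Local Notation T := 'rV[R]_n.
Implicit Types x y : T.

(** Piecewise linear in |x|: Lipschitz regularity is enough for Hoelder estimates with exponent at
    most 1, and the value is at least 1/2 on 1 <= |x| <= 2. *)
Definition cutoff x : R := Num.max 0 (Num.min (enorm x - 2^-1) (4 - enorm x)).

Lemma cutoff_ge0 x : 0 <= cutoff x. Proof. by rewrite le_max lexx. Qed.

Lemma cutoff_le4 x : cutoff x <= 4.
Proof.
by have := enorm_ge0 x; rewrite ge_max ge_min ler0n/= => ?; apply/orP; right; lra.
Qed.

Lemma cutoff_small x : enorm x < 2^-1 -> cutoff x = 0.
Proof. by move=> h; rewrite /cutoff max_l// ge_min; apply/orP; left; lra. Qed.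

Lemma cutoff_large x : 4 < enorm x -> cutoff x = 0.
Proof. by move=> h; rewrite /cutoff max_l// ge_min; apply/orP; right; lra. Qed.

Lemma cutoff_ge_half x : 1 <= enorm x -> enorm x <= 2 -> 2^-1 <= cutoff x.
Proof. by move=> h1 h2; rewrite le_max le_min; apply/orP; right; apply/andP; split; lra. Qed.

Lemma cutoff_lipschitz x y : `|cutoff x - cutoff y| <= enorm (x - y).
Proof.
have := ler_enorm_dist x y; rewrite /cutoff.
move: (enorm x) (enorm y) (enorm (x - y)) => a b c.
rewrite !ler_norml /Order.max /Order.min => /andP[h1 h2].
case: (ltP (a - 2^-1) (4 - a)) => ?; case: (ltP (b - 2^-1) (4 - b)) => ?;
case: ltP => ?; case: ltP => ?; apply/andP; split; lra.
Qed.

Lemma norm1_cutoffM x (z : R[i]) : norm1 ((cutoff x)%:C * z) = cutoff x * norm1 z.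
Proof.
rewrite /norm1 !ReImE /= !mul0r subr0 addr0 !normrM ger0_norm ?cutoff_ge0//.
by rewrite mulrDr.
Qed.

End Cutoff.

(** * Regularity and mean of the symbol built from a family of projections *)

Section Symbol.
Variables (R : realType) (n l : nat).
Local Notation T := 'rV[R]_n.
Local Notation mu := (lebesgue_rV R n).

(** If phi(x0) = e > 0, the Hoelder bound keeps phi >= e/2 on a cube around x0, which has positive
    volume, and the integral would be positive. *)
Lemma holder_bump_zero_integral (alpha : R) (f : T -> R[i]) (phi : T -> R) :
  0 < alpha -> holder_bump alpha f -> (forall x, f x = (phi x)%:C) ->
  (forall x, 0 <= phi x) -> cintegral f = 0 -> forall x, phi x = 0.
Proof.
move=> a0 hf fE p0 f0 x0; apply/eqP; rewrite -[_ == _]negbK; apply/negP => px.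
have fi := cintegrable_holder_bump a0 hf.
have [[C hC] _ _] := hf.
have e0 : 0 < phi x0 by rewrite lt_neqAle eq_sym px p0.
set e := phi x0 in e0.
have K0 : 0 < `|C| + 1 by apply: ltr_wpDl.
pose del := (e / 2 / (`|C| + 1)) `^ (alpha^-1).
have del0 : 0 < del by rewrite powR_gt0// !divr_gt0.
pose r := del / n.+1%:R.
have r0 : 0 < r by rewrite divr_gt0.
pose g y := f (y + x0); have gi : cintegrable g by exact: cintegrable_shift.
have g0 : cintegral g = 0 by rewrite cintegral_shift.
have ge y : cube r y -> e / 2 <= phi (y + x0).
  move=> yr.
  have ny : enorm y <= del.
    apply: le_trans (enorm_le_sum _) _.
    apply: (@le_trans _ _ (\sum_(i < n) r)).
      by apply: ler_sum => i _; have := yr i; rewrite in_itv /= ler_norml.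
    rewrite sumr_const card_ord -mulr_natr /r -mulrA ler_piMr ?(ltW del0)//.
    by rewrite mulrC ler_pdivrMr// mul1r ler_nat.
  have := hC (y + x0) x0; rewrite !fE addrK -raddfB norm1_real.
  have : C * enorm y `^ alpha <= e / 2.
    apply: (@le_trans _ _ ((`|C| + 1) * del `^ alpha)).
      apply: (@le_trans _ _ ((`|C| + 1) * enorm y `^ alpha)).
        by rewrite ler_wpM2r ?powR_ge0//; have := ler_norm C; lra.
      by rewrite ler_wpM2l ?(ltW K0)// ge0_ler_powR ?nnegrE ?enorm_ge0 ?(ltW a0) ?(ltW del0).
    rewrite /del -powRrM mulVf ?gt_eqF// powRr1; last by rewrite ltW// !divr_gt0.
    by rewrite mulrC divfK// gt_eqF.
  have := p0 (y + x0); rewrite -/e ler_norml => ? ? h; have /andP[h1 h2] := h.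
  lra.
have gE : complex.Re (cintegral g) = \int[mu]_x phi (x + x0).
  by rewrite /cintegral /=; apply: eq_Rintegral => x _; rewrite /g fE.
have ig := cintegrable_Re gi.
have : (\int[mu]_x (phi (x + x0))%:E <= 0)%E.
  have : \int[mu]_x phi (x + x0) = 0 by rewrite -gE g0.
  rewrite /Rintegral => h.
  have : (\int[mu]_x (phi (x + x0))%:E)%E \is a fin_num.
    have := integrable_fin_num measurableT ig.
    by under eq_integral do rewrite /= /g fE.
  by move=> /fineK <-; rewrite h.
apply/negP; rewrite -ltNge.
have mc := measurable_cube (n := n) r.
have mphi : measurable_fun setT (fun x : T => (phi (x + x0))%:E).
  apply/measurable_EFinP; have [[m1 _] _] := gi.
  by apply: eq_measurable_fun m1 => x _; rewrite /g fE.
apply: (@lt_le_trans _ _ (\int[mu]_x ((e / 2) * \1_(cube r) x)%:E)%E).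
  under eq_integral do rewrite EFinM.
  rewrite ge0_integralZl//; last 2 first.
  - by apply/measurable_EFinP; exact: measurable_indic.
  - by rewrite lee_fin divr_ge0// ltW.
  rewrite integral_indic// setIT.
  rewrite [X in (_ < _ * X)%E](lebesgue_cube n (ltW r0)) -EFinM lte_fin.
  by rewrite mulr_gt0 ?divr_gt0// exprn_gt0// mulr_gt0.
apply: ge0_le_integral => //.
- by move=> x _; rewrite lee_fin mulr_ge0// divr_ge0// ltW.
- by apply/measurable_EFinP; apply: measurable_funM => //; exact: measurable_indic.
- move=> x _; rewrite lee_fin indicE.
  have [hx|hx] := pselect (cube r x); first by rewrite mem_set// mulr1 ge.
  by rewrite memNset// mulr0.
Qed.

Variables (P : T -> 'M[R[i]]_l) (alpha C : R).
Hypotheses (a0 : 0 < alpha) (a1 : alpha <= 1) (C0 : 0 <= C).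
Hypothesis hermP : forall x, hermitian_idempotent (P x).
Hypothesis holderP : forall x y a b, 2^-1 <= enorm x -> 2^-1 <= enorm y ->
  enorm (x - y) <= 4^-1 -> norm1 (P x a b - P y a b) <= C * enorm (x - y) `^ alpha.

Lemma powR_ge_small (t : R) : 0 <= t -> t <= 1 -> t <= t `^ alpha.
Proof.
move=> t0 t1; have [->|tn0] := eqVneq t 0; first by rewrite powR_ge0.
by rewrite -{1}(powRr1 t0) ger_powR// lt_neqAle eq_sym tn0 t0.
Qed.

(** For points more than 1/4 apart, alpha <= 1 gives |x - y|^alpha >= 1/4, so the trivial bound 2 B
    is at most 8 B |x - y|^alpha. *)
Lemma holder_of_near (f : T -> R[i]) (B D : R) : 0 <= B ->
  (forall x, norm1 (f x) <= B) ->
  (forall x y, enorm (x - y) <= 4^-1 -> norm1 (f x - f y) <= D * enorm (x - y) `^ alpha) ->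
  exists C, forall x y, norm1 (f x - f y) <= C * enorm (x - y) `^ alpha.
Proof.
move=> B0 fB fD; exists (`|D| + 8 * B) => x y; rewrite mulrDl.
have p0 := powR_ge0 (enorm (x - y)) alpha.
have [h|h] := leP (enorm (x - y)) 4^-1.
  apply: le_trans (fD _ _ h) _; apply: ler_wpDr; first by rewrite mulr_ge0 ?mulr_ge0.
  by rewrite ler_wpM2r// ler_norm.
have q : 4^-1 <= enorm (x - y) `^ alpha.
  apply: (@le_trans _ _ (4^-1 `^ alpha)).
    by apply: powR_ge_small; lra.
  by rewrite ge0_ler_powR ?nnegrE ?enorm_ge0 ?(ltW a0) ?(ltW h) ?invr_ge0.
apply: le_trans (ler_norm1D _ _) _; rewrite norm1N.
have := fB x; have := fB y; have : 0 <= `|D| * enorm (x - y) `^ alpha by rewrite mulr_ge0.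
have := ler_wpM2l B0 q; lra.
Qed.

Lemma holder_bump_cutoff : holder_bump alpha (fun x : T => (cutoff x)%:C).
Proof.
have b x : norm1 (cutoff x)%:C <= 4.
  by rewrite norm1_real ger0_norm ?cutoff_ge0 ?cutoff_le4.
split; last 2 first.
- by exists 4.
- by move=> x /cutoff_large ->.
apply: (@holder_of_near _ 4 1) => // x y h; rewrite -raddfB norm1_real mul1r.
apply: le_trans (cutoff_lipschitz _ _) _.
by apply: powR_ge_small; [exact: enorm_ge0|lra].
Qed.

Lemma holder_bump_cutoffP a b : holder_bump alpha (fun x => (cutoff x)%:C * P x a b).
Proof.
have P2 x : norm1 (P x a b) <= 2 by exact: hermitian_idempotent_bound.
have bd x : norm1 ((cutoff x)%:C * P x a b) <= 8.
  rewrite norm1_cutoffM (le_trans (ler_wpM2l (cutoff_ge0 x) (P2 x)))//.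
  have := cutoff_le4 x; lra.
split; last 2 first.
- by exists 8.
- by move=> x /cutoff_large ->; rewrite mul0r.
apply: (@holder_of_near _ 8 (4 * C + 2)) => // x y h.
(* P is Hoelder only away from the origin. After a possible exchange of x and y, the factor P x - P
   y either has both points outside the ball of radius 1/2 or is multiplied by [cutoff] x = 0. *)
wlog xy : x y h / 2^-1 <= enorm y \/ enorm x < 2^-1.
  move=> H; have [y2|y2] := leP 2^-1 (enorm y); first by apply: H => //; left.
  rewrite enormBC -norm1N opprB; apply: H; last by right.
  by rewrite enormBC.
have -> : (cutoff x)%:C * P x a b - (cutoff y)%:C * P y a b =
    (cutoff x)%:C * (P x a b - P y a b) + (cutoff x - cutoff y)%:C * P y a b.
  by rewrite raddfB /=; ring.
apply: le_trans (ler_norm1D _ _) _; rewrite mulrDl; apply: lerD; last first.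
  apply: le_trans (ler_norm1M _ _) _; rewrite norm1_real mulrC.
  apply: ler_pM => //; first exact: norm1_ge0.
  apply: le_trans (cutoff_lipschitz _ _) _.
  by apply: powR_ge_small; [exact: enorm_ge0|lra].
rewrite norm1_cutoffM -mulrA.
have q0 : 0 <= 4 * (C * enorm (x - y) `^ alpha) by rewrite !mulr_ge0// powR_ge0.
have [x2|x2] := leP 2^-1 (enorm x); last by rewrite cutoff_small// mul0r.
case: xy => [y2|]; last by move=> x3; exfalso; lra.
by apply: ler_pM => //; [exact: cutoff_ge0|exact: norm1_ge0|exact: cutoff_le4|exact: holderP].
Qed.

Let q a b x : R[i] := (cutoff x)%:C * (1%:M - P x) a b.

Lemma holder_bump_complement a b : holder_bump alpha (q a b).
Proof.
have := holder_bumpD (holder_bumpZ ((1%:M : 'M[R[i]]_l) a b) holder_bump_cutoff)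
  (holder_bumpZ (-1) (holder_bump_cutoffP a b)).
congr holder_bump; apply/funext => x; rewrite /q [in RHS]mxE [(- P x) a b]mxE; ring.
Qed.

Hypothesis canP : forall u : 'rV[R[i]]_l,
  (forall x, 1 <= enorm x -> enorm x <= 2 -> u *m P x = u) -> u = 0.

Let A : 'M[R[i]]_l := \matrix_(a, b) cintegral (q a b).

(* If [u A = 0], then [u A u^* = 0] is the integral of the nonnegative
   continuous function [w |u (1 - P)|^2], so [u] lies in every fibre. *)
Lemma complement_average_unit : A \in unitmx.
Proof.
rewrite -row_free_unit; apply/inj_row_free => u uA; apply: canP.
pose f x := \sum_a \sum_b (u ord0 a * conjc (u ord0 b)) * q a b x.
pose phi x := cutoff x * \sum_b sqnorm ((u *m (1%:M - P x)) ord0 b).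
have hf : holder_bump alpha f.
  by apply: holder_bump_sum => a; apply: holder_bump_sum => b;
    apply: holder_bumpZ; exact: holder_bump_complement.
have fE x : f x = (phi x)%:C.
  rewrite /phi rmorphM /= -hermitian_idempotent_quad// mulr_sumr; apply: eq_bigr => a _.
  by rewrite mulr_sumr; apply: eq_bigr => b _; rewrite /q; ring.
have s0 x : 0 <= \sum_b sqnorm ((u *m (1%:M - P x)) ord0 b).
  by apply: sumr_ge0 => b _; exact: sqnorm_ge0.
have p0 x : 0 <= phi x by rewrite mulr_ge0// cutoff_ge0.
have iq a b : cintegrable (q a b).
  exact: cintegrable_holder_bump a0 (holder_bump_complement a b).
have f0 : cintegral f = 0.
  rewrite cintegral_sum; last first.
    by move=> a; apply: cintegrable_sum => b; exact: cintegrableZ.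
  under eq_bigr => a _.
    rewrite cintegral_sum; last by move=> b; exact: cintegrableZ.
    under eq_bigr => b _ do rewrite cintegralZ//.
    over.
  rewrite exchange_big big1// => b _.
  transitivity ((u *m A) ord0 b * conjc (u ord0 b)); last by rewrite uA mxE mul0r.
  by rewrite mxE mulr_suml; apply: eq_bigr => a _; rewrite mxE; ring.
move=> x x1 x2; have := holder_bump_zero_integral a0 hf fE p0 f0 x.
move=> /eqP; rewrite mulf_eq0 => /orP[/eqP w0|].
  by exfalso; have := cutoff_ge_half x1 x2; rewrite w0; lra.
rewrite psumr_eq0 => [|b _]; last exact: sqnorm_ge0.
move=> /allP z0; suff : u *m (1%:M - P x) = 0.
  by rewrite mulmxBr mulmx1 => /eqP; rewrite subr_eq0 => /eqP.
apply/rowP => b; rewrite [RHS]mxE.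
have /eqP := z0 b (mem_index_enum b).
have := norm1_sqr_le ((u *m (1%:M - P x)) ord0 b) => h e; rewrite e mulr0 in h.
have n0 : norm1 ((u *m (1%:M - P x)) ord0 b) = 0.
  by apply/eqP; rewrite -sqrf_eq0; apply/eqP/le_anti; rewrite h sqr_ge0.
by apply: complex_ext; apply/eqP; rewrite -normr_le0 -n0 ?ler_norm1_Re ?ler_norm1_Im.
Qed.

(** In matrix form F = w 1 - w (1 - P) B, where A B = (int w) 1 makes the mean vanish. The value at
    the origin is recorded because no fibre is attached to that point. *)
Lemma compensated_symbol : exists F : 'I_l -> 'I_l -> T -> R[i],
  [/\ forall a b, holder_bump alpha (F a b), forall a b, cintegral (F a b) = 0,
   forall a b, F a b 0 = 0 &
   forall x (v : 'rV[R[i]]_l), v *m P x = v ->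
     \sum_a \sum_b v ord0 a * conjc (v ord0 b) * F a b x =
     (cutoff x * \sum_b sqnorm (v ord0 b))%:C].
Proof.
pose w (x : T) : R[i] := (cutoff x)%:C.
have iw : cintegrable w by exact: cintegrable_holder_bump a0 holder_bump_cutoff.
have iq a b : cintegrable (q a b).
  exact: cintegrable_holder_bump a0 (holder_bump_complement a b).
pose B := cintegral w *: invmx A.
pose I : 'M[R[i]]_l := 1%:M.
pose F a b x := I a b * w x + \sum_c (- B c b) * q a c x.
exists F; split.
- move=> a b; apply: holder_bumpD; first exact: holder_bumpZ holder_bump_cutoff.
  by apply: holder_bump_sum => c; apply: holder_bumpZ; exact: holder_bump_complement.
- move=> a b; rewrite cintegralD; [|exact: cintegrableZ|]; last first.
    by apply: cintegrable_sum => c; exact: cintegrableZ.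
  rewrite cintegral_sum; last by move=> c; exact: cintegrableZ.
  rewrite cintegralZ//; under eq_bigr => c _ do rewrite cintegralZ//.
  have AB : A *m B = cintegral w *: I.
    by rewrite -scalemxAr mulmxV// complement_average_unit.
  have := congr1 (fun M : 'M[R[i]]_l => M a b) AB; rewrite [LHS]mxE [RHS]mxE => e.
  rewrite mulrC -e -big_split big1// => c _.
  by rewrite [A a c]mxE /=; ring.
- have w0 : cutoff (0 : T) = 0 by rewrite cutoff_small// enorm0 invr_gt0.
  move=> a b; rewrite /F /w w0 mulr0 add0r big1// => c _.
  by rewrite /q w0 mul0r mulr0.
- move=> x v vP.
  (* This is v (1 - P) = 0: the correction vanishes on the fibre before B acts, so only the scalar
     part w |v|^2 survives. *)
  have v0 c : \sum_a v ord0 a * q a c x = 0.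
    transitivity (w x * (v *m (1%:M - P x)) ord0 c).
      by rewrite mxE mulr_sumr; apply: eq_bigr => a _; rewrite /q /w; ring.
    by rewrite mulmxBr mulmx1 vP subrr mxE mulr0.
  rewrite rmorphM /= rmorph_sum /= mulr_sumr exchange_big; apply: eq_bigr => b _.
  transitivity (conjc (v ord0 b) * \sum_a v ord0 a * (I a b * w x) +
      conjc (v ord0 b) * \sum_c (- B c b) * \sum_a v ord0 a * q a c x).
    have -> : \sum_c (- B c b) * (\sum_a v ord0 a * q a c x) =
        \sum_a v ord0 a * (\sum_c (- B c b) * q a c x).
      rewrite (eq_bigr (fun c => \sum_a (- B c b) * (v ord0 a * q a c x))); last first.
        by move=> c _; rewrite mulr_sumr.
      rewrite exchange_big; apply: eq_bigr => a _; rewrite mulr_sumr.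
      by apply: eq_bigr => c _; ring.
    rewrite -mulrDr -big_split mulr_sumr; apply: eq_bigr => a _.
    by rewrite /F /=; ring.
  rewrite [X in _ + _ * X]big1; last by move=> c _; rewrite v0 mulr0.
  rewrite mulr0 addr0 (bigD1 b)//= big1 ?addr0; last first.
    by move=> a ab; rewrite [I a b]mxE (negPf ab) mul0r mulr0.
  by rewrite [I b b]mxE eqxx mulr1n -mul_conj_sqnorm; rewrite /w; ring.
Qed.

End Symbol.

(** * From the map into the Grassmannian to a symbol on the whole space *)

Section BundleSymbol.
Variables (R : realType) (d l k : nat) (Omega : sphere R d -> grassmannian R l k).
Local Notation T := 'rV[R]_d.

(** The extension of the family of projections that is homogeneous of degree 0. The value 0 at the
    origin is a placeholder that is still a Hermitian idempotent. *)
Definition bundle_proj (x : T) : 'M[R[i]]_l :=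
  if pselect (x != 0) is left x0 then orthoproj (val (Omega (direction x0))) else 0.

Lemma bundle_projE (x : T) (x0 : x != 0) :
  bundle_proj x = orthoproj (val (Omega (direction x0))).
Proof.
rewrite /bundle_proj; case: pselect => [x0'|/(_ x0)//].
by rewrite (bool_irrelevance x0' x0).
Qed.

Lemma bundle_proj_hermitian (x : T) : hermitian_idempotent (bundle_proj x).
Proof.
rewrite /bundle_proj; case: pselect => x0; first exact: orthoproj_hermitian.
exact: hermitian_idempotent0.
Qed.

Lemma enorm_neq0 (x : T) : 0 < enorm x -> x != 0.
Proof. by apply: contraTneq => ->; rewrite enorm0 ltxx. Qed.

(** The difference x/|x| - y/|y| splits into (x - y)/|x| and a multiple of y of length ||y| - |x|| /
    |x|. Each is at most 2 |x - y|, because 1/|x| <= 2. *)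
Lemma direction_dist (x y : T) (x0 : x != 0) (y0 : y != 0) : 2^-1 <= enorm x ->
  sphere_dist (direction x0) (direction y0) <= 4 * enorm (x - y).
Proof.
move=> x2; rewrite /sphere_dist /=.
have ex := enorm_gt0 x0; have ey := enorm_gt0 y0.
have -> : (enorm x)^-1 *: x - (enorm y)^-1 *: y =
    (enorm x)^-1 *: (x - y) + ((enorm x)^-1 - (enorm y)^-1) *: y.
  by rewrite scalerBr scalerBl addrA subrK.
apply: le_trans (ler_enormD _ _) _; rewrite !enormZ.
rewrite ger0_norm ?invr_ge0 ?(ltW ex)//.
have -> : `|(enorm x)^-1 - (enorm y)^-1| * enorm y =
    (enorm x)^-1 * `|enorm y - enorm x|.
  have e : ((enorm x)^-1 - (enorm y)^-1) * enorm y = (enorm x)^-1 * (enorm y - enorm x).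
    by field; rewrite !gt_eqF.
  by have := congr1 Num.norm e; rewrite !normrM (gtr0_norm ey) normfV (gtr0_norm ex).
have i2 : (enorm x)^-1 <= 2 by rewrite -[2]invrK lef_pV2 ?posrE.
have := ler_enorm_dist y x; rewrite (enormBC y) => h.
rewrite -mulrDr; apply: (@le_trans _ _ (2 * (enorm (x - y) + `|enorm y - enorm x|))).
  by rewrite ler_wpM2r// addr_ge0// enorm_ge0.
lra.
Qed.

Lemma directionZ (c : R) (x : T) (x0 : x != 0) (cx0 : c *: x != 0) : 0 < c ->
  direction cx0 = direction x0.
Proof.
move=> c0; apply: val_inj => /=.
rewrite enormZ gtr0_norm// scalerA invfM mulrAC mulVf ?mul1r//.
by rewrite gt_eqF.
Qed.

Hypothesis Omega_holder :
  holder_continuous (@sphere_dist R d) (@grass_dist R l k) Omega.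
Hypothesis Omega_canceling : canceling Omega.

Lemma bundle_symbol : exists alpha : R, exists F : 'I_l -> 'I_l -> T -> R[i],
  [/\ 0 < alpha, forall a b, holder_bump alpha (F a b),
   forall a b, cintegral (F a b) = 0, forall a b, F a b 0 = 0 &
   forall (s : R) (x : T) (x0 : x != 0) (v : 'rV[R[i]]_l), 0 < s ->
     v \in val (Omega (direction x0)) ->
     \sum_a \sum_b v ord0 a * conjc (v ord0 b) * F a b (s *: x) =
     (cutoff (s *: x) * \sum_b sqnorm (v ord0 b))%:C].
Proof.
have [alpha [C [a0 hC]]] := Omega_holder.
(* The cutoff is only Lipschitz, so the exponent is lowered to at most 1; at distances at most 1
   this weakens the Hoelder bound of Omega. *)
pose al := Num.min alpha 1.
have al0 : 0 < al by rewrite lt_min a0 ltr01.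
have al1 : al <= 1 by rewrite ge_min lexx orbT.
have hP (x y : T) a b : 2^-1 <= enorm x -> 2^-1 <= enorm y -> enorm (x - y) <= 4^-1 ->
    norm1 (bundle_proj x a b - bundle_proj y a b) <= 8 * `|C| * enorm (x - y) `^ al.
  move=> x2 y2 xy.
  have x0 : x != 0 by apply: enorm_neq0; lra.
  have y0 : y != 0 by apply: enorm_neq0; lra.
  have dd := direction_dist x0 y0 x2.
  (* The radius 1/4 is what the factor 4 of [direction_dist] leaves, since the Hoelder hypothesis
     speaks only of distances up to 1. *)
  have d1 : sphere_dist (direction x0) (direction y0) <= 1 by lra.
  have d0 : 0 <= sphere_dist (direction x0) (direction y0) by exact: enorm_ge0.
  have := hC _ _ d1; rewrite /grass_dist -!bundle_projE => h.
  have := norm1_hs_norm (bundle_proj x - bundle_proj y) a b; rewrite !mxE => h2.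
  have e0 := enorm_ge0 (x - y).
  set t := sphere_dist _ _ in dd d1 d0 h.
  have t1 : t `^ alpha <= t `^ al.
    have [->|tn0] := eqVneq t 0; first by rewrite !powR0 ?gt_eqF.
    by rewrite ger_powR// ?ge_min ?lexx// lt_neqAle eq_sym tn0 d0.
  have t2 : t `^ al <= 4 * enorm (x - y) `^ al.
    apply: (@le_trans _ _ ((4 * enorm (x - y)) `^ al)).
      by rewrite ge0_ler_powR ?nnegrE ?(ltW al0) ?mulr_ge0.
    rewrite (powRM _ (ler0n R 4) e0); apply: ler_wpM2r; first exact: powR_ge0.
    by rewrite -{2}[4]powRr1// ler_powR// ler1n.
  have : C * t `^ alpha <= `|C| * (4 * enorm (x - y) `^ al).
    apply: (@le_trans _ _ (`|C| * t `^ alpha)).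
      by rewrite ler_wpM2r ?powR_ge0// ler_norm.
    exact: (ler_wpM2l (normr_ge0 C) (le_trans t1 t2)).
  move=> h3; apply: le_trans h2 _; apply: le_trans (ler_wpM2l (ler0n R 2) (le_trans h h3)) _.
  by rewrite le_eqVlt; apply/orP; left; apply/eqP; ring.
(* The annulus contains the unit sphere, where each point is its own direction; u therefore lies in
   all fibres and the canceling condition applies. *)
have canP (u : 'rV[R[i]]_l) : (forall x, 1 <= enorm x -> enorm x <= 2 ->
    u *m bundle_proj x = u) -> u = 0.
  move=> hu; suff : [set 0] u by [].
  rewrite -Omega_canceling => z _ /=.
  have z1 : enorm (val z) = 1 by apply/eqP; exact: (valP z).
  have z0 : val z != 0 by apply: enorm_neq0; rewrite z1.
  have -> : z = direction z0 by apply: val_inj; rewrite /= z1 invr1 scale1r.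
  by apply/mem_orthoproj; rewrite -bundle_projE; apply: hu; rewrite z1// ler1n.
have C80 : 0 <= 8 * `|C| by rewrite mulr_ge0.
have [F [F1 F2 F0 F3]] := compensated_symbol al0 al1 C80 bundle_proj_hermitian hP canP.
exists al, F; split => // s x x0 v s0 vx.
have sx0 : s *: x != 0 by rewrite scaler_eq0 negb_or gt_eqF.
apply: F3; rewrite (bundle_projE sx0) (directionZ x0 sx0 s0).
exact/mem_orthoproj.
Qed.

End BundleSymbol.

(** * The energy estimate *)

Section DyadicEnergy.
Variables (R : realType) (n : nat).
Local Notation T := 'rV[R]_n.
Local Notation mu := (lebesgue_rV R n).

(** The weights are the Jacobians of the dilations: with them the transform is the plain sum of the
    f^(2^i x / c), and summing a bump over scales imitates |x|^-n. The parameter c sets the largest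
    dilation factor. *)
Definition dyadic_sum (N : nat) (c : R) (f : T -> R[i]) : T -> R[i] :=
  fun x => \sum_(i < N) ((c / 2 ^+ i) ^+ n)%:C * f ((c / 2 ^+ i) *: x).

Lemma dyadic_scale_gt0 (c : R) i : 0 < c -> 0 < c / 2 ^+ i.
Proof. by move=> c0; rewrite divr_gt0// exprn_gt0. Qed.

Lemma cintegrable_dyadic_sum N c f : 0 < c -> cintegrable f ->
  cintegrable (dyadic_sum N c f).
Proof.
move=> c0 fi; apply: cintegrable_sum => i; apply: cintegrableZ.
have := cintegrable_affine 0 (dyadic_scale_gt0 i c0) fi.
by under eq_fun do rewrite addr0.
Qed.

(** By [kernel_bound] at the point x / c, the transform of the dyadic sum is bounded by a constant
    independent of N and c, and [fourier_bilinear] is applied with that constant as K. *)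
Lemma dyadic_bilinear (alpha : R) f (s : R) : 0 < alpha -> holder_bump alpha f ->
  pi <= `|s| -> cintegral f = 0 ->
  exists2 C : R, 0 <= C & forall N c u v, 0 < c -> cintegrable u -> cintegrable v ->
    norm1 (cintegral (fun z => dyadic_sum N c f z *
      (fourier_kernel s u z * conjc (fourier_kernel s v z)))) <=
    C * (\int[mu]_x norm1 (u x) * \int[mu]_x norm1 (v x)).
Proof.
move=> a0 hf spi f0; have [C hC] := kernel_bound a0 hf spi f0.
have C0 : 0 <= C by have := hC 0%N 0; rewrite big_ord0.
have fi := cintegrable_holder_bump a0 hf.
exists C => // N c u v c0 ui vi.
have mi := cintegrable_dyadic_sum N c0 fi.
have mK x : norm1 (fourier_kernel s (dyadic_sum N c f) x) <= cst C x.
  have -> : fourier_kernel s (dyadic_sum N c f) x =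
      \sum_(i < N) fourier_kernel s f (2 ^+ i *: (c^-1 *: x)).
    have sc i : cintegrable (fun y : T => ((c / 2 ^+ i) ^+ n)%:C * f ((c / 2 ^+ i) *: y)).
      apply: cintegrableZ; have := cintegrable_affine 0 (dyadic_scale_gt0 i c0) fi.
      by under eq_fun do rewrite addr0.
    rewrite /fourier_kernel /dyadic_sum.
    under eq_fun do rewrite mulr_sumr.
    rewrite cintegral_sum; last by move=> i; exact: cintegrable_kernel.
    apply: eq_bigr => i _.
    rewrite -/(fourier_kernel s f _) scalerA (_ : _ / c = (c / 2 ^+ i)^-1); last first.
      by rewrite invfM invrK mulrC.
    rewrite -(fourier_scale s x (dyadic_scale_gt0 i c0) fi) /fourier_kernel -cintegralZ.
      by congr cintegral; apply/funext => y; rewrite mulrCA.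
    apply: cintegrable_kernel.
    have := cintegrable_affine 0 (dyadic_scale_gt0 i c0) fi.
    by under eq_fun do rewrite addr0.
  by apply: le_trans (norm1_sum _ _) _; exact: hC.
have := fourier_bilinear mi ui vi (measurable_cst C) mK.
rewrite -lee_fin => /le_trans; apply.
have iu := cintegrable_norm1 ui; have iv := cintegrable_norm1 vi.
have mv := measurable_norm1 vi.1; have mu' := measurable_norm1 ui.1.
have fE w : cintegrable w -> (\int[mu]_x (norm1 (w x))%:E = (\int[mu]_x norm1 (w x))%:E)%E.
  by move=> wi; rewrite /Rintegral fineK// (integrable_fin_num measurableT (cintegrable_norm1 wi)).
under eq_integral => x _.
  rewrite (_ : (fun y => _) = (fun y => (norm1 (u x) * C)%:E * (norm1 (v y))%:E)%E); last first.
    by apply/funext => y; rewrite -EFinM mulrAC.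
  rewrite ge0_integralZl//; last 3 first.
  - exact/measurable_EFinP.
  - by move=> y _; rewrite lee_fin norm1_ge0.
  - by rewrite lee_fin mulr_ge0// norm1_ge0.
  rewrite (fE v vi) -EFinM mulrAC.
  over.
rewrite /=.
under eq_integral do rewrite -mulrA mulrC EFinM.
rewrite ge0_integralZl//; last 3 first.
- exact/measurable_EFinP.
- by move=> y _; rewrite lee_fin norm1_ge0.
- by rewrite lee_fin mulr_ge0// -lee_fin -fE//; apply: integral_ge0 => y _; rewrite lee_fin norm1_ge0.
by rewrite (fE u ui) -EFinM lee_fin (mulrC _ C) -mulrA (mulrC (Rintegral _ _ _)).
Qed.

Lemma dyadic_interval (M : nat) (r : R) : 1 <= r -> r <= 2 ^+ M ->
  exists2 i : nat, (i <= M)%N & 2 ^+ i <= r <= 2 ^+ i.+1.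
Proof.
move=> r1; elim: M => [|M IH] rM.
  by exists 0%N => //; rewrite expr0 r1/= (le_trans rM)// expr0 expr1 ler1n.
have [/IH[i iM h]|h] := leP r (2 ^+ M); first by exists i => //; exact: leqW.
by exists M => //; rewrite (ltW h) rM.
Qed.

(** The factors 2^J / 2^i with i <= 2 J run from 2^J down to 2^-J, so one of them, t, brings t |x|
    into [1, 2]. There the cutoff is at least 1/2 and t^n >= |x|^-n; the other terms are
    nonnegative. *)
Lemma dyadic_cutoff_ge (J : nat) (x : T) : 2^-1 ^+ J <= enorm x -> enorm x <= 2 ^+ J ->
  (enorm x ^+ n)^-1 / 2 <=
  \sum_(i < J.*2.+1) (2 ^+ J / 2 ^+ i) ^+ n * cutoff ((2 ^+ J / 2 ^+ i) *: x).
Proof.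
move=> h1 h2.
have p0 k : 0 < (2 : R) ^+ k by rewrite exprn_gt0.
have ex : 0 < enorm x by apply: lt_le_trans h1; rewrite exprn_gt0.
have [i iM /andP[i1 i2]] : exists2 i : nat, (i <= J.*2)%N &
    2 ^+ i <= 2 ^+ J * enorm x <= 2 ^+ i.+1.
  apply: dyadic_interval.
    have := ler_wpM2l (ltW (p0 J)) h1.
    by rewrite exprVn divff// gt_eqF.
  by rewrite -addnn exprD ler_pM2l.
have iM' : (i < J.*2.+1)%N by [].
rewrite (bigD1 (Ordinal iM'))//=; apply: ler_wpDr.
  apply: sumr_ge0 => j _; apply: mulr_ge0; last exact: cutoff_ge0.
  by rewrite exprn_ge0// ltW// divr_gt0.
have s0 : 0 < 2 ^+ J / 2 ^+ i :> R by rewrite divr_gt0.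
have e : enorm ((2 ^+ J / 2 ^+ i) *: x) = 2 ^+ J * enorm x / 2 ^+ i.
  by rewrite enormZ gtr0_norm// mulrAC.
have e1 : 1 <= enorm ((2 ^+ J / 2 ^+ i) *: x) by rewrite e ler_pdivlMr// mul1r.
have e2 : enorm ((2 ^+ J / 2 ^+ i) *: x) <= 2.
  by rewrite e ler_pdivrMr// -exprS.
apply: ler_pM; rewrite ?invr_ge0 ?exprn_ge0 ?(ltW ex)//; last exact: cutoff_ge_half.
rewrite -[enorm x ^- n]exprVn; apply: lerXn2r; rewrite ?nnegrE ?invr_ge0 ?(ltW ex) ?(ltW s0)//.
rewrite -[_^-1]mul1r ler_pdivrMr//.
by move: e1; rewrite enormZ gtr0_norm.
Qed.

End DyadicEnergy.

(** * The weighted L^2 bound for transforms with values in the fibres *)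

Section BundleEnergy.
Variables (R : realType) (d l k : nat) (Omega : sphere R d -> grassmannian R l k).
Local Notation T := 'rV[R]_d.
Local Notation mu := (lebesgue_rV R d).
Hypothesis Omega_holder :
  holder_continuous (@sphere_dist R d) (@grass_dist R l k) Omega.
Hypothesis Omega_canceling : canceling Omega.

(** On the fibres the quadratic form of the symbol equals the cutoff times the squared length, so
    the left side is the sum over entries (a, b) of the bilinear pairings that [dyadic_bilinear]
    bounds. *)
Lemma dyadic_energy (s : R) : pi <= `|s| ->
  exists2 C : R, 0 <= C & forall (g : 'I_l -> T -> R[i]) (N : nat) (c : R), 0 < c ->
    (forall b, cintegrable (g b)) ->
    (forall x (x0 : x != 0),
      (\row_b fourier_kernel s (g b) x) \in val (Omega (direction x0))) ->
    (\int[mu]_x ((\sum_(i < N) (c / 2 ^+ i) ^+ d * cutoff ((c / 2 ^+ i) *: x)) *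
      \sum_b sqnorm (fourier_kernel s (g b) x))%:E <=
     (C * (\sum_b \int[mu]_x norm1 (g b x)) ^+ 2)%:E)%E.
Proof.
move=> spi.
have [alpha [F [a0 hF F0 F00 hv]]] := bundle_symbol Omega_holder Omega_canceling.
have /choice[C hC] : forall p : 'I_l * 'I_l, exists C : R, 0 <= C /\
    forall N c u v, 0 < c -> cintegrable u -> cintegrable v ->
    norm1 (cintegral (fun z => dyadic_sum N c (F p.1 p.2) z *
      (fourier_kernel s u z * conjc (fourier_kernel s v z)))) <=
    C * (\int[mu]_x norm1 (u x) * \int[mu]_x norm1 (v x)).
  move=> p; have [C C0 hC] := dyadic_bilinear a0 (hF p.1 p.2) spi (F0 p.1 p.2).
  by exists C.
exists (\sum_a \sum_b C (a, b)).
  by apply: sumr_ge0 => a _; apply: sumr_ge0 => b _; have [] := hC (a, b).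
move=> g N c c0 gi hg.
pose G x := (\sum_(i < N) (c / 2 ^+ i) ^+ d * cutoff ((c / 2 ^+ i) *: x)) *
      \sum_b sqnorm (fourier_kernel s (g b) x).
pose E a b z := dyadic_sum N c (F a b) z *
  (fourier_kernel s (g a) z * conjc (fourier_kernel s (g b) z)).
have iE a b : cintegrable (E a b).
  rewrite /E; under eq_fun do rewrite mulrC.
  apply: (@cintegrable_boundedM _ _ _ _
    ((2 * \int[mu]_y norm1 (g a y)) * (2 * \int[mu]_y norm1 (g b y)))).
  - by apply: cmeasurableM; [|apply: cmeasurable_conj]; exact: cmeasurable_fourier.
  - move=> x; apply: le_trans (ler_norm1M _ _) _; rewrite norm1_conj.
    by apply: ler_pM; rewrite ?norm1_ge0//; exact: norm1_fourier.
  - by apply: cintegrable_dyadic_sum => //; exact: cintegrable_holder_bump a0 (hF a b).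
have GE z : \sum_a \sum_b E a b z = (G z)%:C.
  (* At the origin the fibre condition says nothing; both sides vanish because the symbol and the
     cutoff are 0 there. *)
  have [->|z0] := eqVneq z 0.
    rewrite /G [X in X * _]big1 ?mul0r; last first.
      by move=> i _; rewrite scaler0 cutoff_small ?mulr0// enorm0 invr_gt0.
    rewrite big1// => a _; rewrite big1// => b _; rewrite /E /dyadic_sum big1 ?mul0r//.
    by move=> i _; rewrite scaler0 F00 mulr0.
  transitivity (\sum_(i < N) ((c / 2 ^+ i) ^+ d)%:C * \sum_a \sum_b
      (fourier_kernel s (g a) z * conjc (fourier_kernel s (g b) z)) *
      F a b ((c / 2 ^+ i) *: z)).
    under [RHS]eq_bigr => i _.
      rewrite mulr_sumr; under eq_bigr => a _ do rewrite mulr_sumr.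
      over.
    rewrite [RHS]exchange_big; apply: eq_bigr => a _.
    rewrite [RHS]exchange_big; apply: eq_bigr => b _.
    by rewrite /E /dyadic_sum mulr_suml; apply: eq_bigr => i _; ring.
  rewrite /G mulr_suml rmorph_sum; apply: eq_bigr => i _.
  have := hv _ z z0 _ (dyadic_scale_gt0 i c0) (hg z z0).
  under eq_bigr => a _ do under eq_bigr => b _ do rewrite !mxE.
  move=> ->; rewrite -rmorphM /= mulrA.
  by congr (_%:C); congr (_ * _); apply: eq_bigr => b _; rewrite mxE.
have iG : cintegrable (fun z => \sum_a \sum_b E a b z).
  by apply: cintegrable_sum => a; exact: cintegrable_sum.
have -> : (\int[mu]_x (G x)%:E = (complex.Re (cintegral (fun z => \sum_a \sum_b E a b z)))%:E)%E.
  rewrite /cintegral /= /Rintegral fineK; last exact: integrable_fin_num (cintegrable_Re iG).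
  by apply: eq_integral => x _; rewrite GE.
rewrite lee_fin; apply: le_trans (ler_norm _) _; apply: le_trans (ler_norm1_Re _) _.
rewrite cintegral_sum; last by move=> a; exact: cintegrable_sum.
apply: le_trans (norm1_sum _ _) _; rewrite mulr_suml; apply: ler_sum => a _.
rewrite cintegral_sum//.
apply: le_trans (norm1_sum _ _) _; rewrite mulr_suml; apply: ler_sum => b _.
have [C0 h] := hC (a, b); apply: le_trans (h N c _ _ c0 (gi a) (gi b)) _.
have I0 b' : 0 <= \int[mu]_x norm1 (g b' x).
  by apply: Rintegral_ge0 => x _; exact: norm1_ge0.
have le b' : \int[mu]_x norm1 (g b' x) <= \sum_b \int[mu]_x norm1 (g b x).
  by rewrite (bigD1 b')//= lerDl sumr_ge0.
by rewrite ler_wpM2l// expr2; apply: ler_pM.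
Qed.

Lemma sqnormZ (r : R) (z : R[i]) : sqnorm (r%:C * z) = r ^+ 2 * sqnorm z.
Proof. by rewrite /sqnorm !ReImE /= !mul0r subr0 addr0 !exprMn mulrDr. Qed.

(** On the annulus [A J] the weight |x|^-d is at most twice the dyadic sum of cutoffs with c = 2^J,
    and the resulting bound is the same for every J. *)
Lemma riesz_energy (s : R) : (0 < d)%N -> pi <= `|s| ->
  exists2 C : R, 0 <= C & forall (g : 'I_l -> T -> R[i]),
    (forall b, cintegrable (g b)) ->
    (forall x (x0 : x != 0),
      (\row_b fourier_kernel s (g b) x) \in val (Omega (direction x0))) ->
    (\int[mu]_x (\sum_b sqnorm
       ((enorm x `^ (- (d%:R / 2)))%:C * fourier_kernel s (g b) x))%:E <=
     (C * (\sum_b \int[mu]_x norm1 (g b x)) ^+ 2)%:E)%E.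
Proof.
move=> d0 spi; have [C C0 hC] := dyadic_energy spi.
exists (2 * C); first by rewrite mulr_ge0.
move=> g gi hg.
pose S x := \sum_b sqnorm (fourier_kernel s (g b) x).
pose rho (x : T) := (enorm x `^ (- (d%:R / 2))) ^+ 2.
have S0 x : 0 <= S x by apply: sumr_ge0 => b _; exact: sqnorm_ge0.
have mS : measurable_fun setT S.
  by apply: measurable_sum => b; apply: measurable_sqnorm; exact: cmeasurable_fourier.
have men := @measurable_enorm R d.
have mrho : measurable_fun setT rho.
  apply: measurable_funX; apply: (measurableT_comp (measurable_powR _)); exact: men.
have mH : measurable_fun setT (fun x => (rho x * S x)%:E).
  by apply/measurable_EFinP; exact: measurable_funM.
have H0 x : (0 <= (rho x * S x)%:E)%E by rewrite lee_fin mulr_ge0// sqr_ge0.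
under eq_integral => x _.
  rewrite (_ : \sum_b _ = rho x * S x); last first.
    by rewrite mulr_sumr; apply: eq_bigr => b _; rewrite sqnormZ.
  over.
pose A (J : nat) := [set x : T | 2^-1 ^+ J <= enorm x] `&` [set x : T | enorm x <= 2 ^+ J].
have mA J : measurable (A J).
  apply: measurableI.
  - have := men measurableT _ (measurable_itv `[2^-1 ^+ J, +oo[); rewrite setTI.
    by congr measurable; apply/seteqP; split=> x /=; rewrite in_itv/= andbT.
  - have := men measurableT _ (measurable_itv `]-oo, 2 ^+ J]); rewrite setTI.
    by congr measurable; apply/seteqP; split=> x /=; rewrite in_itv/=.
have ndA : nondecreasing_seq A.
  apply/nondecreasing_seqP => J; apply/subsetPset => x [/= h1 h2]; split => /=.
  - apply: le_trans h1; rewrite exprS ler_piMl ?exprn_ge0//; lra.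
  - apply: le_trans h2 _; rewrite exprS ler_peMl ?exprn_ge0//; lra.
(* Only the origin lies outside all annuli. There [powR] returns 0, the exponent - d/2 being nonzero
   for d > 0. *)
have off x : ~ (\bigcup_J A J) x -> rho x = 0.
  move=> nx; have [->|x0] := eqVneq x 0.
    rewrite /rho enorm0 powR0 ?expr0n// oppr_eq0 mulf_neq0// ?pnatr_eq0 -?lt0n//.
  exfalso; apply: nx.
  have ex := enorm_gt0 x0.
  have pow (a : R) : 0 < a -> a <= 2 ^+ Num.bound a.
    move=> a0; apply: le_trans (ltW (archi_boundP (ltW a0))) _.
    by rewrite -natrX ler_nat ltnW// ltn_expl.
  pose J := maxn (Num.bound (enorm x)) (Num.bound (enorm x)^-1).
  have mono i : (i <= J)%N -> (2 : R) ^+ i <= 2 ^+ J.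
    by move=> iJ; rewrite ler_weXn2l// ler1n.
  exists J => //; split => /=.
  - rewrite exprVn -[enorm x]invrK lef_pV2 ?posrE ?invr_gt0 ?exprn_gt0//.
    by apply: le_trans (pow _ _) (mono _ (leq_maxr _ _)); rewrite invr_gt0.
  - exact: le_trans (pow _ ex) (mono _ (leq_maxl _ _)).
have mG J : measurable_fun setT (fun x : T =>
    (\sum_(i < J.*2.+1) (2 ^+ J / 2 ^+ i) ^+ d * cutoff ((2 ^+ J / 2 ^+ i) *: x)) * S x).
  apply: measurable_funM => //; apply: measurable_sum => i; apply: measurable_funM => //.
  exact: (measurableT_comp (cmeasurable_holder_bump ltr01
    (holder_bump_cutoff d ltr01 (lexx 1))).1 (measurable_scale _)).
have G0 J (x : T) : 0 <= (\sum_(i < J.*2.+1) (2 ^+ J / 2 ^+ i) ^+ d *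
    cutoff ((2 ^+ J / 2 ^+ i) *: x)) * S x.
  rewrite mulr_ge0// sumr_ge0// => i _.
  by rewrite mulr_ge0 ?cutoff_ge0// exprn_ge0// ltW// dyadic_scale_gt0// exprn_gt0.
have bdA J : (\int[mu]_(x in A J) (rho x * S x)%:E <=
    (2 * C * (\sum_b \int[mu]_x norm1 (g b x)) ^+ 2)%:E)%E.
  have p0 : 0 < (2 : R) ^+ J by rewrite exprn_gt0.
  have := hC g J.*2.+1 (2 ^+ J) p0 gi hg.
  move=> /(lee_wpmul2l (ler0n R 2 : (0 <= 2%:E)%E)) h; rewrite -mulrA EFinM.
  apply: le_trans h; rewrite -ge0_integralZl//; last 2 first.
  - exact/measurable_EFinP.
  - by move=> x _; rewrite lee_fin G0.
  apply: (@le_trans _ _ (\int[mu]_(x in A J) (2%:E * ((\sum_(i < J.*2.+1)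
      (2 ^+ J / 2 ^+ i) ^+ d * cutoff ((2 ^+ J / 2 ^+ i) *: x)) * S x)%:E))%E); last first.
    apply: ge0_subset_integral => //.
    + by apply/measurable_EFinP; apply: measurable_funM.
    + by move=> x _; rewrite -EFinM lee_fin mulr_ge0.
  apply: ge0_le_integral => //.
  - exact: measurable_funTS.
  - by apply: measurable_funTS; apply/measurable_EFinP; apply: measurable_funM.
  - move=> x [/= h1 h2]; rewrite -EFinM lee_fin mulrA ler_wpM2r//.
    rewrite mulrC -ler_pdivrMr//; apply: le_trans (dyadic_cutoff_ge h1 h2).
    have ex : 0 < enorm x by apply: lt_le_trans h1; rewrite exprn_gt0.
    rewrite ler_wpM2r ?invr_ge0// le_eqVlt; apply/orP; left; apply/eqP.
    rewrite /rho -powR_mulrn ?powR_ge0// -powRrM mulNr divfK ?pnatr_eq0//.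
    by rewrite powRN powR_mulrn// ltW.
have -> : (\int[mu]_x (rho x * S x)%:E = \int[mu]_(x in \bigcup_J A J) (rho x * S x)%:E)%E.
  rewrite [RHS]integral_mkcond; apply: eq_integral => x _; rewrite patchE.
  case: ifPn => // /negP nx; rewrite off ?mul0r// => xA; apply: nx; exact/mem_set.
have cv := ge0_nondecreasing_set_cvg_integral ndA mA
  (fun J => measurable_funTS mH) (fun J x _ => H0 x).
rewrite -(cvg_lim _ (cv _))//; apply: lime_le.
  by apply/cvg_ex; eexists; exact: cv.
exact: nearW.
Qed.

End BundleEnergy.

(** * Schwartz functions and vector-valued norms *)

Section SchwartzFunctions.
Variables (R : realType) (n : nat).
Local Notation T := 'rV[R]_n.

(** Decay of orders 0 and 2 n, as the definition of Schwartz functions gives it, is thereby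
    converted into domination by the integrable [cauchy_prod]. *)
Lemma inv_cauchy_prod_le (x : T) : (cauchy_prod x)^-1 <= 2 ^+ n * (1 + enorm x ^+ (2 * n)).
Proof.
have e0 := enorm_ge0 x.
have le1 : (cauchy_prod x)^-1 <= (1 + enorm x ^+ 2) ^+ n.
  rewrite /cauchy_prod -prodfV -[X in _ ^+ X](card_ord n) -prodr_const.
  apply: ler_prod => i _; rewrite invrK addr_ge0 ?sqr_ge0//= lerD2l.
  rewrite -[x ord0 i ^+ 2]real_normK ?num_real//.
  by rewrite lerXn2r ?nnegrE// enorm_coord.
apply: le_trans le1 _; rewrite exprM.
have [h|h] := leP (enorm x ^+ 2) 1.
  apply: (@le_trans _ _ (2 ^+ n)).
    by rewrite lerXn2r ?nnegrE ?addr_ge0 ?sqr_ge0//; lra.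
  by rewrite ler_peMr ?exprn_ge0// lerDl exprn_ge0// sqr_ge0.
apply: (@le_trans _ _ ((2 * enorm x ^+ 2) ^+ n)).
  by rewrite lerXn2r ?nnegrE ?addr_ge0 ?mulr_ge0 ?sqr_ge0//; lra.
by rewrite exprMn ler_wpM2l ?exprn_ge0// lerDr.
Qed.

Lemma real_schwartz_bound (f : T -> R) : real_schwartz f ->
  measurable_fun setT f /\ exists2 C, 0 <= C & forall x, `|f x| <= C * cauchy_prod x.
Proof.
move=> /(_ [::]) [/= df bd]; split.
  by apply: continuous_measurable_rV => x; exact: differentiable_continuous.
have [C0 h0] := bd 0%N; have [C1 h1] := bd (2 * n)%N.
exists (2 ^+ n * (C0 + C1)).
  rewrite mulr_ge0 ?exprn_ge0// addr_ge0//.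
    by apply: le_trans (h0 0); rewrite mulr_ge0 ?exprn_ge0 ?enorm_ge0.
  by apply: le_trans (h1 0); rewrite mulr_ge0 ?exprn_ge0 ?enorm_ge0.
move=> x; rewrite -ler_pdivrMr ?cauchy_prod_gt0//.
apply: le_trans (ler_wpM2l (normr_ge0 _) (inv_cauchy_prod_le x)) _.
have := h0 x; have := h1 x; rewrite expr0 mul1r => ? ?.
by rewrite mulrCA ler_wpM2l ?exprn_ge0// mulrDr mulr1 lerD// mulrC.
Qed.

Lemma cauchy_prod_le1 (x : T) : cauchy_prod x <= 1.
Proof.
apply: prodr_ile1 => i _; rewrite invr_ge0 addr_ge0 ?sqr_ge0//=.
by rewrite invf_le1 ?lerDl ?sqr_ge0// ltr_pwDl// sqr_ge0.
Qed.

Lemma schwartz_cintegrable (phi : T -> R[i]) : schwartz phi ->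
  cintegrable phi /\ exists B, forall x, norm1 (phi x) <= B.
Proof.
move=> [/real_schwartz_bound[m1 [C1 C10 h1]] /real_schwartz_bound[m2 [C2 C20 h2]]].
have h x : norm1 (phi x) <= (C1 + C2) * cauchy_prod x.
  by rewrite mulrDl lerD.
split; last first.
  exists (C1 + C2) => x; apply: le_trans (h x) _.
  by rewrite ler_piMr ?addr_ge0// cauchy_prod_le1.
have mc := @measurable_cauchy_prod R n.
apply: (@cintegrable_le _ _ _ (fun x => (C1 + C2) * cauchy_prod x)) => //.
- exact: measurable_funM.
- under eq_integral do rewrite EFinM.
  rewrite ge0_integralZl//; first by apply: lte_mul_pinfty => //;
    [rewrite lee_fin addr_ge0|exact: integral_cauchy_prod_lty].
  + exact/measurable_EFinP.
  + by move=> x _; rewrite lee_fin ltW// cauchy_prod_gt0.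
  + by rewrite lee_fin addr_ge0.
Qed.

End SchwartzFunctions.

(** * Norms of vector-valued functions against those of their coordinates *)

Section VectorLp.
Variables (R : realType) (d l : nat).
Local Notation mu := (lebesgue_rV R d).
Implicit Types f g : 'rV[R]_d -> 'rV[R[i]]_l.

Lemma hs_norm_row (v : 'rV[R[i]]_l) : hs_norm v ^+ 2 = \sum_b sqnorm (v ord0 b).
Proof.
rewrite /hs_norm sqr_sqrtr ?big_ord1// .
by apply: sumr_ge0 => b _; exact: sqnorm_ge0.
Qed.

Lemma hs_norm_ge0 (v : 'rV[R[i]]_l) : 0 <= hs_norm v.
Proof. exact: sqrtr_ge0. Qed.

Lemma measurable_hs_norm f : (forall b, cmeasurable (fun x => f x ord0 b)) ->
  measurable_fun setT (fun x => hs_norm (f x)).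
Proof.
move=> mf; rewrite /hs_norm; apply: (measurableT_comp
  (continuous_measurable_fun (@sqrt_continuous R))) => /=.
under eq_fun do rewrite big_ord1.
by apply: measurable_sum => b; exact: measurable_sqnorm.
Qed.

Lemma Lp_norm1E f : Lp_norm 1%:E f = (\int[mu]_x (hs_norm (f x))%:E)%E.
Proof.
rewrite /Lp_norm Lnorm1; apply: eq_integral => x _.
by rewrite /= ger0_norm ?hs_norm_ge0.
Qed.

Lemma Lp_norm2_le f (K : R) : 0 <= K ->
  (\int[mu]_x (\sum_b sqnorm (f x ord0 b))%:E <= (K ^+ 2)%:E)%E ->
  (Lp_norm 2%:E f <= K%:E)%E.
Proof.
move=> K0 h; rewrite /Lp_norm unlock.
have -> : (\int[mu]_x `|(hs_norm (f x))%:E| `^ 2 =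
    \int[mu]_x (\sum_b sqnorm (f x ord0 b))%:E)%E.
  apply: eq_integral => x _; rewrite /= ger0_norm ?hs_norm_ge0//.
  by rewrite powR_mulrn ?hs_norm_ge0// hs_norm_row.
have -> : K%:E = ((K ^+ 2)%:E `^ 2^-1)%E.
  by rewrite poweR_EFin -powR_mulrn// -powRrM mulfV ?powRr1.
apply: gt0_ler_poweR => //; rewrite ?invr_ge0// in_itv/= ?leey ?andbT.
  by apply: integral_ge0 => x _; rewrite lee_fin sumr_ge0// => b _; exact: sqnorm_ge0.
by rewrite lee_fin sqr_ge0.
Qed.

Lemma cintegrable_in_L1 f b : in_Lp 1%:E f -> cintegrable (fun x => f x ord0 b).
Proof.
move=> [mf]; rewrite Lp_norm1E => i1.
have mh := measurable_hs_norm mf.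
apply: (@cintegrable_le _ _ _ (fun x => 2 * hs_norm (f x))) => //.
- exact: measurable_funM.
- by move=> x; exact: norm1_hs_norm.
- under eq_integral do rewrite EFinM.
  rewrite ge0_integralZl//; first exact: lte_mul_pinfty.
  + exact/measurable_EFinP.
  + by move=> x _; rewrite lee_fin hs_norm_ge0.
Qed.

Lemma sum_norm1_le_L1 f : in_Lp 1%:E f ->
  ((\sum_b \int[mu]_x norm1 (f x ord0 b))%:E <= (2 * l%:R)%:E * Lp_norm 1%:E f)%E.
Proof.
move=> fL1; have [mf] := fL1; rewrite Lp_norm1E => i1.
have mh := measurable_hs_norm mf.
have I0 : (0 <= \int[mu]_x (hs_norm (f x))%:E)%E.
  by apply: integral_ge0 => x _; rewrite lee_fin hs_norm_ge0.
have /fineK <- : (\int[mu]_x (hs_norm (f x))%:E)%E \is a fin_num by rewrite ge0_fin_numE.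
set I := fine _.
have IE : (\int[mu]_x (hs_norm (f x))%:E = I%:E)%E by rewrite /I fineK// ge0_fin_numE.
rewrite -EFinM lee_fin (_ : 2 * l%:R * I = \sum_(b < l) 2 * I); last first.
  by rewrite sumr_const card_ord -mulr_natl; ring.
apply: ler_sum => b _; have [mb ib] := cintegrable_in_L1 b fL1.
rewrite -lee_fin /Rintegral fineK; last first.
  by rewrite ge0_fin_numE//; apply: integral_ge0 => x _; rewrite lee_fin norm1_ge0.
rewrite EFinM -IE -ge0_integralZl//; last 2 first.
- exact/measurable_EFinP.
- by move=> x _; rewrite lee_fin hs_norm_ge0.
apply: ge0_le_integral => //.
- by move=> x _; rewrite lee_fin norm1_ge0.
- by apply/measurable_EFinP; exact: measurable_norm1.
- by apply/measurable_EFinP; exact: measurable_funM.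
- by move=> x _; rewrite -EFinM lee_fin norm1_hs_norm.
Qed.

End VectorLp.

Theorem theorem1p1 (R : realType) (d l k : nat)
    (d_gt0 : (0 < d)%N) (l_gt0 : (0 < l)%N) (k_gt0 : (0 < k)%N)
    (k_le_l : (k <= l)%N)
    (Omega : sphere R d -> grassmannian R l k)
    (Omega_holder :
       holder_continuous (@sphere_dist R d) (@grass_dist R l k) Omega)
    (Omega_canceling : canceling Omega) :
  exists C : R, forall g : 'rV[R]_d -> 'rV[R[i]]_l, W1 Omega g ->
    exists f : 'rV[R]_d -> 'rV[R[i]]_l,
      [/\ riesz_potential_is (d%:R / 2) g f,
          in_Lp 2%:E f &
          (Lp_norm 2%:E f <= C%:E * Lp_norm 1%:E g)%E].
Proof.
(* Two frequencies occur: - 2 pi for the transform of g in the energy estimate, and 2 pi for the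
   inverse transform of the test functions in the definition of the Riesz potential. *)
have pi2 : pi <= `|- (2 * pi)| :> R.
  by rewrite normrN ger0_norm ?mulr_ge0 ?pi_ge0//; have := pi_ge0 R; lra.
have [C1 C10 energy] := riesz_energy Omega_holder Omega_canceling d_gt0 pi2.
have two_pi : 1 <= (2 * pi : R) ^+ 2.
  by have := pi_ge2 R; nra.
have [C2 C20 planch] := plancherel_extension d two_pi.
(* [C1] bounds the squared L^2 norm of the weighted transform and [C2] the passage back to physical
   space; the further factor 2 l compares the coordinatewise [norm1] integrals with the L^1 norm. *)
pose K := Num.sqrt (C2 * C1).
have K0 : 0 <= K by exact: sqrtr_ge0.
exists (K * (2 * l%:R)) => g [gL1 gOmega].
pose G b x := g x ord0 b.
have fourierE b x : fourier (G b) x = fourier_kernel (- (2 * pi)) (G b) x.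
  by rewrite /fourier /fourier_kernel; congr cintegral; apply/funext => y; rewrite mulNr dotrC.
have Gi b : cintegrable (G b) by exact: cintegrable_in_L1.
have GOmega x (x0 : x != 0) :
    (\row_b fourier_kernel (- (2 * pi)) (G b) x) \in val (Omega (direction x0)).
  rewrite (_ : \row_b _ = vfourier g x); first exact: gOmega.
  by apply/rowP => b; rewrite !mxE -fourierE.
have en := energy G Gi GOmega.
pose h b x := (enorm x `^ (- (d%:R / 2)))%:C * fourier_kernel (- (2 * pi)) (G b) x.
have mh b : cmeasurable (h b).
  apply: cmeasurableM; last exact: cmeasurable_fourier.
  apply: cmeasurable_real; apply: (measurableT_comp (measurable_powR _)).
  exact: measurable_enorm.
have mq b : measurable_fun setT (fun x => (sqnorm (h b x))%:E).
  by apply/measurable_EFinP; exact: measurable_sqnorm.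
have q0 b x : (0 <= (sqnorm (h b x))%:E)%E by rewrite lee_fin sqnorm_ge0.
have enS : (\sum_b \int[lebesgue_rV R d]_x (sqnorm (h b x))%:E <=
    (C1 * (\sum_b \int[lebesgue_rV R d]_x norm1 (G b x)) ^+ 2)%:E)%E.
  apply: le_trans en; rewrite -ge0_integral_sum//.
  by under eq_integral do rewrite sumEFin.
have ih b : (\int[lebesgue_rV R d]_x (sqnorm (h b x))%:E < +oo)%E.
  apply: (@le_lt_trans _ _ _ _ _ _ (ltry _)); apply: le_trans enS.
  rewrite (bigD1 b)//= leeDl//; apply: sume_ge0 => b' _.
  by apply: integral_ge0 => x _.
have /choice[F hF] b := planch (h b) (mh b) (ih b).
pose f x : 'rV[R[i]]_l := \row_b F b x.
have fE b : (fun x => f x ord0 b) = F b by apply/funext => x; rewrite mxE.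
have mF b : cmeasurable (F b) by have [] := hF b.
exists f.
have nf : (Lp_norm 2%:E f <= (K * \sum_b \int[lebesgue_rV R d]_x norm1 (G b x))%:E)%E.
  apply: Lp_norm2_le.
    rewrite mulr_ge0// sumr_ge0// => b _.
    by apply: Rintegral_ge0 => x _; exact: norm1_ge0.
  rewrite exprMn sqr_sqrtr ?mulr_ge0 ?(ltW C20)// -mulrA EFinM.
  under eq_integral do rewrite -sumEFin.
  rewrite ge0_integral_sum//; last 2 first.
  - move=> b; apply/measurable_EFinP; apply: measurable_sqnorm.
    by under eq_fun do rewrite mxE.
  - by move=> b x _; rewrite lee_fin sqnorm_ge0.
  apply: le_trans (lee_wpmul2l _ enS); last by rewrite lee_fin ltW.
  rewrite ge0_sume_distrr; last by move=> b _; apply: integral_ge0 => x _.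
  apply: lee_sum => b _; have [_ hb _] := hF b; apply: le_trans hb.
  by under eq_integral do rewrite mxE.
split.
(* Schwartz functions are bounded and integrable, so the multiplication formula characterising [F b]
   is exactly the identity of distributions to be proved. *)
- move=> b phi /schwartz_cintegrable[phii [B phiB]].
  have [_ _ hb] := hF b.
  rewrite fE {1}/distr_of (hb phi B phii phiB) /riesz_potential /distr_inv_fourier /distr_of.
  congr cintegral; apply/funext => x.
  by rewrite /h -fourierE.
- split; first by move=> b; have := mF b; rewrite -fE.
  by apply: le_lt_trans nf _; rewrite ltry.
- apply: le_trans nf _; rewrite !EFinM -muleA.
  apply: lee_wpmul2l; first by rewrite lee_fin.
  by rewrite -EFinM; exact: sum_norm1_le_L1.
Qed.
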